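(* Let $\omega\in\mathcal{D}$. Then the Bergman projection $P_\omega:L^\infty\to\mathcal{B}$ is bounded and onto. Moreover, if $\alpha>0$ and $h\in\mathcal{B}$, then the function $$g_\alpha(z):=(1-|z|)^\alpha R^{\omega,\omega_\alpha}h(z),\qquad z\in\mathbb{D},$$ belongs to $L^\infty$ and $P_\omega(g_\alpha)=h$.
   Context: $\mathbb{D}=\{z\in\mathbb{C}:|z|<1\}$, $dA=\pi^{-1}dx\,dy$, $L^\infty=L^\infty(\mathbb{D},dA)$. $\mathcal{H}$ is the space of all analytic functions on $\mathbb{D}$. The Bloch space $\mathcal{B}$ consists of $f\in\mathcal{H}$ with $\|f\|_{\mathcal{B}}=\sup_{z\in\mathbb{D}}(1-|z|^2)|f'(z)|+|f(0)|<\infty$. A weight is a non-negative function integrable on $\mathbb{D}$ with respect to $dA$; it is radial if $\omega(z)=\omega(|z|)$. For a radial weight put $\widehat{\omega}(r)=\int_r^1\omega(s)\,ds$, and assume throughout that $\widehat{\omega}(r)>0$ for all $r\in[0,1)$. A radial weight $\omega$ is in $\widehat{\mathcal{D}}$ if there is $C>0$ with $\widehat{\omega}(r)\le C\,\widehat{\omega}\left(\frac{1+r}{2}\right)$ for all $r\in[0,1)$; it is in $\check{\mathcal{D}}$ if there are $K>1$ and $C'>1$ with $\widehat{\omega}(r)\ge C'\,\widehat{\omega}\left(1-\frac{1-r}{K}\right)$ for all $r\in[0,1)$. $\mathcal{D}=\widehat{\mathcal{D}}\cap\check{\mathcal{D}}$. For a radial weight $\omega$ and $\alpha>0$, $\omega_\alpha$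 denotes the weight $\omega_\alpha(r)=(1-r)^\alpha\omega(r)$. For a radial weight $\omega$ set $m_k(\omega)=2\int_0^1r^{2k+1}\omega(r)\,dr$. $B_z^\omega$ is the reproducing kernel at $z\in\mathbb{D}$ of the weighted Bergman space $A^2_\omega$ (analytic functions in $L^2(\mathbb{D},\omega\,dA)$); explicitly $B_z^\omega(\xi)=\sum_{k\ge0}\frac{1}{m_k(\omega)}(\overline{z}\xi)^k$. The Bergman projection is $P_\omega f(z)=\int_{\mathbb{D}}f(\xi)\overline{B_z^\omega(\xi)}\omega(\xi)\,dA(\xi)$, defined for $f\in L^1(\mathbb{D},\omega\,dA)$. For radial weights $\omega,\nu$ the operator $R^{\omega,\nu}:\mathcal{H}\to\mathcal{H}$ is the Taylor coefficient multiplier sending $f(z)=\sum_{k\ge0} f_kz^k$ to $R^{\omega,\nu}f(z)=\sum_{k\ge0}\frac{m_k(\omega)}{m_k(\nu)}f_kz^k$. *)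

(* Defs.v *)
From HB Require Import structures.
From mathcomp Require Import all_boot all_order all_algebra.
From mathcomp Require Import all_classical all_reals all_analysis.
From mathcomp Require Import ess_sup_inf.
From mathcomp.real_closed Require Export complex.

Set Implicit Arguments.
Unset Strict Implicit.
Unset Printing Implicit Defensive.

Import Order.TTheory GRing.Theory Num.Theory numFieldNormedType.Exports.

Local Open Scope classical_set_scope.
Local Open Scope ring_scope.
Local Open Scope complex_scope.

(* R[i] has no canonical topology of its own.  It receives the one induced by
   its modulus, as a normed space over itself, so that derivatives of functions
   R[i] -> R[i] are complex derivatives. *)
#[warnings="-redundant-canonical-projection"]
HB.instance Definition _ (R : realType) := NormedModule.copy R[i] R[i]^o.

(* The modulus as an element of R, whereas `|z| is an element of R[i]. *)
Notation cabs := ComplexField.Normc.normc.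

Section UnitDisc.
Context {R : realType}.

Definition disc : set R[i] := [set z | cabs z < 1].

(* Measurability and integration over the disc are expressed on R * R. *)
Definition ofR2 (p : measurableTypeR R * measurableTypeR R) : R[i] :=
  p.1 +i* p.2.

Definition disc2 : set (measurableTypeR R * measurableTypeR R) :=
  ofR2 @^-1` disc.

Lemma invpi_ge0 : 0 <= (pi : R)^-1.
Proof. by rewrite invr_ge0 pi_ge0. Qed.

Definition dA :
    {measure set (measurableTypeR R * measurableTypeR R) -> \bar R} :=
  mscale (NngNum invpi_ge0) (@lebesgue_measure R \x @lebesgue_measure R)%E.

Definition cintegral (F : R[i] -> R[i]) : R[i] :=
  (\int[dA]_(p in disc2) complex.Re (F (ofR2 p))) +i*
  (\int[dA]_(p in disc2) complex.Im (F (ofR2 p))).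

(* Cutting off to 0 outside the disc does not affect the essential supremum
   of a modulus over the disc, because the disc has positive measure. *)
Definition Linfty_norm (f : R[i] -> R[i]) : \bar R :=
  ess_sup dA ((fun p => (cabs (f (ofR2 p)))%:E) \_ disc2).

Definition Linfty (f : R[i] -> R[i]) : Prop :=
  [/\ measurable_fun disc2 (fun p => complex.Re (f (ofR2 p))),
      measurable_fun disc2 (fun p => complex.Im (f (ofR2 p))) &
      (Linfty_norm f < +oo)%E].

Definition analytic (f : R[i] -> R[i]) : Prop :=
  forall z, disc z -> derivable f z 1.

Definition bloch_norm (f : R[i] -> R[i]) : \bar R :=
  (ereal_sup [set ((1 - cabs z ^+ 2) * cabs (derive1 f z))%:E | z in disc]
   + (cabs (f 0))%:E)%E.

Definition Bloch (f : R[i] -> R[i]) : Prop :=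
  analytic f /\ (bloch_norm f < +oo)%E.

Definition weight (w : R[i] -> R) : Prop :=
  (forall z, disc z -> 0 <= w z) /\
  dA.-integrable disc2 (fun p => (w (ofR2 p))%:E).

Definition radial (w : R[i] -> R) : Prop :=
  forall z, disc z -> w z = w (cabs z)%:C.

(* Extended-real valued: a radial weight is only integrable for s ds near 0,
   so the value at r = 0 could a priori be +oo. *)
Definition what (w : R[i] -> R) (r : R) : \bar R :=
  (\int[lebesgue_measure]_(s in `[r, 1%R[) (w s%:C)%:E)%E.

Definition radial_weight (w : R[i] -> R) : Prop :=
  [/\ weight w, radial w & forall r : R, 0 <= r < 1 -> (0 < what w r)%E].

Definition Dhat (w : R[i] -> R) : Prop :=
  radial_weight w /\
  exists2 C : R, 0 < C &
    forall r : R, 0 <= r < 1 -> (what w r <= C%:E * what w ((1 + r) / 2))%E.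

Definition Dcheck (w : R[i] -> R) : Prop :=
  radial_weight w /\
  exists K C' : R, [/\ 1 < K, 1 < C' &
    forall r : R, 0 <= r < 1 ->
      (what w r >= C'%:E * what w (1 - (1 - r) / K))%E].

Definition classD (w : R[i] -> R) : Prop := Dhat w /\ Dcheck w.

Definition shift_weight (w : R[i] -> R) (a : R) (z : R[i]) : R :=
  (1 - cabs z) `^ a * w z.

Definition moment (w : R[i] -> R) (k : nat) : R :=
  2 * \int[lebesgue_measure]_(r in `[0%R, 1%R[) (r ^+ (2 * k + 1) * w r%:C).

Definition bergman_kernel (w : R[i] -> R) (z xi : R[i]) : R[i] :=
  limn (series (fun k => ((moment w k)^-1)%:C * (z^* * xi) ^+ k)).

Definition bergman_proj (w : R[i] -> R) (f : R[i] -> R[i]) (z : R[i]) : R[i] :=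
  cintegral (fun xi => f xi * (bergman_kernel w z xi)^* * (w xi)%:C).

Definition taylor_coef (f : R[i] -> R[i]) (k : nat) : R[i] :=
  derive1n k f 0 / k`!%:R.

Definition Rmult (w v : R[i] -> R) (f : R[i] -> R[i]) (z : R[i]) : R[i] :=
  limn (series
    (fun k => (moment w k / moment v k)%:C * taylor_coef f k * z ^+ k)).

End UnitDisc.

(* Main.v *)
Require Import Defs.
From mathcomp Require Import all_boot all_order all_algebra.
From mathcomp Require Import all_classical all_reals all_analysis.
From mathcomp Require Import ess_sup_inf measurable_realfun ring lra zify.
Set Implicit Arguments.
Unset Strict Implicit.
Unset Printing Implicit Defensive.
Import Order.TTheory GRing.Theory Num.Theory numFieldNormedType.Exports.
Local Open Scope classical_set_scope.
Local Open Scope ring_scope.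
Local Open Scope complex_scope.

(* Write m_k for the moments of w.  Boundedness of the projection amounts to
   the estimate that the w-mean over xi of |L(z conj(xi))| is O(1/(1 - |z|)),
   for L(x) = sum (k + 1) x^k / m_(k+1).  By AM-GM, |L| is at most half of
   phi |1 - x|^-2 + phi^-1 |(1 - x) L|^2, where phi is the reciprocal of the
   tail of w; orthogonality of the monomials turns the means of these squares
   into power series in |z xi|^2, and those are controlled by the doubling
   properties of the tail.

   For the reproducing formula, the same estimate applied to Lebesgue measure
   and to the ratios lambda_k of the moments of w and of the shifted weight
   bounds the multiplier of a Bloch function h by O((1 - |z|)^-a): the
   Taylor coefficients of h are integrals of (1 - |xi|^2) h'(xi), which is
   bounded.  Hence g_a is bounded, its moments against w are m_k times the
   Taylor coefficients of h, and its projection is h.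

   That a Bloch function is the sum of its Taylor series is obtained from the
   area mean of f(z + t (xi - z)) xi / (xi - z) over |xi| >= s: its derivative
   in t is a mean of f'(.) xi, which vanishes by rotation invariance. *)


(** * Modulus and complex derivatives *)

(** The factor 1 - x in (1 - x) L is what makes an L^2 method sharp. The coefficients (k + 1) /
    m_(k+1) vary slowly, because m_k - m_(k+1) = O(m_(k+1) / (k + 1)), so differencing gains a full
    factor k + 1. AM-GM is applied pointwise, hence phi may depend on |z xi|; with this phi both
    squares get the same bound, phi / (1 - t) at t = |z xi|, and only a radial function remains to
    be integrated. The two halves of class D enter differently. [Dhat] gives the doubling of tails
    and of moments. [Dcheck] gives lambda_k = O((k + 1)^a): it keeps the mass of w from sitting so
    close to the circle that the factor (1 - r)^a destroys it. Tails are taken with respect to area,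
    as integrals of 2 s w(s); these are finite even at 0, where the integral of w(s) may diverge.
    The multiplier series of h may be unbounded on the disc, so its moments are computed for
    dilations by rho < 1, and then rho tends to 1. Rotations are obtained from shears, which miss
    the half-turn; this is the origin of the side condition u != -1. *)

Section ComplexModulus.
Context {R : realType}.
Local Notation C := R[i].
Implicit Types (z w : C) (u : nat -> C).

Lemma normcabs z : `|z| = (cabs z)%:C.
Proof. by rewrite normc_def; case: z. Qed.

Lemma cabs_ge0 z : 0 <= cabs z.
Proof. by rewrite -ler0c -normcabs. Qed.

Lemma cabs_eq0 z : (cabs z == 0) = (z == 0).
Proof. by apply/eqP/eqP => [/ComplexField.Normc.eq0_normc|->] //; rewrite ComplexField.Normc.normc0. Qed.

Lemma cabsM z w : cabs (z * w) = cabs z * cabs w.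
Proof. exact: ComplexField.Normc.normcM. Qed.

Lemma cabsV z : cabs z^-1 = (cabs z)^-1.
Proof. exact: ComplexField.Normc.normcV. Qed.

Lemma cabsX z n : cabs (z ^+ n) = cabs z ^+ n.
Proof.
elim: n => [|n ih]; first by rewrite !expr0 ComplexField.Normc.normc1.
by rewrite !exprS cabsM ih.
Qed.

Lemma cabsN z : cabs (- z) = cabs z.
Proof. exact: normcN. Qed.

Lemma cabs_real (x : R) : cabs x%:C = `|x|.
Proof. by rewrite /= expr0n addr0 sqrtr_sqr. Qed.

Lemma cabs_ge0_real (x : R) : 0 <= x -> cabs x%:C = x.
Proof. by move=> x0; rewrite cabs_real ger0_norm. Qed.

Lemma cabsJ z : cabs z^* = cabs z.
Proof. by case: z => x y /=; rewrite sqrrN. Qed.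

Lemma cabsD z w : cabs (z + w) <= cabs z + cabs w.
Proof. exact: le_normcD. Qed.

Lemma cabsB z w : cabs (z - w) <= cabs z + cabs w.
Proof. by rewrite -(cabsN w); exact: cabsD. Qed.

Lemma cabs_distC z w : cabs (z - w) = cabs (w - z).
Proof. by rewrite -cabsN opprB. Qed.

Lemma cabsB_ge z w : cabs z - cabs w <= cabs (z - w).
Proof. by rewrite lerBlDr -{1}(subrK w z); exact: cabsD. Qed.

Lemma cabs_sum (I : Type) (r : seq I) (P : pred I) (F : I -> C) :
  cabs (\sum_(i <- r | P i) F i) <= \sum_(i <- r | P i) cabs (F i).
Proof.
elim/big_ind2 : _ => // [|x1 x2 y1 y2 h1 h2]; first by rewrite ComplexField.Normc.normc0.
by rewrite (le_trans (cabsD _ _))// lerD.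
Qed.

Lemma cabs2 z : cabs z ^+ 2 = complex.Re z ^+ 2 + complex.Im z ^+ 2.
Proof. by case: z => x y /=; rewrite sqr_sqrtr// addr_ge0// sqr_ge0. Qed.

Lemma mulJ_cabs z : z * z^* = (cabs z ^+ 2)%:C.
Proof. by rewrite cabs2; case: z => x y; apply/eqP; rewrite eq_complex /=; apply/andP; split; apply/eqP; ring. Qed.

Lemma cReB z w : complex.Re (z - w) = complex.Re z - complex.Re w.
Proof. by case: z; case: w. Qed.

Lemma cImB z w : complex.Im (z - w) = complex.Im z - complex.Im w.
Proof. by case: z; case: w. Qed.

Lemma cReM z w : complex.Re (z * w) =
  complex.Re z * complex.Re w - complex.Im z * complex.Im w.
Proof. by case: z; case: w. Qed.

Lemma cImM z w : complex.Im (z * w) =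
  complex.Re z * complex.Im w + complex.Im z * complex.Re w.
Proof. by case: z; case: w. Qed.

Lemma cReD z w : complex.Re (z + w) = complex.Re z + complex.Re w.
Proof. by case: z; case: w. Qed.

Lemma cImD z w : complex.Im (z + w) = complex.Im z + complex.Im w.
Proof. by case: z; case: w. Qed.

Lemma Re_le_cabs z : `|complex.Re z| <= cabs z.
Proof. by have := normc_ge_Re z; rewrite normcabs lecR. Qed.

Lemma Im_le_cabs z : `|complex.Im z| <= cabs z.
Proof.
case: z => x y /=; rewrite -(sqrtr_sqr y) ler_wsqrtr//.
by rewrite lerDr sqr_ge0.
Qed.

Lemma cabs_le_ReIm z : cabs z <= `|complex.Re z| + `|complex.Im z|.
Proof.
rewrite -(ler_pXn2r (n := 2))// ?nnegrE ?cabs_ge0 ?addr_ge0//.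
rewrite cabs2 -(real_normK (num_real (complex.Re z))) -(real_normK (num_real (complex.Im z))).
rewrite sqrrD addrAC lerDl; exact: mulrn_wge0 (mulr_ge0 _ _).
Qed.

(** Turns a bound on the modulus of an integral, or of an increment, into a bound on the real part
    of a unimodular multiple of it. *)
Lemma cabs_phase z : exists u : C, cabs u = 1 /\ u * z = (cabs z)%:C.
Proof.
have [->|z0] := eqVneq z 0.
  by exists 1; rewrite ComplexField.Normc.normc1 mulr0 ComplexField.Normc.normc0.
exists ((cabs z)%:C / z); rewrite divfK// cabsM cabsV cabs_real ger0_norm ?cabs_ge0//.
by rewrite divff// cabs_eq0.
Qed.

Lemma cvgCP u (l : C) : u @ \oo --> l <-> (fun n => cabs (u n - l)) @ \oo --> (0 : R).
Proof.
split=> [/cvgrPdist_lt ul|/cvgrPdist_lt ul].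
- apply/cvgrPdist_lt => e e0.
  have := ul e%:C; rewrite ltcR => /(_ e0); apply: filterS => n.
  by rewrite normcabs ltcR sub0r normrN ger0_norm ?cabs_ge0// cabs_distC.
- apply/cvgrPdist_lt => e e0.
  (* The norm of R[i] takes values in R[i], and so does e; positivity in the partial order of R[i]
     forces it to be real. *)
  have eE : e = (complex.Re e)%:C.
    by case: e e0 => a b; rewrite ltcE/= => /andP[/eqP -> _].
  have := ul (complex.Re e); move: e0; rewrite {1}eE ltcR => e0 /(_ e0).
  apply: filterS => n; rewrite sub0r normrN ger0_norm ?cabs_ge0// => h.
  by rewrite normcabs eE ltcR cabs_distC.
Qed.

(* Fréchet form of complex differentiability. *)
Definition cderiv (f : C -> C) (z d : C) := forall e : R, 0 < e ->
  exists2 del : R, 0 < del & forall w, cabs w < del ->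
    cabs (f (z + w) - f z - d * w) <= e * cabs w.

Lemma cderiv_cvg f z d : cderiv f z d ->
  (fun h : C => h^-1 *: (f (h + z) - f z)) @ 0^' --> d.
Proof.
move=> fd; apply/cvgrPdist_le => e e0.
have eE : e = (complex.Re e)%:C.
  by case: e e0 => a b; rewrite ltcE/= => /andP[/eqP -> _].
move: (e0); rewrite {1}eE ltcR => e0'.
have [del del0 H] := fd _ e0'.
near=> h.
have h0 : h != 0 by near: h; exact: nbhs_dnbhs_neq.
have hd : cabs h < del.
  rewrite -ltcR -normcabs; near: h.
  by apply: dnbhs0_lt; rewrite ltcR.
have := H h hd; rewrite normcabs eE lecR => H1.
rewrite cabs_distC -(ler_pM2r (_ : 0 < cabs h)); last by rewrite lt_def cabs_eq0 h0 cabs_ge0.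
rewrite -cabsM /GRing.scale/= mulrBl mulrAC mulVf// mul1r.
by rewrite (addrC h) (le_trans H1).
Unshelve. all: by end_near. Qed.

Lemma cderivP f z d : cderiv f z d <-> derivable f z 1 /\ derive1 f z = d.
Proof.
split=> [fd|[fz <-]].
- have fc := cderiv_cvg fd; split.
    apply/cvg_ex; exists d => /=.
    by under eq_fun do rewrite [_ *: 1]mulr1.
  by rewrite /derive1; apply/cvg_lim.
- have : (fun h : C => h^-1 *: (f (h + z) - f z)) @ 0^' --> derive1 f z.
    move: fz; rewrite /derivable/derive1 => /cvg_ex[l /=].
    under eq_fun do rewrite [_ *: 1]mulr1.
    by move=> /[dup] /cvg_lim -> //.
  move/cvgrPdist_le => H e e0.
  have /H : 0 < e%:C by rewrite ltcR.
  rewrite near_withinE -filter_from_ballE => -[/= r r0 Hr].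
  have rE : r = (complex.Re r)%:C.
    by case: r r0 {Hr} => a b; rewrite ltcE/= => /andP[/eqP -> _].
  move: (r0); rewrite {1}rE ltcR => r0'.
  exists (complex.Re r) => // w wr.
  have [->|w0] := eqVneq w 0; first by rewrite addr0 mulr0 !subrr !ComplexField.Normc.normc0 mulr0.
  have := Hr w; rewrite /ball/= sub0r normrN normcabs rE ltcR => /(_ wr w0).
  rewrite normcabs lecR cabs_distC => h.
  have : cabs (w^-1 *: (f (w + z) - f z) - derive1 f z) * cabs w <= e * cabs w.
    by rewrite ler_wpM2r// cabs_ge0.
  by rewrite -cabsM /GRing.scale/= mulrBl mulrAC mulVf// mul1r (addrC w).
Qed.

Lemma analytic_cderiv f z : analytic f -> disc z -> cderiv f z (derive1 f z).
Proof. by move=> fa Dz; apply/cderivP; split => //; exact: fa. Qed.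

Lemma cderiv_cont f z d : cderiv f z d -> forall e : R, 0 < e ->
  exists2 del : R, 0 < del & forall w, cabs w < del -> cabs (f (z + w) - f z) < e.
Proof.
move=> fd e e0; have [del del0 H] := fd 1 ltr01.
have c0 : 0 < 1 + cabs d by rewrite ltr_pwDl// cabs_ge0.
exists (Num.min del (e / (1 + cabs d))); first by rewrite lt_min del0 divr_gt0.
move=> w; rewrite lt_min => /andP[w1 w2].
have := H w w1; rewrite mul1r => H1.
rewrite -(subrK (d * w) (f (z + w) - f z)) (le_lt_trans (cabsD _ _))//.
rewrite cabsM; apply: (@le_lt_trans _ _ ((1 + cabs d) * cabs w)).
  by rewrite mulrDl mul1r lerD2r.
by rewrite mulrC -ltr_pdivlMr.
Qed.

End ComplexModulus.

(** * Power series *)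

Section ComplexSeries.
Context {R : realType}.
Local Notation C := R[i].
Implicit Types (z w l c d : C) (f g : C -> C) (u v a b : nat -> C).

Definition csum u : C := limn (series u).

(** The bound M is kept as a parameter: it also bounds the modulus of the sum, and it serves as a
    uniform majorant when series are integrated term by term. *)
Definition abs_summable u (M : R) := forall n, \sum_(0 <= k < n) cabs (u k) <= M.

Lemma csumE u l : series u @ \oo --> l -> csum u = l.
Proof. by move=> ul; apply/cvg_lim. Qed.

Lemma real_abs_cvg (f : nat -> R) (M : R) :
  (forall n, \sum_(0 <= k < n) `|f k| <= M) -> cvgn (series f).
Proof.
move=> fM; apply: normed_cvg; apply: nondecreasing_is_cvgn.
  by apply: nondecreasing_series => k _ _; exact: normr_ge0.
by exists M => _ [n _ <-]; exact: fM.
Qed.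

(** Real and imaginary parts are dominated by the moduli, so completeness is used for real series
    only. *)
Lemma abs_summable_cvg u M : abs_summable u M -> series u @ \oo --> csum u.
Proof.
move=> uM.
have cr : cvgn (series (fun k => complex.Re (u k))).
  apply: (@real_abs_cvg _ M) => n; apply: le_trans (uM n).
  by apply: ler_sum => k _; exact: Re_le_cabs.
have ci : cvgn (series (fun k => complex.Im (u k))).
  apply: (@real_abs_cvg _ M) => n; apply: le_trans (uM n).
  by apply: ler_sum => k _; exact: Im_le_cabs.
suff : series u @ \oo --> limn (series (fun k => complex.Re (u k)))
    +i* limn (series (fun k => complex.Im (u k))).
  by move=> h; rewrite (csumE h).
set x := limn _; set y := limn _.
apply/cvgCP.
have -> : (0 : R) = `|x - x| + `|y - y| by rewrite !subrr normr0 addr0.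
apply: (@squeeze_cvgr _ _ _ _ (cst 0) (fun n =>
    `|series (fun k => complex.Re (u k)) n - x| +
    `|series (fun k => complex.Im (u k)) n - y|)).
- apply: nearW => n; rewrite cabs_ge0/=.
  have -> : series (fun k => complex.Re (u k)) n = complex.Re (series u n).
    by rewrite /series/=; elim/big_ind2 : _ => // a b c d -> ->; rewrite cReD.
  have -> : series (fun k => complex.Im (u k)) n = complex.Im (series u n).
    by rewrite /series/=; elim/big_ind2 : _ => // a b c d -> ->; rewrite cImD.
  by rewrite (le_trans (cabs_le_ReIm _))// cReB cImB.
- by rewrite !subrr normr0 addr0; exact: cvg_cst.
- by apply: cvgD; apply: cvg_norm; apply: cvgB => //; exact: cvg_cst.
Qed.

Lemma cabs_cvg_le u l (M : R) : u @ \oo --> l -> (forall n, cabs (u n) <= M) ->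
  cabs l <= M.
Proof.
move=> /cvgCP ul uM; rewrite leNgt; apply/negP => Ml.
move/cvgrPdist_lt : ul => /(_ (cabs l - M)); rewrite subr_gt0 => /(_ Ml).
case=> n _ /(_ n (leqnn n)); rewrite sub0r normrN ger0_norm ?cabs_ge0// cabs_distC.
by apply/negP; rewrite -leNgt (le_trans _ (cabsB_ge _ _))// lerD2l lerN2.
Qed.

Lemma cabs_csum u M : abs_summable u M -> cabs (csum u) <= M.
Proof.
move=> uM; apply: (cabs_cvg_le (abs_summable_cvg uM)) => n.
exact: le_trans (cabs_sum _ _ _) (uM n).
Qed.

Lemma csumD u v M N : abs_summable u M -> abs_summable v N ->
  csum (fun k => u k + v k) = csum u + csum v.
Proof.
move=> /abs_summable_cvg uM /abs_summable_cvg vN; apply: csumE.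
have -> : (fun k => u k + v k) = u + v by [].
by rewrite seriesD; exact: (cvgD uM vN).
Qed.

Lemma csumZ c u M : abs_summable u M -> csum (fun k => c * u k) = c * csum u.
Proof.
move=> /abs_summable_cvg uM; apply: csumE.
have -> : series (fun k => c * u k) = (fun n => c * series u n).
  by apply/funext => n; rewrite /series/= mulr_sumr.
exact: (cvgM (cvg_cst c) uM).
Qed.

Lemma abs_summableZ c u M : abs_summable u M ->
  abs_summable (fun k => c * u k) (cabs c * M).
Proof.
move=> uM n; under eq_bigr do rewrite cabsM.
by rewrite -mulr_sumr ler_wpM2l// cabs_ge0.
Qed.

Lemma abs_summableD u v M N : abs_summable u M -> abs_summable v N ->
  abs_summable (fun k => u k + v k) (M + N).
Proof.
move=> uM vN n; rewrite (le_trans _ (lerD (uM n) (vN n)))// -big_split/=.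
by apply: ler_sum => k _; exact: cabsD.
Qed.

Lemma csumS u M : abs_summable u M -> csum u = u 0%N + csum (fun k => u k.+1).
Proof.
move=> uM.
have vM : abs_summable (fun k => u k.+1) M.
  move=> n; apply: le_trans (uM n.+1).
  by rewrite big_nat_recl// lerDr cabs_ge0.
apply: csumE; rewrite -cvg_shiftS/=.
have -> : (fun n => series u n.+1) = (fun n => u 0%N + series (fun k => u k.+1) n).
  by apply/funext => n; rewrite /series/= big_nat_recl.
exact: (cvgD (cvg_cst (u 0%N)) (abs_summable_cvg vM)).
Qed.

Lemma abs_summableS u M : abs_summable u M -> abs_summable (fun k => u k.+1) M.
Proof.
move=> uM n; apply: le_trans (uM n.+1).
by rewrite big_nat_recl// lerDr cabs_ge0.
Qed.

Lemma geometric_sum_le (q : R) n : 0 <= q < 1 ->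
  \sum_(0 <= k < n) q ^+ k <= (1 - q)^-1.
Proof.
move=> /andP[q0 q1]; have q1' : 0 < 1 - q by rewrite subr_gt0.
rewrite -(ler_pM2l q1') divff ?gt_eqF// big_mkord -opprB mulNr -subrX1 opprB.
by rewrite gerBl exprn_ge0.
Qed.

(** Each of the n + 1 terms of 1 + q + ... + q^n is at least q^n, and 1 - q times that sum is 1 -
    q^(n+1). The gains of a factor 1 / (k + 1) in moment differences come from here. *)
Lemma natS_pow_le (q : R) n : 0 <= q < 1 -> n.+1%:R * q ^+ n * (1 - q) <= 1.
Proof.
move=> /andP[q0 q1]; have q1' : 0 < 1 - q by rewrite subr_gt0.
apply: (@le_trans _ _ ((1 - q) * \sum_(i < n.+1) q ^+ i)).
  rewrite mulrC ler_wpM2l ?(ltW q1')//.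
  have -> : n.+1%:R * q ^+ n = \sum_(i < n.+1) q ^+ n.
    by rewrite sumr_const card_ord mulr_natl.
  apply: ler_sum => i _; rewrite ler_wiXn2l ?(ltW q1)//.
  by rewrite -ltnS.
by rewrite -opprB mulNr -subrX1 opprB gerBl exprn_ge0.
Qed.

(* The power series with coefficients [a] converges absolutely on |z| < rho. *)
Definition radius_ge (rho : R) a := forall r, 0 <= r < rho ->
  exists M : R, forall k, cabs (a k) * r ^+ k <= M.

Definition ps a z : C := csum (fun k => a k * z ^+ k).

Definition dcoef a k : C := k.+1%:R * a k.+1.

Lemma cabs_nat n : cabs (n%:R : C) = n%:R.
Proof. by rewrite -[n%:R : C](rmorph_nat (real_complex R)) cabs_real normr_nat. Qed.

(** An intermediate radius s turns the bound on |a_k| s^k into a geometric majorant of ratio r /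
    s. *)
Lemma radius_summable rho a (r : R) : radius_ge rho a -> 0 <= r < rho ->
  exists M : R, forall n, \sum_(0 <= k < n) cabs (a k) * r ^+ k <= M.
Proof.
move=> ra /andP[r0 rrho].
pose s := (r + rho) / 2.
have s0 : 0 < s by rewrite /s; lra.
have rs : r < s by rewrite /s; lra.
have [|M HM] := ra s; first by rewrite /s; lra.
have q01 : 0 <= r / s < 1 by rewrite divr_ge0 ?(ltW s0)//= ltr_pdivrMr// mul1r.
exists (M * (1 - r / s)^-1) => n.
have M0 : 0 <= M by apply: le_trans (HM 0%N); rewrite mulr_ge0 ?cabs_ge0// exprn_ge0// ltW.
apply: le_trans (ler_wpM2l M0 (geometric_sum_le n q01)).
rewrite mulr_sumr; apply: ler_sum => k _.
apply: (@le_trans _ _ ((cabs (a k) * s ^+ k) * (r / s) ^+ k)).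
  by rewrite -mulrA -exprMn mulrCA divff ?gt_eqF// mulr1.
by rewrite ler_wpM2r// exprn_ge0//; case/andP : q01.
Qed.

Lemma ps_summable rho a z : radius_ge rho a -> cabs z < rho ->
  exists M, abs_summable (fun k => a k * z ^+ k) M.
Proof.
move=> ra zr; have [|M HM] := radius_summable ra (_ : 0 <= cabs z < rho).
  by rewrite cabs_ge0.
by exists M => n; under eq_bigr do rewrite cabsM cabsX.
Qed.

Lemma ps_cvg rho a z : radius_ge rho a -> cabs z < rho ->
  series (fun k => a k * z ^+ k) @ \oo --> ps a z.
Proof. by move=> ra /(ps_summable ra)[M]; exact: abs_summable_cvg. Qed.

Lemma radius_le rho a b (A : R) : radius_ge rho a ->
  (forall k, cabs (b k) <= A * cabs (a k)) -> radius_ge rho b.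
Proof.
move=> ra ab r rr; have [M HM] := ra r rr; exists (`|A| * M) => k.
have rk : 0 <= r ^+ k by rewrite exprn_ge0//; case/andP : rr.
apply: (@le_trans _ _ (`|A| * (cabs (a k) * r ^+ k))); last by rewrite ler_wpM2l.
rewrite mulrA ler_wpM2r// (le_trans (ab k))// ler_wpM2r ?cabs_ge0//.
exact: ler_norm.
Qed.

Lemma radius_natS rho a : radius_ge rho a -> radius_ge rho (fun k => k.+1%:R * a k).
Proof.
move=> ra r /andP[r0 rrho].
pose s := (r + rho) / 2.
have s0 : 0 < s by rewrite /s; lra.
have rs : r < s by rewrite /s; lra.
have [|M HM] := ra s; first by rewrite /s; lra.
have q01 : 0 <= r / s < 1 by rewrite divr_ge0 ?(ltW s0)//= ltr_pdivrMr// mul1r.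
have q1 : 0 < 1 - r / s by rewrite subr_gt0; case/andP : q01.
have M0 : 0 <= M by apply: le_trans (HM 0%N); rewrite mulr_ge0 ?cabs_ge0// exprn_ge0// ltW.
exists (M * (1 - r / s)^-1) => k.
rewrite cabsM cabs_nat ler_pdivlMr//.
have -> : k.+1%:R * cabs (a k) * r ^+ k * (1 - r / s) =
    (cabs (a k) * s ^+ k) * (k.+1%:R * (r / s) ^+ k * (1 - r / s)).
  have {1}-> : r = r / s * s by rewrite divfK// gt_eqF.
  rewrite exprMn; ring.
rewrite -[leRHS]mulr1 ler_pM//.
- by rewrite mulr_ge0 ?cabs_ge0// exprn_ge0// ltW.
- have /andP[rs0 _] := q01.
  by rewrite !mulr_ge0 ?exprn_ge0 ?(ltW q1).
- exact: natS_pow_le.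
Qed.

Lemma radius_shift rho a : radius_ge rho a -> radius_ge rho (fun k => a k.+1).
Proof.
move=> ra r /andP[r0 rrho].
pose s := (r + rho) / 2.
have s0 : 0 < s by rewrite /s; lra.
have rs : r <= s by rewrite /s; lra.
have [|M HM] := ra s; first by rewrite /s; lra.
exists (M / s) => k; rewrite ler_pdivlMr//; apply: le_trans (HM k.+1).
rewrite exprSr [leRHS]mulrA; apply: ler_wpM2r; first exact: ltW.
by apply: ler_wpM2l; rewrite ?cabs_ge0// lerXn2r// nnegrE ltW.
Qed.

Lemma radius_dcoef rho a : radius_ge rho a -> radius_ge rho (dcoef a).
Proof. by move=> ra; exact: (radius_natS (radius_shift ra)). Qed.

(** The remainders satisfy E_(k+1) = (z + w) E_k + (k + 1) z^k w^2 up to the index shift, which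
    gives the induction. The factor rho on the left stands for a power rho^(k-1) on the right, which
    would be meaningless at k = 0. *)
Lemma pow_taylor2 (rho : R) z w k : 0 <= rho -> cabs z <= rho -> cabs (z + w) <= rho ->
  rho * cabs ((z + w) ^+ k.+1 - z ^+ k.+1 - k.+1%:R * z ^+ k * w)
    <= k.+1%:R ^+ 2 * rho ^+ k * cabs w ^+ 2.
Proof.
move=> rho0 zr zwr; elim: k => [|k ih].
  have -> : (z + w) ^+ 1 - z ^+ 1 - 1%:R * z ^+ 0 * w = 0 by rewrite !expr1 expr0; ring.
  by rewrite ComplexField.Normc.normc0 mulr0 expr0 !mulr1 expr1n mul1r sqr_ge0.
have -> : (z + w) ^+ k.+2 - z ^+ k.+2 - k.+2%:R * z ^+ k.+1 * w =
  (z + w) * ((z + w) ^+ k.+1 - z ^+ k.+1 - k.+1%:R * z ^+ k * w) +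
  k.+1%:R * z ^+ k * w ^+ 2.
  rewrite !exprS -(natr1 k.+1); ring.
set E := (X in (z + w) * X) in ih *.
apply: (@le_trans _ _ (rho * (rho * cabs E) + rho * (k.+1%:R * rho ^+ k * cabs w ^+ 2))).
  rewrite -mulrDr ler_wpM2l//; apply: le_trans (cabsD _ _) _.
  rewrite !cabsM !cabsX cabs_nat -(expr2 (cabs w)); apply: lerD; first by rewrite ler_wpM2r ?cabs_ge0.
  apply: ler_wpM2r; first by rewrite exprn_ge0// cabs_ge0.
  by apply: ler_wpM2l => //; rewrite lerXn2r// nnegrE cabs_ge0.
apply: le_trans (lerD (ler_wpM2l rho0 ih) (lexx _)) _.
have -> : rho * (k.+1%:R ^+ 2 * rho ^+ k * cabs w ^+ 2) +
  rho * (k.+1%:R * rho ^+ k * cabs w ^+ 2) =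
  (k.+1%:R ^+ 2 + k.+1%:R) * rho ^+ k.+1 * cabs w ^+ 2 by rewrite (exprS rho); ring.
do 2 (rewrite ler_wpM2r ?exprn_ge0 ?cabs_ge0//).
by rewrite -(natr1 k.+1); have : (0 : R) <= k.+1%:R by []; nra.
Qed.

(** [pow_taylor2] is summed over k on a disc of radius s between |z| and rho. S bounds the sums of
    (k + 1)^2 |a_(k+1)| s^k, since multiplication by k + 1 keeps the radius. *)
Lemma ps_deriv rho a z : radius_ge rho a -> cabs z < rho ->
  cderiv (ps a) z (ps (dcoef a) z).
Proof.
move=> ra zr; pose s := (cabs z + rho) / 2.
have z0 := cabs_ge0 z.
have zs : cabs z < s by rewrite /s; lra.
have sr : s < rho by rewrite /s; lra.
have s0 : 0 < s by apply: le_lt_trans zs.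
have [|S HS] := radius_summable (radius_natS (radius_dcoef ra)) (_ : 0 <= s < rho).
  by rewrite ltW.
have S0 : 0 <= S by apply: le_trans (HS 0%N); rewrite big_nil.
(* The first term keeps z + w within radius s; the second turns the quadratic error S |w|^2 / s into
   e |w|, with S + 1 in case S = 0. *)
move=> e e0; exists (Num.min (s - cabs z) (e * s / (S + 1))).
  by rewrite lt_min subr_gt0 zs/= divr_gt0 ?mulr_gt0//; lra.
move=> w; rewrite lt_min => /andP[w1 w2].
have zw : cabs (z + w) <= s by apply: le_trans (cabsD _ _) _; lra.
have zwr : cabs (z + w) < rho by exact: le_lt_trans sr.
have [M1 H1] := ps_summable ra zwr.
have [M2 H2] := ps_summable ra zr.
have [M3 H3] := ps_summable (radius_dcoef ra) zr.
have H1' := abs_summableS H1; have H2' := abs_summableS H2.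
have -> : ps a (z + w) - ps a z - ps (dcoef a) z * w =
  csum (fun k => a k.+1 * ((z + w) ^+ k.+1 - z ^+ k.+1 - k.+1%:R * z ^+ k * w)).
  rewrite /ps (csumS H1) (csumS H2) !expr0 opprD addrACA subrr add0r.
  rewrite -(mulN1r (csum (fun k => a k.+1 * z ^+ k.+1))) -(csumZ _ H2').
  rewrite (mulrC _ w) -mulNr -(csumZ _ H3).
  rewrite -(csumD H1' (abs_summableZ _ H2')).
  rewrite -(csumD (abs_summableD H1' (abs_summableZ _ H2')) (abs_summableZ _ H3)).
  by congr csum; apply/funext => k; rewrite /dcoef; ring.
apply: (@le_trans _ _ (S * cabs w ^+ 2 / s)); last first.
  have w0 := cabs_ge0 w.
  rewrite expr2 mulrA mulrAC ler_wpM2r// ler_pdivrMr//.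
  have S1 : 0 < S + 1 by lra.
  move: w2; rewrite ltr_pdivlMr// => w2; nra.
apply: cabs_csum => n; rewrite ler_pdivlMr// mulr_suml.
rewrite (@le_trans _ _ (\sum_(0 <= k < n)
   cabs (k.+1%:R * dcoef a k) * s ^+ k * cabs w ^+ 2))//; last first.
  by rewrite -mulr_suml ler_wpM2r// exprn_ge0// cabs_ge0.
apply: ler_sum => k _; rewrite !cabsM !cabs_nat.
have := @pow_taylor2 s z w k (ltW s0) (ltW zs) zw; set E := cabs _ => h.
have := ler_wpM2l (cabs_ge0 (a k.+1)) h.
by rewrite [leLHS](_ : _ = cabs (a k.+1) * E * s); [move/le_trans; apply; rewrite le_eqVlt; apply/orP; left; apply/eqP; ring|ring].
Qed.

Lemma cderiv_congr rho f g z d : (forall x, cabs x < rho -> f x = g x) ->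
  cabs z < rho -> cderiv g z d -> cderiv f z d.
Proof.
move=> fg zr gd e e0; have [del del0 H] := gd e e0.
exists (Num.min del (rho - cabs z)); first by rewrite lt_min del0 subr_gt0.
move=> w; rewrite lt_min => /andP[wd wr].
rewrite !fg//; first exact: H.
by apply: le_lt_trans (cabsD _ _) _; lra.
Qed.

Lemma cderiv_derive1 f z d : cderiv f z d -> derive1 f z = d.
Proof. by case/cderivP. Qed.

Lemma ps_derive1n rho f a n : radius_ge rho a ->
  (forall z, cabs z < rho -> f z = ps a z) ->
  forall z, cabs z < rho -> derive1n n f z = ps (iter n dcoef a) z.
Proof.
move=> ra fa; elim: n => [|n ih] z zr; first by rewrite derive1n0 fa.
have rn : radius_ge rho (iter n dcoef a).
  by elim: n {ih} => //= n; exact: radius_dcoef.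
rewrite derive1nS; apply: cderiv_derive1.
exact: (cderiv_congr ih zr (ps_deriv rn zr)).
Qed.

Lemma ps0 rho a : 0 < rho -> radius_ge rho a -> ps a 0 = a 0%N.
Proof.
move=> rho0 ra.
have [|M H] := @ps_summable rho a 0 ra _; first by rewrite ComplexField.Normc.normc0.
rewrite /ps (csumS H) expr0 mulr1.
have -> : (fun k => a k.+1 * 0 ^+ k.+1) = (fun=> 0).
  by apply/funext => k; rewrite expr0n mulr0.
rewrite (_ : csum _ = 0) ?addr0//; apply: csumE.
rewrite (_ : series _ = fun=> 0); first exact: cvg_cst.
by apply/funext => n; rewrite /series/= big1.
Qed.

Lemma taylor_coefE rho f a k : 0 < rho -> radius_ge rho a ->
  (forall z, cabs z < rho -> f z = ps a z) -> taylor_coef f k = a k.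
Proof.
move=> rho0 ra fa; rewrite /taylor_coef (ps_derive1n k ra fa) ?ComplexField.Normc.normc0//.
have rn : radius_ge rho (iter k dcoef a).
  by elim: k => //= n; exact: radius_dcoef.
rewrite (ps0 rho0 rn).
have -> : iter k dcoef a 0%N = k`!%:R * a k.
  (* Each [dcoef] moves the index by one, so the induction needs every starting index n; the case
     wanted is n = 0. *)
  suff H n : (n`!%:R * iter k dcoef a n = (n + k)`!%:R * a (n + k)%N).
    by have := H 0%N; rewrite fact0 mul1r add0n.
  elim: k {rn} n => [|k ih] n /=; first by rewrite addn0.
  rewrite /dcoef mulrA -natrM mulnC -factS ih addSnnS.
  by [].
by rewrite mulrC mulKf// pnatr_eq0 -lt0n fact_gt0.
Qed.

End ComplexSeries.

(** * Rotation invariance of Lebesgue measure *)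

Section PlaneMeasure.
Context {R : realType}.
Local Notation mu := (@lebesgue_measure R).
Local Notation MR := (measurableTypeR R).
Local Notation E := (MR * MR)%type.

Lemma measurable_affine (c b : R) : measurable_fun setT (fun x : MR => c * x + b : MR).
Proof. by apply: measurable_funD => //; exact: mulrl_measurable. Qed.

(** c times the image of Lebesgue measure under x -> c x + b gives each interval its length, hence
    is Lebesgue measure by uniqueness. *)
Lemma ge0_integral_affine (c b : R) (f : MR -> \bar R) : 0 < c ->
  measurable_fun setT f -> (forall x, 0 <= f x)%E ->
  (\int[mu]_x f x = c%:E * \int[mu]_x f (c * x + b)%R)%E.
Proof.
move=> c0 mf f0; pose phi (x : MR) : MR := c * x + b.
have mphi : measurable_fun setT phi by exact: measurable_affine.
have [nu nuE] : {nu : {measure set MR -> \bar R} | forall A, nu A = pushforward mu phi A}.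
  by unshelve eexists; [unshelve refine (pushforward mu phi)|].
have H A : measurable A -> mu A = mscale (NngNum (ltW c0)) nu A.
  apply: lebesgue_measure_unique => _ [[x y]] _ <-.
  change (mu `]x, y]%classic = (c%:E * nu `]x, y]%classic)%E).
  rewrite nuE /pushforward.
  have E1 : phi @^-1` `]x, y] = `](x - b) / c, (y - b) / c]%classic.
    apply/seteqP; split => t /=; rewrite /phi !in_itv/= => /andP[h1 h2].
      by rewrite ltr_pdivrMr// ler_pdivlMr// ltrBlDr lerBrDr mulrC h1 h2.
    by move: h1 h2; rewrite ltr_pdivrMr// ler_pdivlMr// ltrBlDr lerBrDr mulrC => -> ->.
  pose I : set MR := `](x - b) / c, (y - b) / c]%classic.
  suff : mu `]x, y]%classic = (c%:E * mu I)%E by rewrite /I -E1.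
  rewrite /I.
  rewrite !lebesgue_measure_itv/= !lte_fin ltr_pM2r ?invr_gt0// ltrD2r.
  case: ifPn => _; last by rewrite mule0.
  rewrite -!EFinB -EFinM; congr EFin; rewrite -mulrBl mulrC divfK ?gt_eqF//; ring.
transitivity (\int[mscale (NngNum (ltW c0)) nu]_x f x)%E.
  by apply: eq_measure_integral => A mA _; exact: H.
rewrite ge0_integral_mscale//; congr (_ * _)%E.
transitivity (\int[pushforward mu phi]_x f x)%E.
  by apply: eq_measure_integral => A mA _; exact: nuE.
by rewrite (ge0_integral_pushforward mphi)//= preimage_setT.
Qed.

Lemma ge0_integral_opp (f : MR -> \bar R) :
  measurable_fun setT f -> (forall x, 0 <= f x)%E ->
  (\int[mu]_x f x = \int[mu]_x f (- x)%R)%E.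
Proof.
move=> mf f0.
have mphi : measurable_fun setT (-%R : MR -> MR) by exact: oppr_measurable.
transitivity (\int[pushforward mu (-%R : MR -> MR)]_x f x)%E.
  by apply: eq_measure_integral => A mA _; exact/esym/lebesgue_measureN.
by rewrite (ge0_integral_pushforward mphi)//= preimage_setT.
Qed.

Lemma measurable_pairP (g1 g2 : E -> MR) : measurable_fun setT g1 ->
  measurable_fun setT g2 -> measurable_fun setT (fun p => (g1 p, g2 p) : E).
Proof. by move=> *; exact: measurable_fun_pair. Qed.

Local Notation mu2 := (mu \x mu)%E.

(** For a fixed second coordinate a shear is a translation of the first, so Tonelli reduces it to
    one variable. *)
Lemma ge0_integral_shear1 (a : R) (f : E -> \bar R) : measurable_fun setT f ->
  (forall x, 0 <= f x)%E ->
  (\int[mu2]_p f p = \int[mu2]_p f (p.1 + a * p.2, p.2)%R)%E.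
Proof.
move=> mf f0.
have mg : measurable_fun setT (fun p : E => f (p.1 + a * p.2, p.2)%R).
  apply: measurableT_comp => //; apply: measurable_pairP => //.
  by apply: measurable_funD => //; exact: measurable_funM.
rewrite [LHS](fubini_tonelli2 _ mf) => [|p]; last exact: f0.
rewrite [RHS](fubini_tonelli2 _ mg) => [|p]; last exact: f0.
apply: eq_integral => y _; rewrite /fubini_G/=.
rewrite (@ge0_integral_affine 1 (a * y)%R)//; last first.
  exact: (measurableT_comp mf (measurable_pair2 _)).
by rewrite mul1e; apply: eq_integral => x _; rewrite mul1r.
Qed.

Lemma ge0_integral_shear2 (a : R) (f : E -> \bar R) : measurable_fun setT f ->
  (forall x, 0 <= f x)%E ->
  (\int[mu2]_p f p = \int[mu2]_p f (p.1, p.2 + a * p.1)%R)%E.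
Proof.
move=> mf f0.
have mg : measurable_fun setT (fun p : E => f (p.1, p.2 + a * p.1)%R).
  apply: measurableT_comp => //; apply: measurable_pairP => //.
  by apply: measurable_funD => //; exact: measurable_funM.
rewrite [LHS](fubini_tonelli1 _ mf) => [|p]; last exact: f0.
rewrite [RHS](fubini_tonelli1 _ mg) => [|p]; last exact: f0.
apply: eq_integral => x _; rewrite /fubini_F/=.
rewrite (@ge0_integral_affine 1 (a * x)%R)//; last first.
  exact: (measurableT_comp mf (measurable_pair1 _)).
by rewrite mul1e; apply: eq_integral => y _; rewrite mul1r.
Qed.

(* A rotation is a product of three shears. *)
Lemma ge0_integral_rotation (c s : R) (f : E -> \bar R) : c ^+ 2 + s ^+ 2 = 1 ->
  1 + c != 0 -> measurable_fun setT f -> (forall x, 0 <= f x)%E ->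
  (\int[mu2]_p f p = \int[mu2]_p f (c * p.1 - s * p.2, s * p.1 + c * p.2)%R)%E.
Proof.
(* With c and s the cosine and sine of an angle, t is the tangent of its half; the three shears have
   parameters -t, s, -t. *)
move=> cs c1 mf f0; pose t := s / (1 + c).
have tc : t * (1 + c) = s by rewrite divfK.
have ts : t * s = 1 - c.
  apply: (mulfI c1); rewrite mulrA (mulrC _ t) tc -expr2.
  have -> : s ^+ 2 = 1 - c ^+ 2 by rewrite -cs; ring.
  ring.
rewrite (ge0_integral_shear1 (- t) mf)//.
set f1 := (fun p : E => f (p.1 + - t * p.2, p.2)%R).
have m1 : measurable_fun setT f1.
  apply: measurableT_comp => //; apply: measurable_pairP => //.
  by apply: measurable_funD => //; exact: measurable_funM.
rewrite (ge0_integral_shear2 s m1)//; last by move=> x; exact: f0.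
set f2 := (fun p : E => f1 (p.1, p.2 + s * p.1)%R).
have m2 : measurable_fun setT f2.
  apply: measurableT_comp => //; apply: measurable_pairP => //.
  by apply: measurable_funD => //; exact: measurable_funM.
rewrite (ge0_integral_shear1 (- t) m2)//; last by move=> x; exact: f0.
apply: eq_integral => -[x y] _; rewrite /f2 /f1 /=; congr (f (_, _)).
- transitivity ((1 - t * s) * x - t * (1 + (1 - t * s)) * y); first by ring.
  by rewrite ts opprB (addrC c) addrA subrr add0r tc.
- have -> : c = 1 - t * s by rewrite ts; ring.
  ring.
Qed.

End PlaneMeasure.

(** * Polar coordinates *)

Section Polar.
Context {R : realType}.
Local Notation mu := (@lebesgue_measure R).
Local Notation MR := (measurableTypeR R).
Local Notation E := (MR * MR)%type.
Local Notation mu2 := (mu \x mu)%E.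

Lemma measurable_sqrt : measurable_fun setT (Num.sqrt : MR -> MR).
Proof. by apply: continuous_measurable_fun; exact: sqrt_continuous. Qed.

Lemma measurable_cabs : measurable_fun setT (fun p : E => cabs (ofR2 p) : MR).
Proof.
apply: measurableT_comp; first exact: measurable_sqrt.
by apply: measurable_funD; apply: measurable_funX.
Qed.

Lemma measurable_disc2 : measurable (@disc2 R).
Proof.
have -> : @disc2 R = (fun p : E => cabs (ofR2 p) : MR) @^-1` `]-oo, 1[%classic.
  by apply/seteqP; split => p /=; rewrite in_itv/=.
by rewrite -[X in measurable X]setTI; apply: measurable_cabs.
Qed.

Lemma integral_oneDsqrV : (\int[mu]_x ((1 + x ^+ 2)^-1)%:E = pi%:E)%E.
Proof.
have -> : (fun x : R => ((1 + x ^+ 2)^-1)%:E) = (fun x => ((oneDsqr x)^-1)%:E) by [].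
rewrite (@ge0_symfun_integralT _ (fun x => (oneDsqr x)^-1)).
- rewrite -set_itvcy integral0y_oneDsqr -EFinM; congr EFin.
  by rewrite mulrC divfK.
- by move=> x; rewrite invr_ge0; apply: le_trans (oneDsqr_ge1 x).
- by move=> x; apply: continuous_oneDsqrV.
- by move=> x; rewrite /oneDsqr/= sqrrN.
Qed.

Let nonneg_part (x : R) : R := Num.max x 0.

Let nonneg_part_ge0 x : 0 <= nonneg_part x.
Proof. by rewrite /nonneg_part le_max lexx orbT. Qed.

Let measurable_nonneg_part : measurable_fun setT (nonneg_part : MR -> MR).
Proof. exact: measurable_maxr. Qed.

Let sec (t : R) : R := Num.sqrt (1 + t ^+ 2).

Let sec_gt0 t : 0 < sec t.
Proof. by rewrite sqrtr_gt0 ltr_pwDl// sqr_ge0. Qed.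

Let measurable_sec : measurable_fun setT (sec : MR -> MR).
Proof.
apply: measurableT_comp; first exact: measurable_sqrt.
by apply: measurable_funD => //; exact: exprn_measurable.
Qed.

(* Polar coordinates in the half planes x > 0 and x < 0, with the slope t = y / x in the
   role of the angle: after y = x t, the abscissa is r / sqrt (1 + t^2), so that
   dx dy = r dr dt / (1 + t^2), and only linear one-variable substitutions are needed. *)
Lemma ge0_integral_polar (psi : MR -> \bar R) : measurable_fun setT psi ->
  (forall r, 0 <= psi r)%E ->
  (\int[mu2]_p psi (cabs (ofR2 p)) =
   (2 * pi)%:E * \int[mu]_r ((Num.max r 0)%:E * psi r))%E.
Proof.
move=> mpsi psi0.
have mN : measurable_fun setT (fun p : E => psi (cabs (ofR2 p))).
  by apply: measurableT_comp => //; exact: measurable_cabs.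
rewrite (fubini_tonelli1 _ mN)// /fubini_F.
set F := (fun x : MR => \int[mu]_y psi (cabs (ofR2 (x, y))))%E.
have mF : measurable_fun setT F.
  exact: (measurable_fun_fubini_tonelli_F (fun p : E => psi (cabs (ofR2 p)))).
pose H (p : E) := ((nonneg_part p.1)%:E * psi (p.1 * sec p.2)%R)%E.
have mH : measurable_fun setT H.
  apply: emeasurable_funM.
    apply/measurable_EFinP; apply: measurableT_comp => //.
  apply: measurableT_comp => //; apply: measurable_funM => //.
  exact: (measurableT_comp measurable_sec).
have H0 p : (0 <= H p)%E by rewrite mule_ge0// lee_fin.
pose G (x : MR) := (\int[mu]_t H (x, t))%E.
have mG : measurable_fun setT G by exact: (measurable_fun_fubini_tonelli_F H).
have G0 x : (0 <= G x)%E by exact: integral_ge0.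
have Gpos x : (0 < x)%R -> F x = G x.
  move=> x0; rewrite /F (@ge0_integral_affine _ x 0)//; last first.
    exact: (measurableT_comp mN (measurable_pair1 _)).
  rewrite /G /H/= /nonneg_part (max_idPl (ltW x0)) ge0_integralZl//.
  - congr (_ * _)%E; apply: eq_integral => t _; congr psi.
    rewrite addr0 /sec -[in RHS](ger0_norm (ltW x0)) -sqrtr_sqr -sqrtrM ?sqr_ge0//.
    by congr Num.sqrt; ring.
  - apply: measurableT_comp => //; apply: measurable_funM => //.
  - by rewrite lee_fin ltW.
have Gneg x : (x <= 0)%R -> G x = 0%E.
  move=> x0; rewrite /G /H/= /nonneg_part (max_idPr x0).
  by under eq_integral do rewrite mul0e; rewrite integral0.
(* G only sees x > 0; evenness of F carries over the half plane x < 0, and the line x = 0 is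
   null. *)
have FN x : F (- x)%R = F x.
  by apply: eq_integral => y _; rewrite /ofR2/= sqrrN.
transitivity (\int[mu]_x (G x + G (- x)%R))%E.
  apply: ge0_ae_eq_integral => //.
  - apply: emeasurable_funD => //.
    by apply: measurableT_comp => //; exact: oppr_measurable.
  - by move=> x _; exact: integral_ge0.
  - by move=> x _; rewrite adde_ge0.
  - exists [set 0%R]; split => //; first exact: lebesgue_measure_set1.
    move=> x /= xP; apply/eqP/negPn/negP => x0; apply: xP => _.
    change (F x = (G x + G (- x)%R)%E).
    have [xl|xg|xe] := ltgtP x 0%R; last by rewrite xe eqxx in x0.
      by rewrite (Gneg x) ?ltW// add0e -Gpos ?oppr_gt0// FN.
    by rewrite (Gneg (- x)%R) ?oppr_le0 ?ltW// adde0 Gpos.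
rewrite ge0_integralD//; last first.
  by apply: measurableT_comp => //; exact: oppr_measurable.
rewrite -(ge0_integral_opp mG)//.
have -> : (\int[mu]_x G x = pi%:E * \int[mu]_r ((Num.max r 0)%:E * psi r))%E.
  rewrite /G (fubini_tonelli H)//.
  set A := (\int[mu]_r ((Num.max r 0)%:E * psi r))%E.
  have A0 : (0 <= A)%E by apply: integral_ge0 => r _; rewrite mule_ge0// lee_fin nonneg_part_ge0.
  transitivity (\int[mu]_t (((1 + t ^+ 2)^-1)%:E * A))%E; last first.
    rewrite ge0_integralZr// ?integral_oneDsqrV//.
    - apply/measurable_EFinP; apply: continuous_measurable_fun => t.
      exact: continuous_oneDsqrV.
    - by move=> t _; rewrite lee_fin invr_ge0 addr_ge0// sqr_ge0.
  apply: eq_integral => t _; rewrite /A.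
  have mf : measurable_fun setT (fun r : MR => ((Num.max r 0)%:E * psi r)%E).
    by apply: emeasurable_funM => //; apply/measurable_EFinP.
  rewrite (@ge0_integral_affine _ (sec t) 0 _ _ mf)//; last first.
    by move=> r; rewrite mule_ge0// lee_fin nonneg_part_ge0.
  have -> : (\int[mu]_x ((Num.max (sec t * x + 0)%R 0)%:E * psi (sec t * x + 0)%R) =
             (sec t)%:E * \int[mu]_x H (x, t))%E.
    rewrite -ge0_integralZl//; last 2 first.
    - exact: (measurableT_comp mH (measurable_pair2 _)).
    - by rewrite lee_fin ltW.
    apply: eq_integral => x _; rewrite /H/= addr0 muleA -EFinM (mulrC x); congr (_%:E * _)%E.
    by rewrite /nonneg_part maxr_pMr ?ltW// mulr0.
  rewrite !muleA -!EFinM -mulrA -expr2 sqr_sqrtr ?addr_ge0 ?sqr_ge0//.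
  by rewrite mulVf ?mul1e// gt_eqF// ltr_pwDl// sqr_ge0.
rewrite -ge0_muleDl ?lee_fin ?pi_ge0// -EFinD; congr (_%:E * _)%E.
by rewrite mulr2n mulrDl mul1r.
Qed.

End Polar.

(** * Weighted integrals over the disc *)

Section DiscIntegral.
Context {R : realType}.
Local Notation C := R[i].
Local Notation mu := (@lebesgue_measure R).
Local Notation MR := (measurableTypeR R).
Local Notation E := (MR * MR)%type.
Local Notation I01 := (`[0%R, 1%R[%classic : set MR).
Implicit Types (v w : C -> R) (F G : C -> R).

(** The 1 / pi of [dA] cancels against the 2 pi of polar coordinates, which leaves the density 2
    r. *)
Lemma ge0_integral_disc_polar (psi : MR -> \bar R) : measurable_fun I01 psi ->
  (forall r, 0 <= r < 1 -> (0 <= psi r)%E) ->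
  (\int[dA]_(p in disc2) psi (cabs (ofR2 p)) =
   \int[mu]_(r in `[0%R, 1%R[) ((2 * r)%:E * psi r))%E.
Proof.
move=> mpsi psi0.
pose psi' := psi \_ I01.
have mI : measurable I01 by exact: measurable_itv.
have m' : measurable_fun setT psi' by apply/(measurable_restrictT psi mI).
have psi'0 r : (0 <= psi' r)%E.
  by rewrite /psi' /patch; case: ifPn => //; rewrite inE/= in_itv/= => /psi0.
rewrite integral_mkcond (_ : _ \_ _ = fun p => psi' (cabs (ofR2 p))); last first.
  apply/funext => p; rewrite /psi' /patch; congr (if _ then _ else _).
  by apply/idP/idP; rewrite !inE/= in_itv/= sqrtr_ge0.
have mN : measurable_fun setT (fun p : E => psi' (cabs (ofR2 p))).
  by apply: measurableT_comp => //; exact: measurable_cabs.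
rewrite ge0_integral_mscale// ge0_integral_polar// muleA -EFinM/=.
rewrite (mulrC 2) mulrA mulVf ?gt_eqF ?pi_gt0// mul1r.
rewrite [in RHS]integral_mkcond -ge0_integralZl//; last 2 first.
- by apply: emeasurable_funM => //; apply/measurable_EFinP; exact: measurable_maxr.
- by move=> x _; rewrite mule_ge0// lee_fin le_max lexx orbT.
apply: eq_integral => r _; rewrite /psi' /patch; case: ifPn => [|_]; last by rewrite !mule0.
by rewrite inE/= in_itv/= => /andP[r0 _]; rewrite (max_idPl r0) muleA -EFinM.
Qed.

(** The bound holds at every point of the disc, not almost everywhere. Such functions form an
    algebra, are integrable against every weight and survive bounded pointwise limits, so
    integrability is settled once for all. *)
Definition bmeas F := measurable_fun disc2 (fun p : E => F (ofR2 p) : MR) /\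
  exists M : R, forall z, disc z -> `|F z| <= M.

Definition dint v F : R := \int[dA]_(p in disc2) (F (ofR2 p) * v (ofR2 p)).

Lemma eq_bmeas F G : (forall z, disc z -> F z = G z) -> bmeas F -> bmeas G.
Proof.
move=> FG [mF [M FM]]; split; last by exists M => z zD; rewrite -FG// FM.
by apply: eq_measurable_fun mF => p; rewrite inE => pD; exact: FG.
Qed.

Lemma bmeas_cst (c : R) : bmeas (fun=> c).
Proof. by split; [exact: measurable_cst|exists `|c|]. Qed.

Lemma bmeasD F G : bmeas F -> bmeas G -> bmeas (fun z => F z + G z).
Proof.
move=> [mF [M FM]] [mG [N GN]]; split; first exact: measurable_funD.
by exists (M + N) => z zD; rewrite (le_trans (ler_normD _ _))// lerD ?FM ?GN.
Qed.

Lemma bmeasM F G : bmeas F -> bmeas G -> bmeas (fun z => F z * G z).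
Proof.
move=> [mF [M FM]] [mG [N GN]]; split; first exact: measurable_funM.
by exists (M * N) => z zD; rewrite normrM ler_pM ?FM ?GN.
Qed.

Lemma bmeasN F : bmeas F -> bmeas (fun z => - F z).
Proof.
move=> [mF [M FM]]; split; first exact: measurable_funN.
by exists M => z zD; rewrite normrN FM.
Qed.

Lemma bmeasB F G : bmeas F -> bmeas G -> bmeas (fun z => F z - G z).
Proof. by move=> bF bG; exact: (bmeasD bF (bmeasN bG)). Qed.

Lemma bmeasX F n : bmeas F -> bmeas (fun z => F z ^+ n).
Proof.
move=> bF; elim: n => [|n ih]; first exact: bmeas_cst.
by under eq_fun do rewrite exprS; exact: bmeasM.
Qed.

Lemma bmeas_radial (phi : MR -> MR) (M : R) : measurable_fun I01 phi ->
  (forall r, 0 <= r < 1 -> `|phi r| <= M) -> bmeas (fun z => phi (cabs z)).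
Proof.
move=> mphi phiM; split; last by exists M => z zD; apply: phiM; rewrite cabs_ge0.
apply: (measurable_comp (F := I01)) => //.
- by move=> _ [p pD <-]; rewrite /= in_itv/= sqrtr_ge0.
- by apply: measurable_funTS; exact: measurable_cabs.
Qed.

Lemma bmeas_cabs : bmeas (fun z => cabs z).
Proof.
apply: (@bmeas_radial id 1) => // r /andP[r0 r1].
by rewrite ger0_norm//; exact: ltW.
Qed.

Lemma bmeas_Re : bmeas (fun z => complex.Re z).
Proof.
split; first by apply: measurable_funTS; exact: measurable_fst.
by exists 1 => z zD; rewrite (le_trans (Re_le_cabs _))// ltW.
Qed.

Lemma bmeas_Im : bmeas (fun z => complex.Im z).
Proof.
split; first by apply: measurable_funTS; exact: measurable_snd.
by exists 1 => z zD; rewrite (le_trans (Im_le_cabs _))// ltW.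
Qed.

Section fixed_weight.
Variable v : C -> R.
Hypothesis vw : weight v.

Lemma dint_integrable F : bmeas F ->
  dA.-integrable disc2 (EFin \o (fun p : E => F (ofR2 p) * v (ofR2 p))).
Proof.
move=> [mF [M FM]].
apply: (@eq_integrable _ _ _ _ _ measurable_disc2
  ((EFin \o (fun p : E => F (ofR2 p))) \* (fun p => (v (ofR2 p))%:E))%E) => //.
apply: integrableMr => //; last by case: vw.
exact: measurable_disc2.
exists M; split; first exact: num_real.
by move=> x Mx p /= pD; rewrite (le_trans (FM _ pD))// ltW.
Qed.

Lemma dintD F G : bmeas F -> bmeas G ->
  dint v (fun z => F z + G z) = dint v F + dint v G.
Proof.
move=> bF bG; rewrite /dint; under eq_Rintegral do rewrite mulrDl.
by rewrite RintegralD//; [exact: measurable_disc2|exact: dint_integrable..].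
Qed.

Lemma dintZ c F : bmeas F -> dint v (fun z => c * F z) = c * dint v F.
Proof.
move=> bF; rewrite /dint; under eq_Rintegral do rewrite -mulrA.
by rewrite RintegralZl//; [exact: measurable_disc2|exact: dint_integrable].
Qed.

Lemma dintN F : bmeas F -> dint v (fun z => - F z) = - dint v F.
Proof.
by move=> bF; rewrite -[RHS]mulN1r -dintZ//; congr dint; apply/funext => z; rewrite mulN1r.
Qed.

Lemma dintB F G : bmeas F -> bmeas G ->
  dint v (fun z => F z - G z) = dint v F - dint v G.
Proof. by move=> bF bG; rewrite dintD ?dintN//; exact: bmeasN. Qed.

Lemma eq_dint F G : (forall z, disc z -> F z = G z) -> dint v F = dint v G.
Proof. by move=> FG; apply: eq_Rintegral => p; rewrite inE => pD; rewrite FG. Qed.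

Lemma dint_le F G : bmeas F -> bmeas G -> (forall z, disc z -> F z <= G z) ->
  dint v F <= dint v G.
Proof.
move=> bF bG FG; apply: le_Rintegral => //; first exact: measurable_disc2.
- exact: dint_integrable.
- exact: dint_integrable.
- by move=> p pD; rewrite ler_wpM2r ?FG//; case: vw => v0 _; exact: v0.
Qed.

Lemma dint_ge0 F : (forall z, disc z -> 0 <= F z) -> 0 <= dint v F.
Proof.
move=> F0; apply: Rintegral_ge0 => p pD; rewrite mulr_ge0 ?F0//.
by case: vw => v0 _; exact: v0.
Qed.

Lemma bounded_cvg (F_ : nat -> C -> R) F (M : R) : (forall n, bmeas (F_ n)) ->
  (forall n z, disc z -> `|F_ n z| <= M) ->
  (forall z, disc z -> F_ ^~ z @ \oo --> F z) ->
  bmeas F /\ (fun n => dint v (F_ n)) @ \oo --> dint v F.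
Proof.
move=> bF FM cF.
have bF' : bmeas F.
  split.
    apply: (@measurable_fun_cvg _ _ _ _ (fun n (p : E) => F_ n (ofR2 p))) => [n|p pD].
      by case: (bF n).
    exact: cF.
  exists M => z zD; apply: (cvgr_to_le (cvg_norm (cF z zD))).
  by apply: nearW => n; exact: FM.
split => //.
have bM : bmeas (fun=> M) by exact: bmeas_cst.
have [||_ _ H] := @dominated_convergence _ _ _ dA disc2 measurable_disc2
  (fun n p => (F_ n (ofR2 p) * v (ofR2 p))%:E)
  (fun p => (F (ofR2 p) * v (ofR2 p))%:E)
  (fun p => (M * v (ofR2 p))%:E)
  (fun n => measurable_int _ (dint_integrable (bF n)))
  (measurable_int _ (dint_integrable bF')) _ (dint_integrable bM) _.
- apply: aeW => p pD; apply: cvg_EFin; first exact: nearW.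
  exact: (cvgM (cF _ pD) (cvg_cst (v (ofR2 p)))).
- apply: aeW => p n pD; rewrite lee_fin normrM (ger0_norm (_ : 0 <= v _)); last first.
    by case: vw => v0 _; exact: v0.
  by rewrite ler_wpM2r ?FM//; case: vw => v0 _; exact: v0.
apply/fine_cvg; rewrite fineK//.
by apply: integrable_fin_num; [exact: measurable_disc2|exact: dint_integrable].
Qed.

End fixed_weight.
End DiscIntegral.

(** * Complex integrals over the disc, rotations and orthogonality of monomials *)

Section ComplexDiscIntegral.
Context {R : realType}.
Local Notation C := R[i].
Local Notation mu := (@lebesgue_measure R).
Local Notation MR := (measurableTypeR R).
Local Notation E := (MR * MR)%type.
Local Notation I01 := (`[0%R, 1%R[%classic : set MR).
Implicit Types (v : C -> R) (F G : C -> C).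

Let rot (u : C) (p : E) : E :=
  (complex.Re u * p.1 - complex.Im u * p.2, complex.Im u * p.1 + complex.Re u * p.2).

Let ofR2_rot u p : ofR2 (rot u p) = u * ofR2 p.
Proof. by case: u => c s; case: p => x y; apply/eqP; rewrite eq_complex/= eqxx (addrC (c * y)) eqxx. Qed.

Let measurable_rot u : measurable_fun setT (rot u).
Proof.
apply: measurable_fun_pair.
  by apply: measurable_funB; apply: measurable_funM.
by apply: measurable_funD; apply: measurable_funM.
Qed.

Lemma disc_rot (u z : C) : cabs u = 1 -> disc (u * z) <-> disc z.
Proof. by move=> u1; rewrite /disc/mkset cabsM u1 mul1r. Qed.

Lemma bmeas_rot (u : C) (F : C -> R) : cabs u = 1 -> bmeas F -> bmeas (fun z => F (u * z)).
Proof.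
move=> u1 [mF [M FM]]; split; last first.
  by exists M => z zD; apply: FM; exact/disc_rot.
apply: (eq_measurable_fun (fun p => F (ofR2 (rot u p)))) => [p _|]; first by rewrite ofR2_rot.
apply: (measurable_comp (F := disc2) (f := fun p : E => F (ofR2 p))) => //.
- exact: measurable_disc2.
- by move=> _ [p pD <-]; rewrite /disc2/= ofR2_rot; exact/disc_rot.
- exact: measurable_funTS.
Qed.

Lemma radial_rot v (u z : C) : radial v -> cabs u = 1 -> disc z -> v (u * z) = v z.
Proof.
by move=> vr u1 zD; rewrite vr ?disc_rot// cabsM u1 mul1r -vr.
Qed.

Lemma dint_rot v (u : C) (F : C -> R) : weight v -> radial v -> cabs u = 1 -> u != -1 -> bmeas F ->
  dint v (fun z => F (u * z)) = dint v F.
Proof.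
move=> vw vr u1 uN1 bF.
(* The rotation formula is for nonnegative integrands; adding the bound M of F makes the integrand
   nonnegative, and linearity removes M again. *)
suff H (G : C -> R) : bmeas G -> (forall z, disc z -> 0 <= G z) ->
    dint v (fun z => G (u * z)) = dint v G.
  have [_ [M FM]] := bF.
  have bM := bmeas_cst M.
  have := H (fun z => F z + M) (bmeasD bF bM).
  rewrite (dintD vw bF bM) (dintD vw (bmeas_rot u1 bF) bM) => H'.
  apply: (addIr (dint v (fun=> M))); apply: H' => z zD.
  by rewrite -lerBlDr sub0r; have := FM z zD; rewrite ler_norml => /andP[].
move=> [mG _] G0; rewrite /dint /Rintegral; congr fine.
have [v0 iv] := vw.
pose f (p : E) := (G (ofR2 p) * v (ofR2 p))%:E.
have mf : measurable_fun disc2 f.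
  apply/measurable_EFinP; apply: measurable_funM => //.
  by apply/measurable_EFinP; exact: measurable_int iv.
have mf' : measurable_fun setT (f \_ disc2).
  by apply/(measurable_restrictT f measurable_disc2).
have f0 p : (0 <= (f \_ disc2) p)%E.
  by rewrite /patch; case: ifPn => //; rewrite inE => pD; rewrite lee_fin mulr_ge0 ?G0 ?v0.
have cs : complex.Re u ^+ 2 + complex.Im u ^+ 2 = 1 by rewrite -cabs2 u1 expr1n.
(* On the unit circle the real part -1 is attained at -1 only. *)
have c1 : 1 + complex.Re u != 0.
  apply/negP => /eqP c1; move/eqP : uN1; apply.
  have cN : complex.Re u = -1 by lra.
  move: cs; rewrite cN sqrrN expr1n => /eqP; rewrite -subr_eq0 addrAC subrr add0r sqrf_eq0.
  by move=> /eqP s0; apply/eqP; rewrite eq_complex cN s0/= oppr0 !eqxx.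
have mg : measurable_fun setT (fun p => (f \_ disc2) (rot u p)).
  exact: (measurableT_comp mf' (measurable_rot u)).
rewrite [RHS]integral_mkcond [LHS]integral_mkcond.
rewrite (_ : _ \_ disc2 = (fun p => (f \_ disc2) (rot u p))); last first.
  apply/funext => p; rewrite /patch.
  have -> : (rot u p \in disc2) = (p \in disc2).
    by apply/idP/idP; rewrite !inE /disc2/= ofR2_rot => /disc_rot; exact.
  case: ifPn => //; rewrite inE => pD.
  by rewrite /f ofR2_rot (radial_rot vr u1 pD).
rewrite !ge0_integral_mscale//; congr (_ * _)%E; apply/esym.
exact: ge0_integral_rotation.
Qed.

Definition cbmeas F := bmeas (fun z => complex.Re (F z)) /\ bmeas (fun z => complex.Im (F z)).

Definition cint v F : C := dint v (fun z => complex.Re (F z)) +i* dint v (fun z => complex.Im (F z)).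

Lemma eq_cbmeas F G : (forall z, disc z -> F z = G z) -> cbmeas F -> cbmeas G.
Proof.
by move=> FG [b1 b2]; split; [apply: eq_bmeas b1|apply: eq_bmeas b2] => z zD; rewrite FG.
Qed.

Lemma cbmeas_cst (c : C) : cbmeas (fun=> c).
Proof. by split; exact: bmeas_cst. Qed.

Lemma cbmeas_id : cbmeas id.
Proof. by split; [exact: bmeas_Re|exact: bmeas_Im]. Qed.

Lemma cbmeasD F G : cbmeas F -> cbmeas G -> cbmeas (fun z => F z + G z).
Proof.
move=> [f1 f2] [g1 g2]; split.
  by under eq_fun do rewrite cReD; exact: bmeasD.
by under eq_fun do rewrite cImD; exact: bmeasD.
Qed.

Lemma cbmeasM F G : cbmeas F -> cbmeas G -> cbmeas (fun z => F z * G z).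
Proof.
move=> [f1 f2] [g1 g2]; split.
  by under eq_fun do rewrite cReM; apply: bmeasB; exact: bmeasM.
by under eq_fun do rewrite cImM; apply: bmeasD; exact: bmeasM.
Qed.

Lemma cbmeasJ F : cbmeas F -> cbmeas (fun z => (F z)^*).
Proof.
move=> [f1 f2]; split.
  by apply: eq_bmeas f1 => z _; case: (F z).
by apply: eq_bmeas (bmeasN f2) => z _; case: (F z).
Qed.

Lemma cbmeasX F n : cbmeas F -> cbmeas (fun z => F z ^+ n).
Proof.
move=> bF; elim: n => [|n ih]; first exact: cbmeas_cst.
by under eq_fun do rewrite exprS; exact: cbmeasM.
Qed.

Lemma cbmeas_real (f : C -> R) : bmeas f -> cbmeas (fun z => (f z)%:C).
Proof. by move=> bf; split => //; exact: bmeas_cst. Qed.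

Lemma cbmeas_sum (F : nat -> C -> C) n : (forall k, cbmeas (F k)) ->
  cbmeas (fun z => \sum_(0 <= k < n) F k z).
Proof.
move=> bF; elim: n => [|n ih].
  by under eq_fun do rewrite big_nil; exact: cbmeas_cst.
by under eq_fun do rewrite big_nat_recr//=; exact: cbmeasD.
Qed.

Lemma bmeas_cabs_comp F : cbmeas F -> bmeas (fun z => cabs (F z)).
Proof.
move=> [f1 f2]; have [[m1 [M1 h1]] [m2 [M2 h2]]] := (f1, f2); split.
  apply: (eq_measurable_fun (fun p : E => Num.sqrt
    (complex.Re (F (ofR2 p)) ^+ 2 + complex.Im (F (ofR2 p)) ^+ 2))).
    by move=> p _; case: (F _).
  apply: measurableT_comp; first exact: measurable_sqrt.
  by apply: measurable_funD; apply: measurable_funX.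
exists (M1 + M2) => z zD; rewrite ger0_norm ?cabs_ge0//.
by rewrite (le_trans (cabs_le_ReIm _))// lerD ?h1 ?h2.
Qed.

Lemma cbmeas_bound F : cbmeas F -> exists M : R, forall z, disc z -> cabs (F z) <= M.
Proof.
move=> /bmeas_cabs_comp[_ [M h]]; exists M => z /h.
by rewrite ger0_norm// cabs_ge0.
Qed.

Section fixed_weight.
Variable v : C -> R.
Hypothesis vw : weight v.

Lemma eq_cint F G : (forall z, disc z -> F z = G z) -> cint v F = cint v G.
Proof. by move=> FG; congr (_ +i* _); apply: eq_dint => z zD; rewrite FG. Qed.

Lemma cintD F G : cbmeas F -> cbmeas G ->
  cint v (fun z => F z + G z) = cint v F + cint v G.
Proof.
move=> [f1 f2] [g1 g2]; rewrite /cint.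
under eq_dint do rewrite cReD; under [X in _ +i* X]eq_dint do rewrite cImD.
by rewrite !dintD.
Qed.

Lemma cintZ c F : cbmeas F -> cint v (fun z => c * F z) = c * cint v F.
Proof.
move=> [f1 f2]; rewrite /cint.
under eq_dint do rewrite cReM; under [X in _ +i* X]eq_dint do rewrite cImM.
rewrite dintB ?dintD ?dintZ//; try by apply: bmeasM => //; exact: bmeas_cst.
by case: c.
Qed.

Lemma cint0 : cint v (fun=> 0) = 0.
Proof.
by rewrite -[RHS](mul0r (cint v (fun=> 0))) -cintZ; [rewrite mul0r|exact: cbmeas_cst].
Qed.

Lemma cintN F : cbmeas F -> cint v (fun z => - F z) = - cint v F.
Proof.
by move=> bF; rewrite -[RHS]mulN1r -cintZ//; congr cint; apply/funext => z; rewrite mulN1r.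
Qed.

Lemma cintB F G : cbmeas F -> cbmeas G ->
  cint v (fun z => F z - G z) = cint v F - cint v G.
Proof.
move=> bF bG; rewrite cintD ?cintN//.
have := cbmeasM (cbmeas_cst (-1)) bG; apply: eq_cbmeas => z _; exact: mulN1r.
Qed.

Lemma cint_sum (F : nat -> C -> C) n : (forall k, cbmeas (F k)) ->
  cint v (fun z => \sum_(0 <= k < n) F k z) = \sum_(0 <= k < n) cint v (F k).
Proof.
move=> bF; elim: n => [|n ih].
  by rewrite big_nil -[RHS]cint0; congr cint; apply/funext => z; rewrite big_nil.
rewrite big_nat_recr//= -ih -cintD//; last exact: cbmeas_sum.
by congr cint; apply/funext => z; rewrite big_nat_recr.
Qed.

Lemma cint_real (f : C -> R) : cint v (fun z => (f z)%:C) = (dint v f)%:C.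
Proof.
rewrite /cint/=; congr (_ +i* _).
rewrite -[RHS](mul0r (dint v (fun=> 0))) -dintZ//; last exact: bmeas_cst.
by rewrite mul0r.
Qed.

Lemma Re_cint F : complex.Re (cint v F) = dint v (fun z => complex.Re (F z)).
Proof. by []. Qed.

Lemma cabs_cint F : cbmeas F -> cabs (cint v F) <= dint v (fun z => cabs (F z)).
Proof.
(* A unimodular u makes u times the integral real and nonnegative; u then moves inside, where Re(u
   F) <= |F|. *)
move=> bF; have [u [u1 uE]] := cabs_phase (cint v F).
have -> : cabs (cint v F) = complex.Re (u * cint v F) by rewrite uE.
rewrite -cintZ// Re_cint.
have [b1 _] := cbmeasM (cbmeas_cst u) bF.
apply: dint_le => //; first exact: bmeas_cabs_comp.
move=> z _; rewrite (le_trans (ler_norm _))// (le_trans (Re_le_cabs _))//.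
by rewrite cabsM u1 mul1r.
Qed.

Lemma cvg_Re (x : nat -> C) l : x @ \oo --> l ->
  (fun n => complex.Re (x n)) @ \oo --> complex.Re l.
Proof.
move=> /cvgCP xl; apply/cvgrPdist_lt => e e0.
move/cvgrPdist_lt : xl => /(_ _ e0); apply: filterS => n.
rewrite sub0r normrN ger0_norm ?cabs_ge0// cabs_distC; apply: le_lt_trans.
by rewrite -cReB Re_le_cabs.
Qed.

Lemma cvg_Im (x : nat -> C) l : x @ \oo --> l ->
  (fun n => complex.Im (x n)) @ \oo --> complex.Im l.
Proof.
move=> /cvgCP xl; apply/cvgrPdist_lt => e e0.
move/cvgrPdist_lt : xl => /(_ _ e0); apply: filterS => n.
rewrite sub0r normrN ger0_norm ?cabs_ge0// cabs_distC; apply: le_lt_trans.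
by rewrite -cImB Im_le_cabs.
Qed.

Lemma cvg_ReIm (x : nat -> C) l : (fun n => complex.Re (x n)) @ \oo --> complex.Re l ->
  (fun n => complex.Im (x n)) @ \oo --> complex.Im l -> x @ \oo --> l.
Proof.
move=> hr hi; apply/cvgCP.
apply: (@squeeze_cvgr _ _ _ _ (cst 0) (fun n =>
    `|complex.Re (x n) - complex.Re l| + `|complex.Im (x n) - complex.Im l|)).
- apply: nearW => n; rewrite cabs_ge0/=.
  by rewrite (le_trans (cabs_le_ReIm _))// cReB cImB.
- exact: cvg_cst.
- have -> : (0 : R) = `|complex.Re l - complex.Re l| + `|complex.Im l - complex.Im l|.
    by rewrite !subrr normr0 addr0.
  by apply: cvgD; apply: cvg_norm; apply: cvgB => //; exact: cvg_cst.
Qed.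

Lemma bounded_ccvg (F_ : nat -> C -> C) F (M : R) : (forall n, cbmeas (F_ n)) ->
  (forall n z, disc z -> cabs (F_ n z) <= M) ->
  (forall z, disc z -> (fun n => F_ n z) @ \oo --> F z) ->
  cbmeas F /\ (fun n => cint v (F_ n)) @ \oo --> cint v F.
Proof.
move=> bF FM cF.
have [||z zD|b1 c1] := @bounded_cvg _ v vw (fun n z => complex.Re (F_ n z))
    (fun z => complex.Re (F z)) M.
- by move=> n; case: (bF n).
- by move=> n z zD; rewrite (le_trans (Re_le_cabs _))// FM.
- exact: (cvg_Re (cF z zD)).
have [||z zD|b2 c2] := @bounded_cvg _ v vw (fun n z => complex.Im (F_ n z))
    (fun z => complex.Im (F z)) M.
- by move=> n; case: (bF n).
- by move=> n z zD; rewrite (le_trans (Im_le_cabs _))// FM.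
- exact: (cvg_Im (cF z zD)).
by split => //; exact: cvg_ReIm.
Qed.

Lemma cint_rot (u : C) F : radial v -> cabs u = 1 -> u != -1 -> cbmeas F ->
  cint v (fun z => F (u * z)) = cint v F.
Proof.
move=> vr u1 uN [f1 f2]; congr (_ +i* _).
  exact: (dint_rot vw vr u1 uN f1).
exact: (dint_rot vw vr u1 uN f2).
Qed.

End fixed_weight.

Definition expi (t : R) : C := cos t +i* sin t.

Lemma cabs_expi t : cabs (expi t) = 1.
Proof. by rewrite /expi/= cos2Dsin2 sqrtr1. Qed.

Lemma expiX t n : expi t ^+ n = expi (t *+ n).
Proof.
elim: n => [|n ih]; first by rewrite expr0 mulr0n /expi cos0 sin0.
rewrite exprS ih mulrS /expi cosD sinD; apply/eqP; rewrite eq_complex/= eqxx/=.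
by rewrite addrC.
Qed.

Lemma expi_neqN1 t : 0 < t < pi -> expi t != -1.
Proof.
move=> /sin_gt0_pi s0; apply/eqP => /(congr1 (@complex.Im R))/= h.
by move: s0; rewrite h oppr0 ltxx.
Qed.

(** u = e^(i pi / (n + 1)) works: n times its angle still lies strictly between 0 and pi, so u^n has
    a positive imaginary part. *)
Lemma rotation_not_root n : (0 < n)%N ->
  exists u : C, [/\ cabs u = 1, u != -1 & u ^+ n != 1].
Proof.
move=> n0; pose t : R := pi / n.+1%:R.
have t0 : 0 < t by rewrite divr_gt0 ?pi_gt0.
exists (expi t); split; first exact: cabs_expi.
- apply: expi_neqN1; rewrite t0/= ltr_pdivrMr// ltr_pMr ?pi_gt0//.
  by rewrite ltr1n.
- rewrite expiX; apply/eqP => /(congr1 (@complex.Im R))/= h.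
  have : 0 < sin (t *+ n).
    apply: sin_gt0_pi; rewrite pmulrn_lgt0// t0/= -mulr_natr mulrAC ltr_pdivrMr//.
    by rewrite ltr_pM2l ?pi_gt0// ltr_nat.
  by rewrite h ltxx.
Qed.

Section orthogonality.
Variable v : C -> R.
Hypotheses (vw : weight v) (vr : radial v).

Lemma cabsXJ (z : C) k : z ^+ k * z^* ^+ k = (cabs z ^+ (2 * k))%:C.
Proof. by rewrite -exprMn mulJ_cabs -rmorphXn exprM. Qed.

(** A rotation by u multiplies the integral by u^j conj(u)^k, which differs from 1 for a suitable u,
    whereas rotation invariance leaves the integral unchanged. *)
Lemma cint_orthogonal (phi : C -> R) j k : bmeas phi ->
  (forall u z, cabs u = 1 -> disc z -> phi (u * z) = phi z) -> j != k ->
  cint v (fun z => (phi z)%:C * (z ^+ j * z^* ^+ k)) = 0.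
Proof.
move=> bphi phir jk.
(* On the unit circle u^j conj(u)^k is u^(j-k), so it suffices to avoid the m-th roots of unity for
   m = |j - k|. *)
have [m [m0 H]] : exists m, (0 < m)%N /\ forall u : C, cabs u = 1 ->
    u ^+ m != 1 -> u ^+ j * u^* ^+ k != 1.
  have nz (u : C) : cabs u = 1 -> u != 0.
    by move=> u1; rewrite -cabs_eq0 u1 oner_eq0.
  have uJ (u : C) : cabs u = 1 -> u^* = u^-1.
    move=> u1; apply: (mulfI (nz _ u1)); rewrite mulJ_cabs u1 expr1n mulfV//.
    exact: nz.
  have [jlk|klj|] := ltngtP j k; last by move=> e; rewrite e eqxx in jk.
  - exists (k - j)%N; rewrite subn_gt0; split => // u u1 h.
    apply: contra h => /eqP h; rewrite -(inj_eq (mulfI (expf_neq0 j (nz _ u1)))).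
    rewrite -exprD subnKC ?(ltnW jlk)// mulr1.
    rewrite -(inj_eq (mulIf (invr_neq0 (expf_neq0 k (nz _ u1))))).
    by rewrite mulfV ?expf_neq0 ?nz// -exprVn -uJ// h.
  - exists (j - k)%N; rewrite subn_gt0; split => // u u1 h.
    apply: contra h => /eqP h; rewrite -(inj_eq (mulfI (expf_neq0 k (nz _ u1)))).
    rewrite -exprD subnKC ?(ltnW klj)// mulr1.
    rewrite -(inj_eq (mulIf (invr_neq0 (expf_neq0 k (nz _ u1))))).
    by rewrite mulfV ?expf_neq0 ?nz// -exprVn -uJ// h.
have [u [u1 uN um]] := rotation_not_root m0.
have bF : cbmeas (fun z : C => (phi z)%:C * (z ^+ j * z^* ^+ k)).
  apply: cbmeasM; first exact: cbmeas_real.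
  by apply: cbmeasM; apply: cbmeasX; [exact: cbmeas_id|exact: cbmeasJ cbmeas_id].
have := cint_rot vw vr u1 uN bF.
rewrite (eq_cint v (G := fun z => (u ^+ j * u^* ^+ k) * ((phi z)%:C * (z ^+ j * z^* ^+ k)))).
  rewrite cintZ// => /eqP; rewrite -subr_eq0 -{2}[cint v _]mul1r -mulrBl mulf_eq0.
  by rewrite subr_eq0 (negbTE (H _ u1 um)) => /eqP.
by move=> z zD; rewrite phir// !exprMn rmorphM exprMn; ring.
Qed.

Lemma cint_diagonal (phi : C -> R) k :
  cint v (fun z => (phi z)%:C * (z ^+ k * z^* ^+ k)) =
  (dint v (fun z => phi z * cabs z ^+ (2 * k)))%:C.
Proof.
by rewrite -cint_real//; congr cint; apply/funext => z; rewrite cabsXJ -rmorphM.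
Qed.

End orthogonality.
End ComplexDiscIntegral.

(** * Tails of radial weights *)

Section RadialTails.
Context {R : realType}.
Local Notation C := R[i].
Local Notation mu := (@lebesgue_measure R).
Local Notation MR := (measurableTypeR R).
Local Notation E := (MR * MR)%type.
Local Notation I01 := (`[0%R, 1%R[%classic : set MR).
Variable w : C -> R.
Hypotheses (ww : weight w) (wr : radial w).

Lemma disc_real (r : R) : 0 <= r < 1 -> disc r%:C.
Proof. by move=> /andP[r0 r1]; rewrite /disc/mkset cabs_ge0_real. Qed.

Lemma weight_real_ge0 (r : R) : 0 <= r < 1 -> 0 <= w r%:C.
Proof. by move=> /disc_real; case: ww => + _; exact. Qed.

Lemma measurable_weight_real : measurable_fun I01 (fun r : MR => w r%:C : MR).
Proof.
have [_ /measurable_int/measurable_EFinP mw] := ww.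
apply: (measurable_comp (F := disc2) (f := fun p : E => w (ofR2 p)) (g := fun r : MR => (r, 0 : MR))).
- exact: measurable_disc2.
- move=> q [r /=]; rewrite in_itv/= => r01 <-.
  exact: (disc_real r01).
- exact: mw.
- by apply: measurable_funTS; exact: measurable_fun_pair.
Qed.

Lemma dint_polar (phi : MR -> MR) : measurable_fun I01 phi ->
  (forall r, 0 <= r < 1 -> 0 <= phi r) -> (exists M : R, forall r, 0 <= r < 1 -> phi r <= M) ->
  ((dint w (fun z => phi (cabs z)))%:E =
   \int[mu]_(r in `[0%R, 1%R[) (2 * r * phi r * w r%:C)%:E)%E.
Proof.
move=> mphi phi0 [M phiM].
have bphi : bmeas (fun z : C => phi (cabs z)).
  apply: (bmeas_radial (M := M)) => // r r01.
  by rewrite ger0_norm ?phi0 ?phiM.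
rewrite /dint /Rintegral fineK; last first.
  exact: (integrable_fin_num measurable_disc2 (dint_integrable ww bphi)).
transitivity (\int[dA]_(p in disc2) (phi (cabs (ofR2 p)) * w (cabs (ofR2 p))%:C)%:E)%E.
  by apply: eq_integral => p; rewrite inE => pD; rewrite -wr.
rewrite (ge0_integral_disc_polar (psi := fun r => (phi r * w r%:C)%:E)).
- by apply: eq_integral => r _; rewrite -EFinM mulrA.
- by apply/measurable_EFinP; apply: measurable_funM => //; exact: measurable_weight_real.
- by move=> r r01; rewrite lee_fin mulr_ge0 ?phi0 ?weight_real_ge0.
Qed.

(** Serves both w (phi = 1) and the shifted weight (phi = (1 - r)^a): all moments become integrals
    against the same w. *)
Lemma moment_dint (g : C -> R) (phi : MR -> MR) k : measurable_fun I01 phi ->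
  (forall r, 0 <= r < 1 -> 0 <= phi r) -> (exists M : R, forall r, 0 <= r < 1 -> phi r <= M) ->
  (forall r : R, 0 <= r < 1 -> g r%:C = phi r * w r%:C) ->
  moment g k = dint w (fun z => phi (cabs z) * cabs z ^+ (2 * k)).
Proof.
move=> mphi phi0 [M phiM] gphi.
have mI : measurable I01 by exact: measurable_itv.
pose psi (r : MR) : MR := phi r * r ^+ (2 * k).
have mpsi : measurable_fun I01 psi.
  by apply: measurable_funM => //; exact: exprn_measurable.
have psi0 r : 0 <= r < 1 -> 0 <= psi r.
  by move=> r01; rewrite mulr_ge0 ?phi0// exprn_ge0//; case/andP : r01.
have /(dint_polar mpsi psi0) : exists M0 : R, forall r, 0 <= r < 1 -> psi r <= M0.
  exists M => r r01; rewrite /psi -[leRHS]mulr1 ler_pM ?phi0 ?phiM//.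
    by rewrite exprn_ge0//; case/andP : r01.
  by rewrite exprn_ile1//; case/andP : r01 => // _ /ltW.
rewrite /psi => H; rewrite /moment /Rintegral.
have E1 : (\int[mu]_(r in `[0%R, 1%R[) (2 * r * psi r * w r%:C)%:E =
  2%:E * \int[mu]_(r in `[0%R, 1%R[) (r ^+ (2 * k + 1) * g r%:C)%:E)%E.
  rewrite -ge0_integralZl//.
  - apply: eq_integral => r; rewrite inE/= in_itv/= => r01.
    rewrite -EFinM gphi// /psi addn1 exprS; congr EFin; ring.
  - apply/measurable_EFinP.
    apply: (eq_measurable_fun (fun r : MR => r ^+ (2 * k + 1) * (phi r * w r%:C) : MR)).
      by move=> r; rewrite inE/= in_itv/= => r01; rewrite gphi.
    apply: measurable_funM; first by apply: exprn_measurable.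
    by apply: measurable_funM => //; exact: measurable_weight_real.
  - move=> r /=; rewrite in_itv/= => r01; rewrite lee_fin gphi// !mulr_ge0 ?phi0 ?weight_real_ge0//.
    by rewrite exprn_ge0//; case/andP : r01.
move: H; rewrite E1; set X := (\int[mu]_(r in _) _)%E => H.
have X0 : (0 <= X)%E.
  apply: integral_ge0 => r /=; rewrite in_itv/= => r01.
  rewrite lee_fin gphi// !mulr_ge0 ?phi0 ?weight_real_ge0//.
  by rewrite exprn_ge0//; case/andP : r01.
(* [moment] takes the finite part of an extended integral; the identity H, whose left side is
   finite, excludes the value +oo. *)
case: X X0 H => [x _|_|//]; first by rewrite -EFinM => -[->].
by rewrite gt0_muley// lte_fin.
Qed.

(** In polar coordinates, the integral of 2 s w(s) over [r, 1). Unlike [what] it is finite at r = 0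
    too, and as an integral over the disc it compares directly with moments. *)
Definition tail (r : R) : R := dint w (fun z => (r <= cabs z)%R%:R).

Lemma measurable_ge (r : R) : measurable_fun I01 (fun s : MR => (r <= s)%R%:R : MR).
Proof.
apply: nondecreasing_measurable; first exact: measurable_itv.
move=> s t st; case: (leP r s) => rs; last by rewrite ler0n.
by rewrite (le_trans rs st).
Qed.

Lemma bmeas_ge (r : R) : bmeas (fun z : C => (r <= cabs z)%R%:R).
Proof.
apply: (bmeas_radial (phi := fun s : MR => (r <= s)%R%:R : MR) (M := 1)) => [|s _].
  exact: measurable_ge.
by case: (r <= s); rewrite ?normr1 ?normr0.
Qed.

Lemma tail_le r s : r <= s -> tail s <= tail r.
Proof.
move=> rs; apply: dint_le => //; try exact: bmeas_ge.
move=> z _; have [sz|_] := leP s (cabs z); last exact: ler0n.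
by rewrite (le_trans rs sz).
Qed.

Let whatE (r : R) : 0 <= r < 1 ->
  (what w r = \int[mu]_(s in `[0%R, 1%R[) ((r <= s)%R%:R * w s%:C)%:E)%E.
Proof.
move=> /andP[r0 r1].
rewrite /what [LHS]integral_mkcond [RHS]integral_mkcond; apply: eq_integral => s _.
rewrite /patch !mem_setE !in_itv/=.
case: (leP r s) => [rs|sr]/=; first by rewrite (le_trans r0 rs)/= mul1r.
by case: ifP => //; rewrite mul0r.
Qed.

Let tailE (r : R) :
  ((tail r)%:E = \int[mu]_(s in `[0%R, 1%R[) (2 * s * (r <= s)%R%:R * w s%:C)%:E)%E.
Proof.
apply: (dint_polar (phi := fun s : MR => (r <= s)%R%:R : MR)).
- exact: measurable_ge.
- by move=> s _; rewrite ler0n.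
- by exists 1 => s _; case: (r <= s).
Qed.

Let measurable_tail_fun (r : R) :
  measurable_fun I01 (fun s : MR => ((r <= s)%R%:R * w s%:C)%:E).
Proof.
apply/measurable_EFinP; apply: measurable_funM; first exact: measurable_ge.
exact: measurable_weight_real.
Qed.

Let measurable_tail_fun2 (r : R) :
  measurable_fun I01 (fun s : MR => (2 * s * (r <= s)%R%:R * w s%:C)%:E).
Proof.
apply/measurable_EFinP; apply: measurable_funM; last exact: measurable_weight_real.
apply: measurable_funM; last exact: measurable_ge.
exact: mulrl_measurable.
Qed.

Lemma tail_le_what (r : R) : 0 <= r < 1 -> ((tail r)%:E <= 2%:E * what w r)%E.
Proof.
move=> r01; rewrite tailE whatE// -ge0_integralZl//; last first.
  by move=> s /=; rewrite in_itv/= => s01; rewrite lee_fin mulr_ge0// weight_real_ge0.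
apply: ge0_le_integral => //.
- move=> s /=; rewrite in_itv/= => s01; rewrite lee_fin !mulr_ge0 ?weight_real_ge0//.
  by case/andP : s01.
- by apply: measurable_funeM; exact: measurable_tail_fun.
- move=> s /=; rewrite in_itv/= => s01; rewrite -EFinM lee_fin mulrA ler_wpM2r ?weight_real_ge0//.
  by rewrite ler_wpM2r// ler_piMr//; case/andP : s01 => _ /ltW.
Qed.

(** On [r, 1) the density 2 s is at least 2 r. At r = 0 this says nothing, hence the restriction to
    r >= 1/2 in later comparisons. *)
Lemma what_le_tail (r : R) : 0 <= r < 1 -> ((2 * r)%:E * what w r <= (tail r)%:E)%E.
Proof.
move=> r01; have /andP[r0 r1] := r01.
rewrite tailE whatE// -ge0_integralZl//; last 2 first.
- by move=> s /=; rewrite in_itv/= => s01; rewrite lee_fin mulr_ge0// weight_real_ge0.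
- by rewrite lee_fin mulr_ge0.
apply: ge0_le_integral => //.
- move=> s /=; rewrite in_itv/= => s01; rewrite -EFinM lee_fin !mulr_ge0 ?weight_real_ge0//.
- by apply: measurable_funeM; exact: measurable_tail_fun.
- move=> s /=; rewrite in_itv/= => s01; rewrite -EFinM lee_fin mulrA ler_wpM2r ?weight_real_ge0//.
  by case: (leP r s) => rs; rewrite ?mulr1 ?mulr0// ler_pM2l.
Qed.

End RadialTails.

(** * Doubling and decay of tails in class D *)

Section ClassDTails.
Context {R : realType}.
Variable w : R[i] -> R.
Hypothesis hw : classD w.

Lemma classD_weight : weight w.
Proof. by have [[[]]] := hw. Qed.

Lemma classD_radial : radial w.
Proof. by have [[[]]] := hw. Qed.

Let ww := classD_weight.
Let wr := classD_radial.

Let what_gt0 r : 0 <= r < 1 -> (0 < what w r)%E.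
Proof. by have [[[_ _ H] _] _] := hw; exact: H. Qed.

(** For r >= 1/2 the factor 2 r is at least 1, so the finite tail bounds [what] and excludes the
    value +oo. *)
Let what_fin r : 1 / 2 <= r < 1 -> exists x : R, [/\ what w r = x%:E, 0 < x & x <= tail w r].
Proof.
move=> /andP[r0 r1]; have r01 : 0 <= r < 1 by rewrite r1 andbT; lra.
have := what_le_tail ww wr r01; have := what_gt0 r01.
case: (what w r) => [x|_|//].
  rewrite lte_fin -EFinM lee_fin => x0 h; exists x; split => //.
  by apply: le_trans h; nra.
by rewrite gt0_muley ?lte_fin//; lra.
Qed.

Lemma tail_gt0 r : 0 <= r < 1 -> 0 < tail w r.
Proof.
move=> /andP[r0 r1].
have [|x [_ x0 xt]] := @what_fin ((1 + r) / 2); first by apply/andP; split; lra.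
apply: lt_le_trans (tail_le ww (_ : r <= (1 + r) / 2)); last by lra.
exact: lt_le_trans xt.
Qed.

(** The midpoint (1 + r) / 2 is at least 1/2, where [what] is below the tail. The factor 2 comes
    from the comparison at r, and the added 1 ensures that the constant is at least 1. *)
Lemma tail_doubling : exists2 c : R, 1 <= c &
  forall r, 0 <= r < 1 -> tail w r <= c * tail w ((1 + r) / 2).
Proof.
have [[_ [c c0 H]] _] := hw.
exists (2 * c + 1); first by lra.
move=> r r01; have /andP[r0 r1] := r01.
have [|x [xE x0 xt]] := @what_fin ((1 + r) / 2); first by apply/andP; split; lra.
have := tail_le_what ww wr r01; have := H r r01; rewrite xE -EFinM.
move=> h1 /le_trans => /(_ (2 * (c * x))%:E); rewrite (EFinM 2) lee_pmul2l// => /(_ h1).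
rewrite lee_fin => h2; apply: (le_trans h2).
have := mulr_ge0 (ltW c0) (ltW x0); nra.
Qed.

(** Iterating [Dcheck] n times divides [what] by c^n while 1 - r shrinks by K^n. With c^n >= 16, the
    factor 2 lost in returning from [what] to tails still leaves 8. *)
Lemma tail_decay : exists2 b : R, 1 < b &
  forall r, 1 / 2 <= r < 1 -> tail w (1 - (1 - r) / b) <= tail w r / 8.
Proof.
have [_ [_ [K [c [K1 c1 H]]]]] := hw.
have Hn n : forall r, 0 <= r < 1 -> ((c ^+ n)%:E * what w (1 - (1 - r) / K ^+ n) <= what w r)%E.
  elim: n => [|n ih] r r01.
    by rewrite !expr0 mul1e divr1 opprB addrC subrK.
  have /andP[r0 r1] := r01.
  have q01 : 0 < (1 - r) / K <= 1.
    rewrite divr_gt0 ?subr_gt0//=; last by lra.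
    by rewrite ler_pdivrMr ?mul1r; lra.
  have := ih (1 - (1 - r) / K) ltac:(by apply/andP; split; lra).
  have -> : (1 - (1 - (1 - r) / K)) / K ^+ n = (1 - r) / K ^+ n.+1.
    rewrite exprS invfM; ring.
  move=> h; apply: le_trans (H r r01); rewrite exprS EFinM -muleA lee_pmul2l//.
  by rewrite lte_fin; lra.
(* Bernoulli bounds c^n below by a linear function of n; n > 0 is needed for K^n > 1. *)
have [n n1 cn] : exists2 n, (0 < n)%N & 16 <= c ^+ n.
  have cB n : 1 + n%:R * (c - 1) <= c ^+ n.
    elim: n => [|n ih]; first by rewrite mul0r addr0 expr0.
    have n0 : 0 <= n%:R * (c - 1) by rewrite mulr_ge0//; lra.
    rewrite exprS -natr1; nra.
  have [m Hm] : exists m : nat, 16 / (c - 1) <= m%:R.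
    exists (Num.truncn (16 / (c - 1))).+1; apply/ltW/truncnS_gt.
  exists m.+1 => //; apply: le_trans (cB m.+1).
  have c10 : 0 < c - 1 by lra.
  move: Hm; rewrite ler_pdivrMr// -natr1; nra.
have Kn : 1 < K ^+ n by rewrite exprn_egt1// -lt0n.
exists (K ^+ n) => // r /andP[r0 r1].
have [|x [xE x0 xt]] := @what_fin r; first by rewrite r0 r1.
have K0 : 0 < K ^+ n by lra.
have q01 : 0 < (1 - r) / K ^+ n <= 1 - r.
  rewrite divr_gt0 ?subr_gt0//= ler_pdivrMr// ler_peMr//; lra.
have [|y [yE y0 yt]] := @what_fin (1 - (1 - r) / K ^+ n); first by apply/andP; split; lra.
have := Hn n r ltac:(by apply/andP; split; lra); rewrite xE yE -EFinM lee_fin => h.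
have := @tail_le_what _ w ww wr (1 - (1 - r) / K ^+ n) ltac:(by apply/andP; split; lra).
rewrite yE -EFinM lee_fin => h2; nra.
Qed.

End ClassDTails.

(** * Moments *)

Section Moments.
Context {R : realType}.
Local Notation C := R[i].
Local Notation MR := (measurableTypeR R).
Local Notation I01 := (`[0%R, 1%R[%classic : set MR).

(** The sum is the integer part of y capped at N. This is a discrete layer cake formula: up to an
    error of 1, a function is a sum of indicators of its superlevel sets. *)
Lemma staircase (y : R) N : 0 <= y <= N.+1%:R ->
  \sum_(0 <= j < N) (j.+1%:R <= y)%R%:R <= y <= 1 + \sum_(0 <= j < N) (j.+1%:R <= y)%R%:R.
Proof.
elim: N => [|N ih]; first by rewrite big_nil addr0 => /andP[-> ->].
rewrite big_nat_recr//= => /andP[y0 yN].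
have [Ny|yN'] := leP N.+1%:R y; last by rewrite addr0; apply: ih; rewrite y0 ltW.
have -> : \sum_(0 <= j < N) (j.+1%:R <= y)%R%:R = N%:R :> R.
  rewrite (eq_big_nat _ _ (F2 := fun=> 1)) => [|j /andP[_ jN]].
    by rewrite big_const_nat subn0 iter_addr_0.
  by suff -> : j.+1%:R <= y by []; apply: le_trans Ny; rewrite ler_nat leqW.
by rewrite natr1 Ny/= nat1r.
Qed.

Lemma powR_le1 (x a : R) : 0 <= x <= 1 -> 0 <= a -> x `^ a <= 1.
Proof.
move=> /andP[x0 x1] a0; have E1 : (1 : R) `^ a = 1 by rewrite powR1.
by rewrite -[leRHS]E1 ge0_ler_powR// nnegrE.
Qed.

Lemma powR_le_pow (x a : R) n : 0 <= x -> 0 <= a <= n%:R -> x `^ a <= 1 + x ^+ n.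
Proof.
move=> x0 /andP[a0 an]; have xn : 0 <= x ^+ n by rewrite exprn_ge0.
have [x1|x1] := leP x 1.
  rewrite (@le_trans _ _ 1)// ?lerDl//.
  by rewrite powR_le1// x0.
rewrite (@le_trans _ _ (x ^+ n))// ?lerDr// -powR_mulrn//.
by rewrite ler_powR// ltW.
Qed.

(** Induction on n, with r^k <= r^j r^j for j = k / 2: one half absorbs one factor through
    [natS_pow_le], the other absorbs the remaining n. Since k + 1 <= 2 (j + 1), a step costs
    2^(n+1). *)
Lemma pow_decay n : exists2 c : R, 0 < c & forall k (r : R), 0 <= r < 1 ->
  (k.+1%:R * (1 - r)) ^+ n * r ^+ k <= c.
Proof.
elim: n => [|n [c c0 ih]].
  exists 1 => // k r /andP[r0 r1]; rewrite expr0 mul1r exprn_ile1//; exact: ltW.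
exists (2 * 2 ^+ n * c); first by rewrite !mulr_gt0// exprn_gt0.
move=> k r r01; have /andP[r0 r1] := r01.
pose j := k./2.
have jk : (j + j <= k)%N by rewrite addnn -[leqRHS]odd_double_half leq_addl.
have kj : (k.+1 <= 2 * j.+1)%N.
  by rewrite mul2n -addnn addSn addnS addnn -{1}(odd_double_half k) -/j; case: (odd k).
have kj' : k.+1%:R <= 2 * j.+1%:R :> R by rewrite -natrM ler_nat.
have s0 : 0 <= 1 - r by rewrite subr_ge0 ltW.
have h1 := natS_pow_le j r01.
have h2 := ih j r r01.
have A0 : 0 <= k.+1%:R * (1 - r) by rewrite mulr_ge0.
have B0 : 0 <= j.+1%:R * (1 - r) by rewrite mulr_ge0.
have AB : k.+1%:R * (1 - r) <= 2 * (j.+1%:R * (1 - r)) by rewrite mulrA ler_wpM2r.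
have rj : 0 <= r ^+ j by rewrite exprn_ge0.
apply: (@le_trans _ _ ((2 * (j.+1%:R * (1 - r))) ^+ n.+1 * r ^+ (j + j))).
  rewrite ler_pM ?exprn_ge0//; first by rewrite lerXn2r// nnegrE mulr_ge0.
  by rewrite ler_wiXn2l// ltW.
rewrite exprD exprS exprMn.
set B := j.+1%:R * (1 - r) in B0 h2 AB *.
have -> : 2 * B * (2 ^+ n * B ^+ n) * (r ^+ j * r ^+ j) =
  (2 * 2 ^+ n) * ((B * r ^+ j) * (B ^+ n * r ^+ j)) by ring.
have B1 : B * r ^+ j <= 1 by move: h1; rewrite /B -mulrA (mulrC (r ^+ j)) mulrA.
apply: ler_wpM2l; first by rewrite mulr_ge0// exprn_ge0.
rewrite -[leRHS]mul1r ler_pM// mulr_ge0//; exact: exprn_ge0.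
Qed.

Lemma powR_decay (a : R) : 0 <= a -> exists2 c : R, 0 < c & forall k (r : R), 0 <= r < 1 ->
  k.+1%:R `^ a * (1 - r) `^ a * r ^+ k <= c.
Proof.
(* A real exponent is reduced to an integer n >= a by x^a <= 1 + x^n. *)
move=> a0; pose n := (Num.truncn a).+1.
have [c c0 H] := pow_decay n.
exists (1 + c); first by lra.
move=> k r r01; have /andP[r0 r1] := r01.
have s0 : 0 <= 1 - r by rewrite subr_ge0 ltW.
have rk : 0 <= r ^+ k by rewrite exprn_ge0.
rewrite -powRM//; apply: (@le_trans _ _ ((1 + (k.+1%:R * (1 - r)) ^+ n) * r ^+ k)).
  rewrite ler_wpM2r// powR_le_pow ?mulr_ge0// a0/= ltW//; exact: truncnS_gt.
rewrite mulrDl mul1r lerD//; last exact: H.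
by rewrite exprn_ile1// ltW.
Qed.

Section fixed_weight.
Variable w : C -> R.
Hypotheses (hw : classD w).
Let ww := classD_weight hw.
Let wr := classD_radial hw.

Let M n := dint w (fun z => cabs z ^+ n).

Let bpow n : bmeas (fun z : C => cabs z ^+ n).
Proof. exact: bmeasX bmeas_cabs. Qed.

Let bplus n : bmeas (fun z : C => Num.max (2 * cabs z - 1) 0 ^+ n).
Proof.
apply: bmeasX; apply: (bmeas_radial (phi := fun r : MR => Num.max (2 * r - 1) 0 : MR) (M := 1)).
  apply: measurable_maxr => //; apply: measurable_funB => //.
move=> r /andP[r0 r1]; rewrite ger0_norm ?le_max ?lexx ?orbT//.
by rewrite ge_max; apply/andP; split; lra.
Qed.

(* Tail domination [tail r <= c * tail ((1 + r) / 2)] compares |z| with (2 |z| - 1)^+ in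
   distribution, hence every increasing function of them; here the function is x^n, written
   as a limit of sums of tail indicators. *)
Lemma tail_doubling_pow (c : R) n : (0 < n)%N -> 1 <= c ->
  (forall r, 0 <= r < 1 -> tail w r <= c * tail w ((1 + r) / 2)) ->
  M n <= c * dint w (fun z => Num.max (2 * cabs z - 1) 0 ^+ n).
Proof.
move=> n0 c1 H.
set P := dint w _.
have M0 : 0 <= M 0 by apply: dint_ge0 => // z _; rewrite exprn_ge0// cabs_ge0.
(* The staircase error 1 integrates to M 0; dividing by N + 1 and letting N grow removes it. *)
suff HN N : N.+1%:R * M n <= M 0 + c * (N.+1%:R * P).
  rewrite leNgt; apply/negP => lt; have e0 : 0 < M n - c * P by rewrite subr_gt0.
  have := HN (Num.truncn (M 0 / (M n - c * P))).
  have := truncnS_gt (M 0 / (M n - c * P)); rewrite ltr_pdivrMr//.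
  by move: _.+1%:R => K h1 h2; nra.
(* x j is the level at which (N + 1) s^n reaches j + 1; for j < N it stays below 1, where the tail
   hypothesis applies. *)
pose x j : R := (j.+1%:R / N.+1%:R) `^ n%:R^-1.
have N0 : (0 : R) < N.+1%:R by [].
have xn j : x j ^+ n = j.+1%:R / N.+1%:R.
  rewrite -powR_mulrn ?powR_ge0// -powRrM mulVf ?powRr1// ?divr_ge0//.
  by rewrite pnatr_eq0 -lt0n.
have x0 j : 0 < x j by rewrite powR_gt0// divr_gt0.
have x1 j : (j < N)%N -> x j < 1.
  move=> jN; rewrite -(@ltr_pXn2r _ n)// ?nnegrE ?(ltW (x0 j))// xn expr1n.
  by rewrite ltr_pdivrMr// mul1r ltr_nat.
have xle j (s : R) : 0 <= s -> (j.+1%:R <= N.+1%:R * s ^+ n) = (x j <= s).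
  move=> s0; rewrite mulrC -ler_pdivrMr// -xn ler_pXn2r// nnegrE//.
  exact: ltW.
have stp (s : R) : 0 <= s < 1 -> \sum_(0 <= j < N) (x j <= s)%R%:R <= N.+1%:R * s ^+ n
    <= 1 + \sum_(0 <= j < N) (x j <= s)%R%:R.
  move=> /andP[s0 s1].
  rewrite (eq_bigr (fun j : nat => (j.+1%:R <= N.+1%:R * s ^+ n)%R%:R)); last by move=> j _; rewrite xle.
  apply: staircase; rewrite mulr_ge0 ?exprn_ge0//=.
  by rewrite -[leRHS]mulr1 ler_pM2l// exprn_ile1// ltW.
have bsum (g : nat -> C -> R) : (forall j, bmeas (g j)) -> bmeas (fun z => \sum_(0 <= j < N) g j z).
  move=> bg; elim: N {x N0 xn x0 x1 xle stp} => [|m ih].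
    by under eq_fun do rewrite big_nil; exact: bmeas_cst.
  by under eq_fun do rewrite big_nat_recr//=; exact: bmeasD.
have dsum (g : nat -> C -> R) : (forall j, bmeas (g j)) ->
    dint w (fun z => \sum_(0 <= j < N) g j z) = \sum_(0 <= j < N) dint w (g j).
  move=> bg; have bs m : bmeas (fun z => \sum_(0 <= j < m) g j z).
    elim: m => [|m ih]; first by under eq_fun do rewrite big_nil; exact: bmeas_cst.
    by under eq_fun do rewrite big_nat_recr//=; exact: bmeasD.
  elim: {bsum x N0 xn x0 x1 xle stp} N => [|m ih].
    rewrite big_nil -[RHS](mul0r (dint w (fun=> 0))) -(dintZ ww _ (bmeas_cst 0)).
    by apply: eq_dint => z _; rewrite big_nil mul0r.
  rewrite big_nat_recr//= -ih -dintD//.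
  by apply: eq_dint => z _; rewrite big_nat_recr.
have bge j : bmeas (fun z : C => (x j <= cabs z)%R%:R) by exact: bmeas_ge.
have E1 : N.+1%:R * M n <= M 0 + \sum_(0 <= j < N) tail w (x j).
  rewrite /M -dintZ// -dsum// -dintD//; last exact: bsum.
  apply: dint_le => //.
  - by apply: bmeasM => //; exact: bmeas_cst.
  - by apply: bmeasD => //; exact: bsum.
  - move=> z zD; rewrite expr0; have := stp (cabs z); rewrite cabs_ge0 zD => /(_ isT).
    by case/andP.
apply: (le_trans E1); rewrite lerD2l.
apply: (@le_trans _ _ (c * \sum_(0 <= j < N) tail w ((1 + x j) / 2))).
  rewrite mulr_sumr [leLHS]big_nat_cond [leRHS]big_nat_cond; apply: ler_sum => j.
  by rewrite andbT => /andP[_ jN]; apply: H; rewrite ltW//= x1.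
rewrite ler_wpM2l//; first by lra.
rewrite -dsum; last by move=> j; exact: bmeas_ge.
rewrite /P -dintZ//; apply: dint_le => //.
- by apply: bsum => j; exact: bmeas_ge.
- by apply: bmeasM => //; exact: bmeas_cst.
move=> z zD.
have s01 : 0 <= Num.max (2 * cabs z - 1) 0 < 1.
  have := cabs_ge0 z; rewrite le_max lexx orbT/= gt_max ltr01 andbT => z0.
  by move: zD; rewrite /disc/mkset; lra.
have /andP[h _] := stp _ s01.
apply: le_trans h; apply: ler_sum => j _; rewrite ler_nat.
case: (leP ((1 + x j) / 2) (cabs z)) => // h; rewrite lt0b.
by rewrite le_max; apply/orP; left; lra.
Qed.

(** For s >= 1/2 one has 0 <= 2 s - 1 <= s^2 and 1 <= 4 s^2, so (2 s - 1)^n <= 4 s^(2n+2); the tail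
    comparison does the rest. *)
Lemma moment_doubling : exists2 c : R, 0 < c & forall n, M n <= c * M (2 * n + 2).
Proof.
have [c c1 H] := tail_doubling hw.
exists (4 * c); first by lra.
have half (s : R) n : 0 <= s < 1 -> 1 / 2 <= s -> (2 * s - 1) ^+ n <= 4 * s ^+ (2 * n + 2).
  move=> /andP[s0 s1] s2; rewrite exprD exprM mulrCA -[leLHS]mulr1.
  rewrite ler_pM ?exprn_ge0//; first by lra.
  - by rewrite lerXn2r// ?nnegrE ?exprn_ge0//; [lra|nra].
  - nra.
(* At n = 0 the power 0^0 = 1 would also count the points with |z| < 1/2, so the total mass is
   compared directly with the tail at 1/2. *)
move=> [|n].
  have -> : M 0 = tail w 0.
    by apply: eq_dint => z _; rewrite expr0 cabs_ge0.
  apply: le_trans (H 0 _) _; first by rewrite lexx ltr01.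
  rewrite (mulrC 4) -mulrA ler_wpM2l//; first by lra.
  rewrite /M -dintZ//; apply: dint_le => //; first exact: bmeas_ge.
    by apply: bmeasM => //; exact: bmeas_cst.
  move=> z zD; rewrite addr0; have [h|h] := leP (1 / 2) (cabs z); last by rewrite mulr_ge0// exprn_ge0// cabs_ge0.
  by rewrite -(expr0 (2 * cabs z - 1)) half// cabs_ge0.
apply: le_trans (tail_doubling_pow (ltn0Sn n) c1 H) _.
rewrite (mulrC 4) -mulrA ler_wpM2l//; first by lra.
rewrite /M -dintZ//; apply: dint_le => //.
  by apply: bmeasM => //; exact: bmeas_cst.
move=> z zD; case: (leP (2 * cabs z - 1) 0) => h.
  by rewrite expr0n/= mulr_ge0// exprn_ge0// cabs_ge0.
by rewrite half ?cabs_ge0//; lra.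
Qed.

Lemma pow_moment_le m n : (m <= n)%N -> M n <= M m.
Proof.
move=> mn; apply: dint_le => // z zD; rewrite ler_wiXn2l ?cabs_ge0//.
exact: ltW.
Qed.

Lemma tail_moment_le (u : R) n : 0 <= u -> u ^+ n * tail w u <= M n.
Proof.
move=> u0; rewrite /tail -dintZ//; last exact: bmeas_ge.
apply: dint_le => //; first by apply: bmeasM; [exact: bmeas_cst|exact: bmeas_ge].
move=> z zD; have [h|h] := leP u (cabs z); last by rewrite mulr0 exprn_ge0// cabs_ge0.
by rewrite mulr1 lerXn2r// nnegrE ?cabs_ge0.
Qed.

Lemma pow_moment_gt0 n : 0 < M n.
Proof.
apply: lt_le_trans (tail_moment_le n (_ : 0 <= 1 / 2)) => //.
rewrite mulr_gt0 ?exprn_gt0// tail_gt0//; lra.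
Qed.

(** r^(2k) (1 - r^2) = r^k (1 + r) (r^k (1 - r)) <= 2 r^k / (k + 1). The remaining power r^k has
    half the exponent, which [moment_doubling] repairs up to a constant. *)
Lemma moment_diff : exists2 c : R, 0 < c & forall k,
  M (2 * k) - M (2 * k.+1) <= c / k.+1%:R * M (2 * k.+1).
Proof.
have [c c0 H] := moment_doubling; exists (2 * c); first by rewrite mulr_gt0.
move=> k; have k0 : (0 : R) < k.+1%:R by [].
apply: (@le_trans _ _ (2 / k.+1%:R * M k)); last first.
  have := H k; rewrite -[(2 * k + 2)%N](mulnDr 2 k 1) addn1 => h.
  rewrite [2 * c / _]mulrAC -[leRHS]mulrA ler_wpM2l// divr_ge0//.
rewrite /M -dintB// -dintZ//; apply: dint_le => //.
- exact: bmeasB.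
- by apply: bmeasM => //; exact: bmeas_cst.
move=> z zD; have z0 := cabs_ge0 z; have zk : 0 <= cabs z ^+ k by rewrite exprn_ge0.
rewrite mulrAC ler_pdivlMr// mulnS exprD [leLHS]mulrC.
have := natS_pow_le k (_ : 0 <= cabs z < 1); rewrite z0 zD => /(_ isT) h.
rewrite mul2n -addnn exprD.
have -> : k.+1%:R * (cabs z ^+ k * cabs z ^+ k - cabs z ^+ 2 * (cabs z ^+ k * cabs z ^+ k)) =
   (k.+1%:R * cabs z ^+ k * (1 - cabs z)) * (1 + cabs z) * cabs z ^+ k by ring.
rewrite ler_wpM2r//; have : cabs z < 1 by [].
set y := _ * (1 - cabs z) in h *; have : 0 <= y by rewrite !mulr_ge0// subr_ge0 ltW.
move=> *; nra.
Qed.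

Section shifted.
Variable a : R.
Hypothesis a0 : 0 < a.

Let Ma n := dint w (fun z => (1 - cabs z) `^ a * cabs z ^+ n).

Lemma shift_factor_le1 (r : R) : 0 <= r < 1 -> 0 <= (1 - r) `^ a <= 1.
Proof.
move=> /andP[r0 r1]; rewrite powR_ge0/= powR_le1//; last exact: ltW.
by apply/andP; split; lra.
Qed.

Lemma measurable_shift_factor : measurable_fun I01 (fun r : MR => (1 - r) `^ a : MR).
Proof.
apply: measurable_funTS.
apply: (@measurableT_comp _ _ _ _ _ _ (fun x : MR => x `^ a : MR)); first exact: measurable_powR.
exact: measurable_funB.
Qed.

Lemma bmeas_shift_factor : bmeas (fun z : C => (1 - cabs z) `^ a).
Proof.
apply: (bmeas_radial measurable_shift_factor (M := 1)) => r /shift_factor_le1/andP[h1 h2].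
by rewrite ger0_norm.
Qed.

Let bshift n : bmeas (fun z : C => (1 - cabs z) `^ a * cabs z ^+ n).
Proof. by apply: bmeasM => //; exact: bmeas_shift_factor. Qed.

(** This is where [Dcheck] enters. On |z| < 1 - f, with f of order 1 / (k + 1), the factor (1 -
    |z|)^a costs a multiple of (k + 1)^a. The annulus |z| >= 1 - f carries at most a quarter of M (2
    k) and is absorbed into the left side, whence the factor 2. *)
Lemma moment_le_shifted : exists2 c : R, 0 < c & forall k,
  M (2 * k) <= c * k.+1%:R `^ a * Ma (2 * k).
Proof.
have [b b1 Hb] := tail_decay hw.
exists (2 * (4 * b) `^ a); first by rewrite mulr_gt0// powR_gt0// mulr_gt0//; lra.
(* By Bernoulli (1 - e)^(2k) >= 1 - 2 k e >= 1/2, so the tail at 1 - e is at most 2 M (2 k). *)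
move=> k; pose e : R := (4 * k.+1%:R)^-1.
have k1 : (1 : R) <= k.+1%:R by rewrite ler1n.
have e0 : 0 < e by rewrite invr_gt0; lra.
have e1 : e <= 1 / 4 by rewrite /e mul1r lef_pV2 ?posrE//; lra.
pose f := e / b.
have b0 : 0 < b by lra.
have f0 : 0 < f by rewrite divr_gt0.
have fe : f < e by rewrite ltr_pdivrMr// ltr_pMr.
have H1 : tail w (1 - f) <= tail w (1 - e) / 8.
  have := Hb (1 - e); rewrite opprB addrCA subrr addr0; apply.
  by apply/andP; split; lra.
have H2 : tail w (1 - e) <= 2 * M (2 * k).
  have := tail_moment_le (2 * k) (_ : 0 <= 1 - e).
  have h : 1 / 2 <= (1 - e) ^+ (2 * k).
    have bern n (x : R) : 0 <= x <= 1 -> 1 - n%:R * x <= (1 - x) ^+ n.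
      move=> /andP[x0 x1]; elim: n => [|n ih]; first by rewrite mul0r subr0 expr0.
      have n0 : (0 : R) <= n%:R by [].
      have p0 : 0 <= (1 - x) ^+ n by rewrite exprn_ge0// subr_ge0.
      rewrite exprS -natr1; have := ler_wpM2l (_ : 0 <= 1 - x) ih; rewrite subr_ge0 => /(_ x1).
      by apply: le_trans; nra.
    apply: le_trans (bern (2 * k)%N e _); last by apply/andP; split; lra.
    have : 4 * k.+1%:R * e = 1 by rewrite /e divff//; lra.
    by rewrite -natr1 natrM => h; nra.
  move=> /(_ ltac:(lra)) h2.
  have t0 : 0 < tail w (1 - e) by apply: tail_gt0 => //; lra.
  by nra.
have H3 : M (2 * k) <= tail w (1 - f) + (4 * b * k.+1%:R) `^ a * Ma (2 * k).
  rewrite /Ma -dintZ// /tail -dintD//; [|exact: bmeas_ge|by apply: bmeasM => //; exact: bmeas_cst].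
  apply: dint_le => //.
    by apply: bmeasD; [exact: bmeas_ge|apply: bmeasM => //; exact: bmeas_cst].
  move=> z zD; have z0 := cabs_ge0 z; have zn : 0 <= cabs z ^+ (2 * k) by rewrite exprn_ge0.
  have [h|h] := leP (1 - f) (cabs z).
    rewrite (@le_trans _ _ 1) ?exprn_ile1//; first exact: ltW.
    by rewrite lerDl !mulr_ge0// powR_ge0.
  rewrite add0r mulrA -powRM; [|by rewrite !mulr_ge0//; lra|by move: zD; rewrite /disc/mkset; lra].
  rewrite ler_peMl//.
  have E1 : 4 * b * k.+1%:R * f = 1.
    rewrite /f /e; field; apply/andP; split; apply/eqP; lra.
  have {1}<- : (1 : R) `^ a = 1 by rewrite powR1.
  rewrite ge0_ler_powR ?nnegrE ?(ltW a0)//.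
    by rewrite mulr_ge0//; [nra|move: zD; rewrite /disc/mkset; lra].
  by rewrite -[leLHS]E1 ler_wpM2l//; nra.
have -> : 2 * (4 * b) `^ a * k.+1%:R `^ a * Ma (2 * k) =
    2 * ((4 * b * k.+1%:R) `^ a * Ma (2 * k)).
  by rewrite (@powRM _ (4 * b))//; [ring|lra].
have A0 : 0 <= (4 * b * k.+1%:R) `^ a * Ma (2 * k).
  rewrite mulr_ge0 ?powR_ge0//; apply: dint_ge0 => // z zD.
  by rewrite mulr_ge0 ?powR_ge0// exprn_ge0// cabs_ge0.
lra.
Qed.

End shifted.
End fixed_weight.
End Moments.

(** * Differences and square sums of the coefficient sequences *)

Section MomentCoefficients.
Context {R : realType}.
Local Notation C := R[i].
Local Notation MR := (measurableTypeR R).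
Local Notation I01 := (`[0%R, 1%R[%classic : set MR).

(* Coefficients of (1 - x) * (sum_k l_k x^k). *)
Definition diffcoef (l : nat -> R) k : R := if k is k'.+1 then l k - l k' else l 0.

Section fixed_weight.
Variable w : C -> R.
Hypotheses (hw : classD w).
Let ww := classD_weight hw.
Let wr := classD_radial hw.

Lemma moment_classD k : moment w k = dint w (fun z => cabs z ^+ (2 * k)).
Proof.
rewrite (moment_dint ww wr k (phi := fun=> 1)).
- by apply: eq_dint => z _; rewrite mul1r.
- exact: measurable_cst.
- by [].
- by exists 1.
- by move=> r _; rewrite mul1r.
Qed.

Lemma moment_gt0 k : 0 < moment w k.
Proof. by rewrite moment_classD; exact: pow_moment_gt0. Qed.

Lemma moment_nonincreasing k : moment w k.+1 <= moment w k.
Proof. by rewrite !moment_classD; apply: (pow_moment_le hw); rewrite leq_mul2l leqnSn orbT. Qed.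

Lemma moment_step : exists2 c : R, 0 < c &
  forall k, moment w k - moment w k.+1 <= c / k.+1%:R * moment w k.+1.
Proof. by have [c c0 H] := moment_diff hw; exists c => // k; rewrite !moment_classD. Qed.

Lemma moment_ge_tail (u : R) k : 0 <= u -> u ^+ (2 * k) * tail w u <= moment w k.
Proof. by move=> u0; rewrite moment_classD; exact: tail_moment_le. Qed.

(** s = (1 + r) / 2 satisfies r <= s^2, and m_k >= s^(2k) tail(s); hence r^k / m_k stays below 1 /
    tail(s). *)
Lemma radius_moment_inv : radius_ge 1 (fun k => ((moment w k)^-1)%:C).
Proof.
move=> r /andP[r0 r1]; pose s := (1 + r) / 2.
have s0 : 0 <= s by rewrite /s; lra.
have rs : r <= s ^+ 2 by rewrite /s; nra.
have ts : 0 < tail w s by apply: tail_gt0 => //; rewrite /s; lra.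
exists (tail w s)^-1 => k.
have m0 := moment_gt0 k.
rewrite cabs_ge0_real ?invr_ge0 ?(ltW m0)// mulrC ler_pdivrMr// mulrC ler_pdivlMr//.
apply: le_trans (moment_ge_tail k s0); rewrite ler_wpM2r ?(ltW ts)//.
by rewrite exprM lerXn2r// nnegrE exprn_ge0.
Qed.

(** The numerator of the difference is m_(k+1) + (k + 1) (m_(k+1) - m_(k+2)). By [moment_step] its
    second term is of the size of the first, so differencing removes the factor k + 1. *)
Lemma kernel_deriv_diffcoef : exists2 c : R, 0 < c & forall k,
  `|diffcoef (fun k => k.+1%:R / moment w k.+1) k| <= c / moment w k.+1.
Proof.
have [c c0 H] := moment_step; exists (1 + c); first by lra.
move=> [|k] /=.
  have m1 := moment_gt0 1; rewrite mul1r ger0_norm ?invr_ge0 ?(ltW m1)//.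
  by rewrite ler_peMl ?invr_ge0 ?(ltW m1)//; lra.
have m1 := moment_gt0 k.+1; have m2 := moment_gt0 k.+2.
have h := H k.+1; have h' := moment_nonincreasing k.+1.
move: (moment w k.+1) (moment w k.+2) m1 m2 h h' => x y m1 m2 h h'.
have -> : k.+2%:R / y - k.+1%:R / x = (x + k.+1%:R * (x - y)) / (x * y).
  rewrite -(natr1 k.+1); field; apply/andP; split; apply/eqP; lra.
have k0 : (0 : R) < k.+1%:R by [].
have k2 : (0 : R) < k.+2%:R by [].
rewrite ger0_norm; last first.
  apply: divr_ge0; last by apply: mulr_ge0; exact: ltW.
  apply: addr_ge0; first exact: ltW.
  by apply: mulr_ge0; [exact: ltW|lra].
rewrite ler_pdivrMr ?mulr_gt0//.
have -> : (1 + c) / y * (x * y) = x + c * x by field; apply/eqP; lra.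
rewrite lerD2l; apply: (@le_trans _ _ (k.+1%:R * (c / k.+2%:R * y))).
  by rewrite ler_wpM2l// ltW.
have q1 : k.+1%:R / k.+2%:R <= (1 : R) by rewrite ler_pdivrMr// mul1r ler_nat.
have -> : k.+1%:R * (c / k.+2%:R * y) = c * ((k.+1%:R / k.+2%:R) * y) by ring.
rewrite ler_wpM2l ?(ltW c0)//; apply: le_trans h'; rewrite -[leRHS]mul1r.
by rewrite ler_wpM2r// ltW.
Qed.

(** With u = 1 - (1 - t) / 4, two doublings give tail(t) <= c^2 tail(u), while m_(k+1) >= u^(2k+2)
    tail(u). Half of t^(2k) pays for u^(-4k), as t <= u^4; the other half sums to at most 1 / (1 -
    t). *)
Lemma sum_moment_inv_sqr : exists2 c : R, 0 < c & forall N (t : R), 0 <= t < 1 ->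
  \sum_(0 <= k < N) ((moment w k.+1)^-1) ^+ 2 * t ^+ (2 * k) <= (c / tail w t) ^+ 2 / (1 - t).
Proof.
have [c c1 H] := tail_doubling hw.
exists (2 * c ^+ 2); first by rewrite mulr_gt0// exprn_gt0//; lra.
move=> N t /[dup] t01 /andP[t0 t1]; pose u := 1 - (1 - t) / 4.
have u01 : 0 <= u < 1 by apply/andP; split; rewrite /u; lra.
have u0 : 3 / 4 <= u by rewrite /u; lra.
have Tt : 0 < tail w t by exact: tail_gt0.
have Tu : 0 < tail w u by exact: tail_gt0.
have tT : tail w t <= c ^+ 2 * tail w u.
  apply: le_trans (H t t01) _; rewrite expr2 -mulrA ler_wpM2l//; first by lra.
  have := H ((1 + t) / 2) ltac:(by apply/andP; split; lra).
  by have -> : (1 + (1 + t) / 2) / 2 = u by rewrite /u; field.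
have ut : t <= u ^+ 4.
  have u2 : 1 - (1 - t) / 2 <= u ^+ 2 by rewrite /u; nra.
  by rewrite (exprM u 2 2); nra.
apply: (@le_trans _ _ ((2 * c ^+ 2 / tail w t) ^+ 2 * \sum_(0 <= k < N) t ^+ k)); last first.
  by rewrite ler_wpM2l ?sqr_ge0// geometric_sum_le.
rewrite mulr_sumr; apply: ler_sum => k _.
have m0 := moment_gt0 k.+1.
have mu : u ^+ (2 * k.+1) * tail w u <= moment w k.+1 by apply: moment_ge_tail; case/andP : u01.
have u2 : 0 < u ^+ (2 * k.+1) by rewrite exprn_gt0//; lra.
have c20 : 0 < c ^+ 2 by rewrite exprn_gt0//; lra.
have hm : tail w t * u ^+ (2 * k.+1) <= c ^+ 2 * moment w k.+1.
  apply: (@le_trans _ _ (c ^+ 2 * tail w u * u ^+ (2 * k.+1))); first by rewrite ler_wpM2r// ltW.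
  by rewrite -mulrA ler_wpM2l ?(ltW c20)// mulrC.
(* The factor 2 makes up for the surplus u^4 in u^(4k+4): u >= 3/4 gives 4 u^4 >= 1. *)
have hq : t ^+ (2 * k) <= (2 * u ^+ (2 * k.+1)) ^+ 2 * t ^+ k.
  have tk : 0 <= t ^+ k by rewrite exprn_ge0.
  rewrite mul2n -addnn exprD ler_wpM2r//.
  apply: (@le_trans _ _ ((u ^+ 4) ^+ k)); first by rewrite lerXn2r// nnegrE exprn_ge0//; lra.
  have -> : (2 * u ^+ (2 * k.+1)) ^+ 2 = 4 * u ^+ 4 * (u ^+ 4) ^+ k.
    rewrite exprMn -!exprM -mulrA -exprD; congr (_ * u ^+ _); first by ring.
    by rewrite mulnC mulnA -mulnS.
  rewrite ler_peMl ?exprn_ge0//; first by lra.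
  have u2' : 9 / 16 <= u ^+ 2 by nra.
  by rewrite (exprM u 2 2); nra.
have -> : (2 * c ^+ 2 / tail w t) ^+ 2 * t ^+ k =
   (c ^+ 2 / tail w t / (u ^+ (2 * k.+1))) ^+ 2 * ((2 * u ^+ (2 * k.+1)) ^+ 2 * t ^+ k).
  field; apply/andP; split; apply/eqP; lra.
rewrite ler_pM ?sqr_ge0 ?exprn_ge0//.
rewrite lerXn2r ?nnegrE ?invr_ge0 ?(ltW m0)//; first by rewrite !divr_ge0// ltW.
by rewrite ler_pdivlMr// ler_pdivlMr// -[leLHS]mulrA [leLHS]mulrC ler_pdivrMr// [leLHS]mulrC.
Qed.

Section shifted.
Variable a : R.
Hypothesis a0 : 0 < a.

Let Ma n := dint w (fun z => (1 - cabs z) `^ a * cabs z ^+ n).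
Let ma k := moment (shift_weight w a) k.

Let bshift n : bmeas (fun z : C => (1 - cabs z) `^ a * cabs z ^+ n).
Proof. by apply: bmeasM; [exact: bmeas_shift_factor|exact: bmeasX bmeas_cabs]. Qed.

Lemma moment_shift_classD k : moment (shift_weight w a) k =
  dint w (fun z => (1 - cabs z) `^ a * cabs z ^+ (2 * k)).
Proof.
rewrite (moment_dint ww wr k (phi := fun r => (1 - r) `^ a))//.
- exact: measurable_shift_factor.
- by move=> r _; exact: powR_ge0.
- by exists 1 => r /(shift_factor_le1 a0)/andP[].
- by move=> r /andP[r0 r1]; rewrite /shift_weight cabs_ge0_real.
Qed.

(** Doubling is inherited from w. With j = k / 2, half of the power turns (1 - r)^a into (j +
    1)^(-a); two moment doublings reach the exponent 2 k + 2; [moment_le_shifted] restores the shift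
    at the price of (k + 2)^a <= (3 (j + 1))^a, and the powers of j + 1 cancel. *)
Lemma shifted_doubling : exists2 c : R, 0 < c & forall k, Ma k <= c * Ma (2 * k.+1).
Proof.
have [c1 c10 H1] := powR_decay (ltW a0).
have [c2 c20 H2] := moment_doubling hw.
have [c3 c30 H3] := moment_le_shifted hw a0.
exists (c1 * (c2 * c2) * c3 * 3 `^ a); first by rewrite !mulr_gt0// powR_gt0.
move=> k; pose j := k./2.
have kE : k = (odd k + j + j)%N by rewrite -addnA addnn odd_double_half.
have b1 : (odd k <= 1)%N by case: (odd k).
have jk : (j + j <= k)%N by lia.
have j0 : (0 : R) < j.+1%:R `^ a by rewrite powR_gt0.
set m := dint w (fun z => cabs z ^+ j).
have A1 : Ma k <= c1 / j.+1%:R `^ a * m.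
  rewrite /m /Ma -dintZ//; last exact: bmeasX bmeas_cabs.
  apply: dint_le => //; first by apply: bmeasM; [exact: bmeas_cst|exact: bmeasX bmeas_cabs].
  move=> z zD; have z0 := cabs_ge0 z; have zj : 0 <= cabs z ^+ j by rewrite exprn_ge0.
  have h := H1 j (cabs z) ltac:(by rewrite z0 zD).
  apply: (@le_trans _ _ ((1 - cabs z) `^ a * cabs z ^+ (j + j))).
    by rewrite ler_wpM2l ?powR_ge0// ler_wiXn2l// ltW.
  rewrite exprD mulrA ler_wpM2r// ler_pdivlMr//.
  by apply: le_trans h; rewrite mulrC mulrA.
have A2 : m <= c2 * c2 * dint w (fun z => cabs z ^+ (2 * k.+1)).
  apply: le_trans (H2 j) _; rewrite -mulrA ler_wpM2l ?(ltW c20)//.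
  apply: le_trans (H2 _) _; rewrite ler_wpM2l ?(ltW c20)//.
  by apply: (pow_moment_le hw); lia.
have A3 := H3 k.+1.
have A4 : k.+2%:R `^ a <= 3 `^ a * j.+1%:R `^ a.
  rewrite -powRM// ge0_ler_powR ?nnegrE ?(ltW a0)// -?natrM ?ler_nat//.
  lia.
have Mak : 0 <= Ma (2 * k.+1).
  by apply: dint_ge0 => // z _; rewrite mulr_ge0 ?powR_ge0// exprn_ge0// cabs_ge0.
apply: (le_trans A1).
have -> : c1 * (c2 * c2) * c3 * 3 `^ a * Ma (2 * k.+1) =
  c1 / j.+1%:R `^ a * (c2 * c2 * (c3 * (3 `^ a * j.+1%:R `^ a) * Ma (2 * k.+1))).
  field; apply/eqP; lra.
rewrite ler_wpM2l ?divr_ge0 ?(ltW c10) ?(ltW j0)//; apply: (le_trans A2).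
rewrite ler_wpM2l ?mulr_ge0 ?(ltW c20)//; apply: (le_trans A3).
by rewrite ler_wpM2r// ler_wpM2l// ltW.
Qed.

Lemma moment_shift_gt0 k : 0 < ma k.
Proof.
have [c c0 H] := moment_le_shifted hw a0.
have := H k; rewrite -moment_shift_classD -moment_classD => h.
have := lt_le_trans (moment_gt0 k) h.
by rewrite pmulr_rgt0// mulr_gt0// powR_gt0.
Qed.

(** The splitting of r^(2k) (1 - r^2) used for w, with (1 - r)^a carried along as an inert
    factor. *)
Lemma moment_shift_step : exists2 c : R, 0 < c &
  forall k, 0 <= ma k - ma k.+1 <= c / k.+1%:R * ma k.+1.
Proof.
have [c c0 H] := shifted_doubling; exists (2 * c); first by rewrite mulr_gt0.
move=> k; have k0 : (0 : R) < k.+1%:R by [].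
rewrite /ma !moment_shift_classD -dintB//; apply/andP; split.
  apply: dint_ge0 => // z zD; rewrite -mulrBr mulr_ge0 ?powR_ge0// subr_ge0.
  by rewrite ler_wiXn2l ?cabs_ge0 ?leq_mul2l ?leqnSn ?orbT//; exact: ltW.
apply: (@le_trans _ _ (2 / k.+1%:R * Ma k)); last first.
  by rewrite [2 * c / _]mulrAC -[leRHS]mulrA ler_wpM2l// divr_ge0.
rewrite /Ma -dintZ//; apply: dint_le => //.
- exact: bmeasB.
- by apply: bmeasM => //; exact: bmeas_cst.
move=> z zD; have z0 := cabs_ge0 z; have zk : 0 <= cabs z ^+ k by rewrite exprn_ge0.
rewrite mulrAC ler_pdivlMr// mulnS exprD [leLHS]mulrC.
have := natS_pow_le k (_ : 0 <= cabs z < 1); rewrite z0 zD => /(_ isT) h.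
rewrite mul2n -addnn exprD.
have s0 : 0 <= (1 - cabs z) `^ a by exact: powR_ge0.
set s := (1 - cabs z) `^ a in s0 *.
have -> : k.+1%:R * (s * (cabs z ^+ k * cabs z ^+ k) -
    s * (cabs z ^+ 2 * (cabs z ^+ k * cabs z ^+ k))) =
   (k.+1%:R * cabs z ^+ k * (1 - cabs z)) * (1 + cabs z) * (s * cabs z ^+ k) by ring.
rewrite ler_wpM2r ?mulr_ge0//; have : cabs z < 1 by [].
set y := _ * (1 - cabs z) in h *; have : 0 <= y by rewrite !mulr_ge0// subr_ge0 ltW.
move=> *; nra.
Qed.

Let lam k := moment w k / ma k.

Lemma ratio_ge0 k : 0 <= lam k.
Proof. by rewrite divr_ge0// ltW// ?moment_gt0// moment_shift_gt0. Qed.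

Lemma ratio_le : exists2 c : R, 0 < c & forall k, lam k <= c * k.+1%:R `^ a.
Proof.
have [c c0 H] := moment_le_shifted hw a0; exists c => // k.
rewrite ler_pdivrMr ?moment_shift_gt0// /ma moment_shift_classD moment_classD.
exact: H.
Qed.

Lemma powS_le k : k.+2%:R `^ a <= 2 `^ a * k.+1%:R `^ a.
Proof.
by rewrite -powRM// ge0_ler_powR ?nnegrE ?(ltW a0)// -?natrM ?ler_nat//; lia.
Qed.

(** A discrete product rule: lambda_k is O((k + 1)^a) and its increments are O((k + 1)^(a-1)), so
    the increments of (k + 2) lambda_(k+1) are one power of k smaller than the sequence. *)
Lemma ratio_diffcoef : exists2 c : R, 0 < c & forall k,
  `|diffcoef (fun k => k.+2%:R * lam k.+1) k| <= c * k.+1%:R `^ a.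
Proof.
have [c1 c10 H1] := ratio_le.
have [c2 c20 H2] := moment_step.
have [c3 c30 H3] := moment_shift_step.
have p0 : 0 < (2 : R) `^ a by rewrite powR_gt0.
have step k : `|lam k.+1 - lam k| <= (c2 * (c1 * 2 `^ a) + c3 * c1) / k.+1%:R * k.+1%:R `^ a.
  have k0 : (0 : R) < k.+1%:R by [].
  have m0 := moment_gt0 k; have m1 := moment_gt0 k.+1.
  have n0 := moment_shift_gt0 k; have n1 := moment_shift_gt0 k.+1.
  have h2 := H2 k; have /andP[h3' h3] := H3 k; have hm := moment_nonincreasing k.
  have l0 := H1 k; have l1 := le_trans (H1 k.+1) (ler_wpM2l (ltW c10) (powS_le k)).
  (* Quotient rule: each term contains one moment difference, of relative size 1 / (k + 1). *)
  have -> : lam k.+1 - lam k = lam k * ((ma k - ma k.+1) / ma k.+1) -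
      (moment w k - moment w k.+1) / ma k.+1.
    by rewrite /lam; field; apply/andP; split; apply/eqP; lra.
  have A1 : 0 <= (ma k - ma k.+1) / ma k.+1 <= c3 / k.+1%:R.
    by rewrite divr_ge0 ?(ltW n1)//= ler_pdivrMr.
  have A2 : 0 <= (moment w k - moment w k.+1) / ma k.+1 <= c2 / k.+1%:R * lam k.+1.
    rewrite divr_ge0 ?subr_ge0 ?(ltW n1)//= ler_pdivrMr// /lam.
    apply: (le_trans h2); rewrite -[leRHS]mulrA.
    by rewrite [X in _ <= _ * X](divfK (lt0r_neq0 n1)).
  have := ratio_ge0 k => lk.
  apply: (@le_trans _ _ (c2 / k.+1%:R * lam k.+1 + lam k * (c3 / k.+1%:R))).
    case/andP : A1 => A1 A1'; case/andP : A2 => A2 A2'.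
    have h := ler_wpM2l lk A1'; have h' := mulr_ge0 lk A1.
    have gen (A B X Y : R) : 0 <= A -> A <= Y -> 0 <= B -> B <= X -> `|A - B| <= X + Y.
      by move=> *; rewrite ler_norml; apply/andP; split; lra.
    exact: gen.
  have -> : (c2 * (c1 * 2 `^ a) + c3 * c1) / k.+1%:R * k.+1%:R `^ a =
    c2 / k.+1%:R * (c1 * (2 `^ a * k.+1%:R `^ a)) + (c1 * k.+1%:R `^ a) * (c3 / k.+1%:R) by ring.
  rewrite lerD//; first by rewrite ler_wpM2l// divr_ge0// ltW.
  by rewrite ler_wpM2r// divr_ge0// ltW.
pose K := c2 * (c1 * 2 `^ a) + c3 * c1.
have K0 : 0 < K by rewrite addr_gt0// !mulr_gt0.
exists (2 * c1 * 2 `^ a + 2 * K + (c1 * 2 `^ a) * 2 `^ a + K * 2 `^ a).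
  by rewrite !addr_gt0// !mulr_gt0.
move=> [|k] /=.
  rewrite powR1 mulr1 ger0_norm; last by rewrite mulr_ge0// ratio_ge0.
  have h := H1 1; have := mulr_gt0 K0 p0; have := mulr_gt0 (mulr_gt0 c10 p0) p0.
  by nra.
have k1 : (0 : R) < k.+2%:R by [].
have -> : k.+3%:R * lam k.+2 - k.+2%:R * lam k.+1 = lam k.+2 + k.+2%:R * (lam k.+2 - lam k.+1).
  by rewrite -(natr1 k.+2); ring.
apply: le_trans (ler_normD _ _) _; rewrite (ger0_norm (ratio_ge0 k.+2)) [X in _ + X <= _]normrM (ger0_norm (ltW k1)).
have h1 := le_trans (H1 k.+2) (ler_wpM2l (ltW c10) (powS_le k.+1)).
have h2 := ler_wpM2l (ltW k1) (step k.+1).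
have E1 : k.+2%:R * ((c2 * (c1 * 2 `^ a) + c3 * c1) / k.+2%:R * k.+2%:R `^ a) = K * k.+2%:R `^ a.
  by rewrite /K; field; apply/eqP; lra.
rewrite E1 in h2.
have q0 : 0 <= k.+2%:R `^ a by exact: powR_ge0.
set q := k.+2%:R `^ a in h1 h2 q0 *.
have z1 := mulr_ge0 (mulr_ge0 (ltW c10) (ltW p0)) q0.
have z2 := mulr_ge0 (ltW K0) q0.
have z3 := mulr_ge0 z1 (ltW p0); have z4 := mulr_ge0 z2 (ltW p0).
apply: le_trans (lerD h1 h2) _.
have -> : (2 * c1 * 2 `^ a + 2 * K + c1 * 2 `^ a * 2 `^ a + K * 2 `^ a) * q =
  c1 * (2 `^ a * q) + K * q + (c1 * 2 `^ a * q + K * q + c1 * 2 `^ a * q * 2 `^ a + K * q * 2 `^ a).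
  by ring.
by rewrite lerDl !addr_ge0.
Qed.

(** Half of t^(2k) is spent on the coefficients: with q = sqrt t, (k + 1)^a q^k = O((1 - q)^(-a)),
    and 1 - t <= 2 (1 - q). The other half is a geometric series. *)
Lemma sum_powR_sqr : exists2 c : R, 0 < c & forall N (t : R), 0 <= t < 1 ->
  \sum_(0 <= k < N) (k.+1%:R `^ a) ^+ 2 * t ^+ (2 * k) <= (c / (1 - t) `^ a) ^+ 2 / (1 - t).
Proof.
have [c c0 H] := powR_decay (ltW a0).
have p0 : 0 < (2 : R) `^ a by rewrite powR_gt0.
exists (c * 2 `^ a); first by rewrite mulr_gt0.
move=> N t /[dup] t01 /andP[t0 t1]; pose q := Num.sqrt t.
have q0 : 0 <= q by exact: sqrtr_ge0.
have qt : q ^+ 2 = t by rewrite sqr_sqrtr.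
have q1 : q < 1 by rewrite -(@ltr_pXn2r _ 2)// ?nnegrE// qt expr1n.
have T0 : 0 < (1 - t) `^ a by rewrite powR_gt0 ?subr_gt0.
have Q0 : 0 < (1 - q) `^ a by rewrite powR_gt0 ?subr_gt0.
have TQ : (1 - t) `^ a <= 2 `^ a * (1 - q) `^ a.
  rewrite -powRM ?subr_ge0 ?(ltW q1)// ge0_ler_powR ?nnegrE ?(ltW a0)//; first by lra.
    by rewrite mulr_ge0// subr_ge0 ltW.
  by rewrite -qt; nra.
apply: (@le_trans _ _ ((c * 2 `^ a / (1 - t) `^ a) ^+ 2 * \sum_(0 <= k < N) t ^+ k)); last first.
  by rewrite ler_wpM2l ?sqr_ge0// geometric_sum_le.
rewrite mulr_sumr; apply: ler_sum => k _.
have -> : t ^+ (2 * k) = (q ^+ k) ^+ 2 * t ^+ k.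
  by rewrite -exprM (mulnC k) [q ^+ _]exprM qt -exprD addnn -mul2n.
rewrite mulrA -exprMn ler_wpM2r ?exprn_ge0//.
rewrite lerXn2r ?nnegrE ?mulr_ge0 ?powR_ge0 ?exprn_ge0 ?invr_ge0 ?(ltW c0) ?(ltW T0)//.
have h := H k q ltac:(by rewrite q0 q1).
rewrite ler_pdivlMr//.
have x0 : 0 <= k.+1%:R `^ a * q ^+ k by rewrite mulr_ge0 ?powR_ge0// exprn_ge0.
apply: le_trans (ler_wpM2l x0 TQ) _.
have -> : k.+1%:R `^ a * q ^+ k * (2 `^ a * (1 - q) `^ a) =
   (k.+1%:R `^ a * (1 - q) `^ a * q ^+ k) * 2 `^ a by ring.
by rewrite ler_wpM2r// ltW.
Qed.

End shifted.
End fixed_weight.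
End MomentCoefficients.

(** * Lipschitz functions on the disc *)

Section LipschitzDisc.
Context {R : realType}.
Local Notation C := R[i].
Local Notation mu := (@lebesgue_measure R).
Local Notation MR := (measurableTypeR R).
Local Notation E := (MR * MR)%type.
Local Notation I01 := (`[0%R, 1%R[%classic : set MR).

Lemma mvt_bound (g d : R -> R) (K : R) : continuous g ->
  (forall t, 0 < t < 1 -> (fun h => h^-1 * (g (h + t) - g t)) @ 0^' --> d t) ->
  (forall t, 0 < t < 1 -> `|d t| <= K) -> `|g 1 - g 0| <= K.
Proof.
move=> cg dg dK.
have [||c] := @MVT R g d 0 1 ltr01.
- move=> t; rewrite in_itv/= => t01; have h := dg t t01.
  have h' : (fun h => h^-1 *: (g (h *: 1 + t) - g t)) @ 0^' --> d t.
    by under eq_fun do rewrite [_ *: 1]mulr1.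
  apply: DeriveDef; first by apply/cvg_ex; exists (d t).
  by rewrite /derive; apply/cvg_lim.
- exact: continuous_subspaceT.
- by rewrite in_itv/= subr0 mulr1 => c01 ->; exact: dK.
Qed.

Lemma real_deriv_cvg (g : R -> R) (t d : R) :
  (forall e : R, 0 < e -> exists2 del : R, 0 < del &
    forall s, `|s| < del -> `|g (t + s) - g t - d * s| <= e * `|s|) ->
  (fun h => h^-1 * (g (h + t) - g t)) @ 0^' --> d.
Proof.
move=> H; apply/cvgrPdist_le => e e0; have [del del0 Hd] := H e e0.
near=> h.
have h0 : h != 0 by near: h; exact: nbhs_dnbhs_neq.
have hd : `|h| < del by near: h; exact: dnbhs0_lt.
have := Hd h hd; rewrite -[X in X <= _](_ : `|h^-1 * (g (h + t) - g t) - d| * `|h| = _).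
  by rewrite ler_pM2r ?normr_gt0// distrC.
by rewrite -normrM mulrBl mulrAC mulVf// mul1r (addrC h).
Unshelve. all: by end_near. Qed.

Lemma lipschitz_continuous (g : R -> R) (K : R) :
  (forall s t, `|g s - g t| <= K * `|s - t|) -> continuous g.
Proof.
move=> gK t; apply/cvgrPdist_lt => e e0.
have K0 : 0 < `|K| + 1 by rewrite ltr_wpDl.
near=> s; apply: le_lt_trans (gK _ _) _.
apply: (@le_lt_trans _ _ ((`|K| + 1) * `|t - s|)).
  by rewrite ler_wpM2r// (le_trans (ler_norm K))// lerDl.
rewrite mulrC -ltr_pdivlMr//; near: s.
by apply: cvgr_dist_lt => //; rewrite divr_gt0.
Unshelve. all: by end_near. Qed.

Lemma cRe_scale (z : C) (x : R) : complex.Re (z * x%:C) = complex.Re z * x.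
Proof. by case: z => u v /=; rewrite mulr0 subr0. Qed.

Lemma cIm_scale (z : C) (x : R) : complex.Im (z * x%:C) = complex.Im z * x.
Proof. by case: z => u v /=; rewrite mulr0 add0r. Qed.

(** Truncation makes a path along a segment continuous on the whole line and keeps it inside the
    disc, as [mvt_bound] asks for a function continuous on R. *)
Definition clamp (t : R) : R := Num.min (Num.max t 0) 1.

Lemma clamp_itv t : 0 <= clamp t <= 1.
Proof. by rewrite /clamp le_min ler01 le_max lexx orbT/= ge_min lexx orbT. Qed.

Lemma clamp_id t : 0 <= t <= 1 -> clamp t = t.
Proof. by move=> /andP[t0 t1]; rewrite /clamp (max_idPl t0) (min_idPl t1). Qed.

Variant clamp_spec (t : R) : R -> Type :=
| ClampLow of t <= 0 : clamp_spec t 0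
| ClampMid of 0 <= t & t <= 1 : clamp_spec t t
| ClampHigh of 1 <= t : clamp_spec t 1.

Lemma clampP t : clamp_spec t (clamp t).
Proof.
rewrite /clamp; have [t0|t0] := leP t 0; first by rewrite min_l//; constructor.
by have [t1|t1] := leP t 1; [constructor => //; exact: ltW|constructor; exact: ltW].
Qed.

Lemma clamp_lipschitz s t : `|clamp s - clamp t| <= `|s - t|.
Proof.
by rewrite !ler_norml; case: (clampP s) => *;
  case: (clampP t) => *; have := ler_norm (s - t);
  have := ler_norm (- (s - t)); rewrite normrN => *; apply/andP; split; lra.
Qed.

Lemma disc_segment (a b : C) (t : R) : disc a -> disc b -> 0 <= t <= 1 ->
  disc (a + t%:C * (b - a)).
Proof.
rewrite /disc/mkset => a1 b1 /andP[t0 t1].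
have -> : a + t%:C * (b - a) = (1 - t)%:C * a + t%:C * b.
  by rewrite rmorphB rmorph1; ring.
apply: le_lt_trans (cabsD _ _) _; rewrite !cabsM !cabs_ge0_real ?subr_ge0//.
by have [ab|ba] := leP (cabs a) (cabs b); [apply: le_lt_trans b1|apply: le_lt_trans a1]; nra.
Qed.

(** The mean value theorem is applied to Re(u f) along the segment, with u the phase for which u (f
    b - f a) is the modulus to be bounded. *)
Lemma disc_lipschitz (f f' : C -> C) (K : R) : (forall z, disc z -> cderiv f z (f' z)) ->
  (forall z, disc z -> cabs (f' z) <= K) ->
  forall a b, disc a -> disc b -> cabs (f b - f a) <= K * cabs (b - a).
Proof.
move=> df fK a b Da Db.
have [u [u1 uE]] := cabs_phase (f b - f a).
pose p t := a + (clamp t)%:C * (b - a).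
have pD t : disc (p t) by apply: disc_segment => //; exact: clamp_itv.
pose g t : R := complex.Re (u * f (p t)).
have pB s t : cabs (p s - p t) <= `|s - t| * cabs (b - a).
  have -> : p s - p t = (clamp s - clamp t)%:C * (b - a) by rewrite /p rmorphB; ring.
  by rewrite cabsM cabs_real ler_wpM2r ?cabs_ge0// clamp_lipschitz.
have gB s t : `|g s - g t| <= cabs (f (p s) - f (p t)).
  by rewrite /g -cReB -mulrBr (le_trans (Re_le_cabs _))// cabsM u1 mul1r.
have cg : continuous g.
  move=> t; apply/cvgrPdist_lt => e e0.
  have [del del0 H] := cderiv_cont (df _ (pD t)) e0.
  have ba : 0 < cabs (b - a) + 1 by rewrite ltr_wpDl// cabs_ge0.
  near=> s; rewrite distrC; apply: le_lt_trans (gB _ _) _.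
  rewrite -(subrK (p t) (p s)) (addrC (p s - _)); apply: H.
  apply: le_lt_trans (pB _ _) _.
  apply: (@le_lt_trans _ _ (`|s - t| * (cabs (b - a) + 1))); first by rewrite ler_wpM2l// lerDl.
  rewrite -ltr_pdivlMr// distrC; near: s.
  by apply: cvgr_dist_lt => //; rewrite divr_gt0.
have := @mvt_bound g (fun t => complex.Re (u * (f' (p t) * (b - a)))) (K * cabs (b - a)) cg.
have -> : g 1 - g 0 = cabs (f b - f a).
  rewrite /g -cReB -mulrBr /p !clamp_id ?lexx ?ler01//.
  by rewrite rmorph1 rmorph0 mul0r addr0 mul1r (addrC a) subrK uE.
rewrite ger0_norm ?cabs_ge0//; apply.
- move=> t /andP[t0 t1]; apply: real_deriv_cvg => e e0.
  have ba : 0 < cabs (b - a) + 1 by rewrite ltr_wpDl// cabs_ge0.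
  have [del del0 H] := df _ (pD t) (e / (cabs (b - a) + 1)) (divr_gt0 e0 ba).
  exists (Num.min (Num.min t (1 - t)) (del / (cabs (b - a) + 1))).
    by rewrite !lt_min t0 subr_gt0 t1 divr_gt0.
  move=> s; rewrite !lt_min => /andP[/andP[s1 s2] s3].
  have /andP[s4 s5] : - t < s < 1 - t.
    by have := ler_norm s; have := ler_norm (- s); rewrite normrN => *; apply/andP; split; lra.
  have pE : p (t + s) = p t + s%:C * (b - a).
    rewrite /p !clamp_id ?rmorphD; [ring|apply/andP; split; lra|apply/andP; split; lra].
  have ws : cabs (s%:C * (b - a)) < del.
    rewrite cabsM cabs_real; apply: (@le_lt_trans _ _ (`|s| * (cabs (b - a) + 1))).
      by rewrite ler_wpM2l// lerDl.
    by rewrite -ltr_pdivlMr.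
  have := H _ ws; rewrite -pE => h.
  have -> : g (t + s) - g t - complex.Re (u * (f' (p t) * (b - a))) * s =
     complex.Re (u * (f (p (t + s)) - f (p t) - f' (p t) * (s%:C * (b - a)))).
    rewrite (mulrBr u (f (p (t + s)) - f (p t))) (cReB (u * (f (p (t + s)) - f (p t)))).
    rewrite (mulrBr u (f (p (t + s)))) (cReB (u * f (p (t + s)))) /g; congr (_ - _).
    have -> : u * (f' (p t) * (s%:C * (b - a))) = (u * (f' (p t) * (b - a))) * s%:C by ring.
    by rewrite cRe_scale.
  apply: le_trans (Re_le_cabs _) _; rewrite cabsM u1 mul1r (le_trans h)//.
  rewrite cabsM cabs_real mulrCA mulrC ler_wpM2r//.
  rewrite mulrAC ler_pdivrMr//; apply: ler_wpM2l; first exact: ltW.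
  by rewrite lerDl.
- move=> t _; apply: le_trans (Re_le_cabs _) _; rewrite cabsM u1 mul1r cabsM.
  by rewrite ler_wpM2r ?cabs_ge0// fK.
Unshelve. all: by end_near. Qed.

(* A K-Lipschitz function is the infimum of the cones [g q + K |p - q|] over rational q. *)
Lemma lipschitz_bmeas (g : C -> R) (K : R) :
  (forall a b, disc a -> disc b -> `|g b - g a| <= K * cabs (b - a)) -> bmeas g.
Proof.
move=> gK.
have D0 : disc (0 : C) by rewrite /disc/mkset ComplexField.Normc.normc0.
have K0 : 0 <= K.
  have Dh : disc ((1 / 2 : R)%:C) by rewrite /disc/mkset cabs_ge0_real//; lra.
  have := le_trans (normr_ge0 _) (gK _ _ D0 Dh); rewrite subr0 cabs_ge0_real//.
  by rewrite pmulr_lge0//; lra.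
have gM z : disc z -> `|g z| <= `|g 0| + K.
  move=> zD; rewrite -{1}(subrK (g 0) (g z)) (le_trans (ler_normD _ _))// addrC lerD2l.
  apply: le_trans (gK 0 z D0 zD) _; rewrite subr0 -[leRHS]mulr1 ler_wpM2l//.
  exact: ltW.
split; last by exists (`|g 0| + K).
pose M := `|g 0| + K.
(* An enumeration of the rational points. For points outside the disc the cone is replaced by M, an
   upper bound of g that leaves the infimum unchanged. *)
pose q k : C := if unpickle k is Some (a, b) then (ratr (a : rat) : R) +i* ratr (b : rat) else 0.
pose h k (z : C) : R := if `[< disc (q k) >] then g (q k) + K * cabs (z - q k) else M.
pose m := fix m n (z : C) : R := if n is n'.+1 then Num.min (m n' z) (h n' z) else M.
have hm k : measurable_fun disc2 (fun p : E => h k (ofR2 p) : MR).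
  rewrite /h; have [qD|qD] := pselect (disc (q k)); last by rewrite (asboolF qD); exact: measurable_cst.
  rewrite (asboolT qD).
  apply: measurable_funD => //; apply: measurable_funM => //.
  apply: measurable_funTS.
  apply: (eq_measurable_fun (fun p : E => cabs (ofR2 (p.1 - complex.Re (q k), p.2 - complex.Im (q k))))).
    by move=> p _; congr cabs; case: (q k).
  apply: (measurableT_comp measurable_cabs).
  by apply: measurable_fun_pair; apply: measurable_funB.
have mm n : measurable_fun disc2 (fun p : E => m n (ofR2 p) : MR).
  elim: n => [|n ih] /=; first exact: measurable_cst.
  exact: (measurable_minr ih (hm n)).
have hge k z : disc z -> g z <= h k z.
  move=> zD; rewrite /h; case: asboolP => qD.
    by rewrite -lerBlDl (le_trans (ler_norm _))// gK.
  exact: le_trans (ler_norm _) (gM z zD).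
have mge n z : disc z -> g z <= m n z.
  move=> zD; elim: n => [|n ih] /=; first exact: le_trans (ler_norm _) (gM z zD).
  by rewrite le_min ih hge.
have mle n k z : (k < n)%N -> m n z <= h k z.
  elim: n => // n ih; rewrite ltnS leq_eqVlt => /predU1P[->|/ih kn] /=.
    by rewrite ge_min lexx orbT.
  by rewrite ge_min kn.
apply: (@measurable_fun_cvg _ _ _ _ (fun n (p : E) => m n (ofR2 p))) => // p pD.
set z := ofR2 p; have zD : disc z by [].
apply/cvgrPdist_lt => e e0.
have KK : 0 < 2 * K + 1 by lra.
(* q is found within 2 d of z: this keeps q in the disc, and the cone at q exceeds g z by at most 4
   K d < e. *)
pose d := Num.min (e / (2 * K + 1)) (1 - cabs z) / 4.
have d0 : 0 < d by rewrite divr_gt0// lt_min divr_gt0// subr_gt0.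
have za : complex.Re z - d < complex.Re z + d by lra.
have [a] := rat_in_itvoo za.
have zb : complex.Im z - d < complex.Im z + d by lra.
have [b] := rat_in_itvoo zb.
rewrite !in_itv/= => /andP[b1 b2] /andP[a1 a2].
pose k := pickle (a, b).
have qk : q k = ratr a +i* ratr b by rewrite /q /k pickleK.
have zq : cabs (z - q k) <= 2 * d.
  apply: le_trans (cabs_le_ReIm _) _; rewrite cReB cImB qk/=.
  have h1 : `|p.1 - ratr a| <= d by rewrite ler_norml; move: a1 a2 => /= *; apply/andP; split; lra.
  have h2 : `|p.2 - ratr b| <= d by rewrite ler_norml; move: b1 b2 => /= *; apply/andP; split; lra.
  by rewrite mulr2n mulrDl mul1r lerD.
have d1 : d * 4 <= 1 - cabs z by rewrite /d divfK// ge_min lexx orbT.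
have d2 : d * 4 <= e / (2 * K + 1) by rewrite /d divfK// ge_min lexx.
have qD : disc (q k).
  rewrite /disc/mkset -(subKr z (q k)); apply: le_lt_trans (cabsB _ _) _; lra.
exists k.+1 => // n /= kn; rewrite distrC ger0_norm ?subr_ge0 ?mge// ltrBlDl.
apply: le_lt_trans (mle n k z kn) _; rewrite /h asboolT//.
have gqz : g (q k) <= g z + K * cabs (z - q k).
  by rewrite -lerBlDl cabs_distC (le_trans (ler_norm _))// gK.
have := cabs_ge0 (z - q k); move: d2; rewrite ler_pdivlMr//; nra.
Qed.

Lemma lipschitz_cbmeas (f : C -> C) (K : R) :
  (forall a b, disc a -> disc b -> cabs (f b - f a) <= K * cabs (b - a)) -> cbmeas f.
Proof.
move=> fK; split; apply: (@lipschitz_bmeas _ K) => a b Da Db.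
  by rewrite -cReB (le_trans (Re_le_cabs _))// fK.
by rewrite -cImB (le_trans (Im_le_cabs _))// fK.
Qed.

(** A chain rule along sequences, with displacement w n and scale s n given separately; it is
    applied to rotations of the variable and to moves along a segment. *)
Lemma cderiv_quotient (f : C -> C) p l (w s : nat -> C) d : cderiv f p l ->
  (forall n, s n != 0) -> w @ \oo --> (0 : C) -> (fun n => w n / s n) @ \oo --> d ->
  (fun n => (f (p + w n) - f p) / s n) @ \oo --> l * d.
Proof.
move=> fp s0 /cvgCP w0 /cvgCP wd; apply/cvgCP/cvgrPdist_lt => e e0.
pose D := cabs d + 1; have D0 : 0 < D by rewrite ltr_wpDl// cabs_ge0.
have D2 : 0 < 2 * D by rewrite mulr_gt0.
have L0 : 0 < cabs l + 1 by rewrite ltr_wpDl// cabs_ge0.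
have [del del0 H] := fp (e / (2 * D)) (divr_gt0 e0 D2).
move/cvgrPdist_lt : w0 => /(_ _ del0) w0.
move/cvgrPdist_lt : wd => wd; have := wd (Num.min 1 (e / (2 * (cabs l + 1)))).
rewrite lt_min ltr01 divr_gt0 ?mulr_gt0// => /(_ isT) {}wd.
near=> n; rewrite sub0r normrN ger0_norm ?cabs_ge0//.
have hw : cabs (w n) < del.
  suff : `|0 - cabs (w n - 0)| < del by rewrite subr0 sub0r normrN ger0_norm// cabs_ge0.
  by near: n.
have [h1 h2] : cabs (w n / s n - d) < 1 /\ cabs (w n / s n - d) < e / (2 * (cabs l + 1)).
  apply/andP; rewrite -lt_min.
  suff : `|0 - cabs (w n / s n - d)| < Num.min 1 (e / (2 * (cabs l + 1))).
    by rewrite sub0r normrN ger0_norm// cabs_ge0.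
  by near: n.
have h3 := H _ hw.
have sn : 0 < cabs (s n) by rewrite lt_def cabs_eq0 s0 cabs_ge0.
have -> : (f (p + w n) - f p) / s n - l * d =
   (f (p + w n) - f p - l * w n) / s n + l * (w n / s n - d) by field.
have wsD : cabs (w n) / cabs (s n) <= D.
  rewrite -cabsV -cabsM -(subrK d (w n / s n)); apply: le_trans (cabsD _ _) _.
  by rewrite /D addrC lerD2l ltW.
apply: le_lt_trans (cabsD _ _) _; rewrite !cabsM cabsV.
have A1 : cabs (f (p + w n) - f p - l * w n) / cabs (s n) <= e / 2.
  apply: (@le_trans _ _ (e / (2 * D) * (cabs (w n) / cabs (s n)))).
    by rewrite mulrA ler_wpM2r ?invr_ge0 ?cabs_ge0.
  have -> : e / 2 = e / (2 * D) * D by field; apply/eqP; lra.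
  by apply: ler_wpM2l => //; apply: divr_ge0; exact: ltW.
have A2 : cabs l * cabs (w n / s n - d) < e / 2.
  apply: (@le_lt_trans _ _ ((cabs l + 1) * cabs (w n / s n - d))).
    by rewrite ler_wpM2r ?cabs_ge0// lerDl.
  have -> : e / 2 = (cabs l + 1) * (e / (2 * (cabs l + 1))) by field; apply/eqP; lra.
  by rewrite ltr_pM2l.
lra.
Unshelve. all: by end_near. Qed.

Lemma ccvgMl (c : C) (x : nat -> C) (l : C) : x @ \oo --> l -> (fun n => c * x n) @ \oo --> c * l.
Proof. by move=> h; exact: (cvgM (cvg_cst c) h). Qed.

Lemma ccvgMr (c : C) (x : nat -> C) (l : C) : x @ \oo --> l -> (fun n => x n * c) @ \oo --> l * c.
Proof. by move=> h; exact: (cvgM h (cvg_cst c)). Qed.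

Lemma eq_ccvg (x y : nat -> C) (l : C) : (forall n, x n = y n) ->
  x @ \oo --> l -> y @ \oo --> l.
Proof. by move=> /funext ->. Qed.

Lemma ccvg_unique (x : nat -> C) (l l' : C) : x @ \oo --> l -> x @ \oo --> l' -> l = l'.
Proof.
move=> /cvgCP/cvgrPdist_lt h /cvgCP/cvgrPdist_lt h'.
apply/eqP; rewrite -subr_eq0 -cabs_eq0 eq_le cabs_ge0 andbT; apply/ler_addgt0Pr => e e0.
have e2 : 0 < e / 2 by rewrite divr_gt0.
have [m _ hm] := h' _ e2.
have [k _ hk] := h _ e2.
have := hk (maxn m k) (leq_maxr _ _); have := hm (maxn m k) (leq_maxl _ _).
move: (x _) => y; rewrite /= !sub0r !normrN !ger0_norm ?cabs_ge0// => h1 h2.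
have -> : l - l' = (y - l') - (y - l) by ring.
by apply: le_trans (cabsB _ _) _; lra.
Qed.

Lemma ccvg_shiftS (x : nat -> C) (l : C) : (fun n => x n.+1) @ \oo --> l -> x @ \oo --> l.
Proof. by move=> h; rewrite -cvg_shiftS. Qed.

Lemma weight1 : weight (fun _ : C => 1 : R).
Proof.
split => //; apply/integrableP; split; first exact: measurable_cst.
have -> : (\int[dA]_(x in disc2) `|1%:E| = \int[mu]_(r in `[0%R, 1%R[) ((2 * r)%:E * 1%:E))%E.
  rewrite -(ge0_integral_disc_polar (psi := fun=> 1%:E))//.
  by apply: eq_integral => p _; rewrite /= normr1.
apply: (@le_lt_trans _ _ (\int[mu]_(r in `[0%R, 1%R[) (cst 2%:E r))%E).
  apply: ge0_le_integral => //.
  - by move=> r /=; rewrite in_itv/= => /andP[r0 _]; rewrite mule1 lee_fin mulr_ge0.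
  - by apply: emeasurable_funM => //; apply/measurable_EFinP; exact: mulrl_measurable.
  - move=> r /=; rewrite in_itv/= => /andP[r0 r1]; rewrite mule1 lee_fin.
    by rewrite ler_piMr// ltW.
rewrite integral_cst//= lebesgue_measure_itv/= lte_fin ltr01 -EFinD -EFinM; exact: ltry.
Qed.

Lemma radial1 : radial (fun _ : C => 1 : R).
Proof. by []. Qed.

End LipschitzDisc.

(** * Taylor expansion on the disc *)

Section CauchyTaylor.
Context {R : realType}.
Local Notation C := R[i].
Local Notation mu := (@lebesgue_measure R).
Local Notation MR := (measurableTypeR R).
Local Notation E := (MR * MR)%type.
Local Notation I01 := (`[0%R, 1%R[%classic : set MR).
Local Notation one := (fun _ : C => 1 : R).

Lemma tail_one_bounds (r : R) : 0 <= r < 1 ->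
  2 * r * (1 - r) <= tail one r <= 2 * (1 - r).
Proof.
move=> r01; have /andP[r0 r1] := r01.
have wE : what one r = (1 - r)%:E.
  rewrite /what integral_cst/=; last exact: measurable_itv.
  by rewrite lebesgue_measure_itv/= lte_fin r1 mul1e.
have := what_le_tail weight1 radial1 r01; have := tail_le_what weight1 radial1 r01.
by rewrite wE -!EFinM !lee_fin => -> ->.
Qed.

(** e^(i / (n + 1)) avoids 1, so that difference quotients make sense, and -1, so that rotation
    invariance applies. *)
Lemma rotation_sequence : exists u : nat -> C, [/\ forall n, cabs (u n) = 1,
  forall n, u n != -1, forall n, u n != 1 & u @ \oo --> (1 : C)].
Proof.
have s0 n : 0 < sin (n.+1%:R^-1 : R).
  apply: sin_gt0_pi; rewrite invr_gt0 ltr0n/= (@le_lt_trans _ _ 1)//.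
    by rewrite invf_le1// ler1n.
  by have := @pi_ge2 R; lra.
exists (fun n => expi (n.+1%:R^-1)); split => [n|n|n|].
- exact: cabs_expi.
- by apply/eqP => /(congr1 (@complex.Im R))/= h; have := s0 n; rewrite h oppr0 ltxx.
- by apply/eqP => /(congr1 (@complex.Im R))/= h; have := s0 n; rewrite h ltxx.
- apply: cvg_ReIm => /=.
    rewrite -[X in _ --> X](@cos0 R); apply: (continuous_cvg _ (@continuous_cos R _)).
    exact: cvg_harmonic.
  rewrite -[X in _ --> X](@sin0 R); apply: (continuous_cvg _ (@continuous_sin R _)).
  exact: cvg_harmonic.
Qed.

Section fixed_function.
Variables (f f' : C -> C) (K s : R).
Hypotheses (df : forall z, disc z -> cderiv f z (f' z))
           (fK : forall z, disc z -> cabs (f' z) <= K) (s01 : 0 < s < 1).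

Let chi (xi : C) : R := (s <= cabs xi)%R%:R.

Let s0 : 0 < s. Proof. by case/andP : s01. Qed.

Let chi01 xi : 0 <= chi xi <= 1.
Proof. by rewrite /chi; case: (s <= cabs xi); rewrite /= ?ler01 ?lexx. Qed.

Let bchi : bmeas chi. Proof. exact: bmeas_ge. Qed.

Let K0 : 0 <= K.
Proof.
have D0 : disc (0 : C) by rewrite /disc/mkset ComplexField.Normc.normc0.
exact: le_trans (cabs_ge0 _) (fK D0).
Qed.

Let flip := disc_lipschitz df fK.

Let cdist_le2 (a b : C) : disc a -> disc b -> cabs (b - a) <= 2.
Proof. by rewrite /disc/mkset => a1 b1; apply: le_trans (cabsB _ _) _; lra. Qed.

(* [J xi] is 1 / xi on s <= |xi| and 0 on |xi| < s. *)
Let maxs (r : R) : R := Num.max r s.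
Let Jr k (xi : C) : R := chi xi * ((maxs (cabs xi)) ^+ 2)^-1 ^+ k.
Let J (xi : C) : C := (Jr 1 xi)%:C * xi^*.

Let bmaxs : bmeas (fun xi : C => ((maxs (cabs xi)) ^+ 2)^-1).
Proof.
apply: (bmeas_radial (phi := fun r : MR => ((maxs r) ^+ 2)^-1 : MR) (M := (s ^+ 2)^-1)).
  apply: nonincreasing_measurable; first exact: measurable_itv.
  move=> x y xy; have m0 t : 0 < maxs t by rewrite /maxs lt_max s0 orbT.
  rewrite lef_pV2 ?posrE ?exprn_gt0// lerXn2r ?nnegrE ?(ltW (m0 _))//.
  by rewrite /maxs ge_max !le_max xy lexx orbT.
move=> r _; have m0 : 0 < maxs r by rewrite /maxs lt_max s0 orbT.
rewrite ger0_norm ?invr_ge0 ?exprn_ge0 ?(ltW m0)//.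
rewrite lef_pV2 ?posrE ?exprn_gt0// lerXn2r ?nnegrE ?(ltW m0) ?(ltW s0)//.
by rewrite /maxs le_max lexx orbT.
Qed.

Let bJr k : bmeas (Jr k). Proof. by apply: bmeasM => //; exact: bmeasX. Qed.

Let bJ : cbmeas J.
Proof. by apply: cbmeasM; [exact: cbmeas_real|exact: cbmeasJ cbmeas_id]. Qed.

Let J_in xi : s <= cabs xi -> J xi = xi^-1.
Proof.
move=> sx; have x0 : 0 < cabs xi by exact: lt_le_trans sx.
rewrite /J /Jr /chi sx mul1r expr1 /maxs max_l//.
have xi0 : xi != 0 by rewrite -cabs_eq0 gt_eqF.
by apply: (mulfI xi0); rewrite mulrCA mulJ_cabs -rmorphM/= mulVf ?mulfV// gt_eqF// exprn_gt0.
Qed.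

Let J_out xi : cabs xi < s -> J xi = 0.
Proof. by move=> sx; rewrite /J /Jr /chi leNgt sx/= mul0r mul0r. Qed.

Let J_bound xi : cabs (J xi) <= s^-1.
Proof.
have [sx|sx] := leP s (cabs xi); last first.
  by rewrite J_out// ComplexField.Normc.normc0 invr_ge0 ltW.
by rewrite J_in// cabsV lef_pV2// posrE// (lt_le_trans s0).
Qed.

Let A := tail one s.

Let A0 : 0 < A.
Proof.
have s01' : 0 <= s < 1 by case/andP : s01 => /ltW -> ->.
have /andP[h _] := tail_one_bounds s01'; apply: lt_le_trans h.
by rewrite !mulr_gt0// subr_gt0; case/andP : s01.
Qed.

(** chi J^k is a radial function times conj(xi)^k, hence orthogonal to 1 for k > 0; at k = 0 the
    mass A of the annulus remains. *)
Let cint_chiJ k : cint one (fun xi => (chi xi)%:C * J xi ^+ k) = if k is 0 then A%:C else 0.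
Proof.
case: k => [|k].
  rewrite (eq_cint _ (G := fun xi => (chi xi)%:C)) => [|z _]; last by rewrite expr0 mulr1.
  by rewrite cint_real//; exact: weight1.
have := @cint_orthogonal _ one weight1 radial1 (Jr k.+1) 0 k.+1 (bJr _) _ isT.
move=> <-; last by move=> u z u1 zD; rewrite /Jr /chi cabsM u1 mul1r.
apply: eq_cint => z _; rewrite expr0 mul1r /J exprMn -rmorphXn mulrA -rmorphM; congr (_%:C * _).
rewrite /Jr expr1 exprMn mulrA; congr (_ * _).
by rewrite /chi; case: (s <= cabs z); rewrite /= ?mul0r ?mul1r ?expr1n ?mulr1.
Qed.

Section fixed_point.
Variable z : C.
Hypothesis zs : cabs z < s.

Let zD : disc z. Proof. by rewrite /disc/mkset (lt_trans zs)//; case/andP : s01. Qed.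

Let Q : R := (1 - cabs z / s)^-1.

Let zs1 : 0 <= cabs z / s < 1.
Proof. by rewrite divr_ge0 ?cabs_ge0 ?(ltW s0)//= ltr_pdivrMr// mul1r. Qed.

Let Q0 : 0 < Q. Proof. by rewrite invr_gt0 subr_gt0; case/andP : zs1. Qed.

Let S n (xi : C) : C := \sum_(0 <= k < n) (z * J xi) ^+ k.

Let zJ_bound xi : cabs (z * J xi) <= cabs z / s.
Proof. by rewrite cabsM ler_wpM2l ?cabs_ge0. Qed.

Let S_summable xi : abs_summable (fun k => (z * J xi) ^+ k) Q.
Proof.
move=> n; apply: le_trans (geometric_sum_le n zs1); apply: ler_sum => k _.
rewrite cabsX lerXn2r// nnegrE ?cabs_ge0//; first by case/andP : zs1.
Qed.

Let S_bound n xi : cabs (S n xi) <= Q.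
Proof. exact: le_trans (cabs_sum _ _ _) (S_summable xi n). Qed.

(** Geometric series of 1 / (1 - z J), which equals xi / (xi - z) on the annulus s <= |xi|; it
    converges uniformly since |z J| <= |z| / s < 1. *)
Let T (xi : C) : C := csum (fun k => (z * J xi) ^+ k).

Let T_eq xi : (1 - z * J xi) * T xi = 1.
Proof.
have h := S_summable xi; rewrite mulrBl mul1r {1}/T (csumS h) expr0.
rewrite -(csumZ _ h); set c1 := csum _; set c2 := csum _.
have -> : c1 = c2 by congr csum; apply/funext => k; rewrite exprS.
by rewrite addrK.
Qed.

Let q (xi : C) : C := (chi xi)%:C * T xi.

(** Clearing the denominator xi - z is what later turns the derivative in t into a mean of f'(.)
    xi. *)
Let q_spec xi : (xi - z) * q xi = (chi xi)%:C * xi.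
Proof.
rewrite /q /chi; have [sx|sx] := leP s (cabs xi); last by rewrite !mul0r mulr0.
rewrite !mul1r; have xi0 : xi != 0 by rewrite -cabs_eq0 gt_eqF// (lt_le_trans s0).
have -> : xi - z = xi * (1 - z * J xi) by rewrite J_in// mulrBr mulr1 mulrCA mulfV// mulr1.
by rewrite -mulrA T_eq mulr1.
Qed.

Let cabs_chi xi : cabs (chi xi)%:C <= 1.
Proof. by rewrite cabs_ge0_real; case/andP : (chi01 xi). Qed.

Let bS n : cbmeas (S n).
Proof. by apply: cbmeas_sum => k; apply: cbmeasX; apply: cbmeasM => //; exact: cbmeas_cst. Qed.

(** The partial sums of the geometric series are bounded by Q, so they integrate term by term
    against any bounded F. *)
Let cint_q (F : C -> C) : cbmeas F ->
  cbmeas (fun xi => F xi * q xi) /\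
  series (fun k => cint one (fun xi => F xi * ((chi xi)%:C * J xi ^+ k)) * z ^+ k) @ \oo
    --> cint one (fun xi => F xi * q xi).
Proof.
move=> bF; have [M FM] := cbmeas_bound bF.
have M0 : 0 <= M by exact: le_trans (cabs_ge0 _) (FM z zD).
have bc : cbmeas (fun xi => (chi xi)%:C) by exact: cbmeas_real.
have [|||b c] := @bounded_ccvg _ one weight1 (fun n xi => F xi * ((chi xi)%:C * S n xi))
   (fun xi => F xi * q xi) (M * Q).
- by move=> n; apply: cbmeasM => //; exact: cbmeasM.
- move=> n xi xiD; rewrite cabsM ler_pM ?cabs_ge0 ?FM// cabsM -[leRHS]mul1r.
  by rewrite ler_pM ?cabs_ge0.
- move=> xi xiD; rewrite /q.
  have h : (fun n => S n xi) @ \oo --> T xi by refine (abs_summable_cvg (S_summable xi)).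
  exact: (ccvgMl (ccvgMl h)).
split => //; apply: eq_ccvg c => n.
rewrite /series/=.
rewrite (eq_cint one (G := fun xi => \sum_(0 <= k < n) z ^+ k * (F xi * ((chi xi)%:C * J xi ^+ k)))).
  have bk k : cbmeas (fun xi => F xi * ((chi xi)%:C * J xi ^+ k)).
    by apply: cbmeasM => //; apply: cbmeasM => //; exact: cbmeasX.
  rewrite cint_sum//; [|exact: weight1|by move=> k; apply: cbmeasM => //; exact: cbmeas_cst].
  by apply: eq_bigr => k _; rewrite cintZ 1?mulrC//; exact: weight1.
move=> xi _; rewrite /S mulr_sumr mulr_sumr; apply: eq_bigr => k _.
by rewrite exprMn; ring.
Qed.

Let bq : cbmeas q.
Proof.
have [b _] := cint_q (cbmeas_cst 1); apply: eq_cbmeas b => xi _; exact: mul1r.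
Qed.

Let cint_q1 : cint one q = A%:C.
Proof.
have [_] := cint_q (cbmeas_cst 1).
rewrite (eq_cint one (G := q)) => [|xi _]; last exact: mul1r.
move=> h; apply: (ccvg_unique h); apply: ccvg_shiftS.
have -> : (fun n => series (fun k => cint one (fun xi => 1 * ((chi xi)%:C * J xi ^+ k)) * z ^+ k) n.+1)
   = (fun=> A%:C); last exact: cvg_cst.
apply/funext => n; rewrite /series/= big_nat_recl//= big1 => [|k _].
  rewrite addr0 expr0 mulr1 (eq_cint one (G := fun xi => (chi xi)%:C * J xi ^+ 0)) ?(cint_chiJ 0)//.
  by move=> xi _; exact: mul1r.
rewrite (eq_cint one (G := fun xi => (chi xi)%:C * J xi ^+ k.+1)) ?(cint_chiJ k.+1) ?mul0r//.
by move=> xi _; exact: mul1r.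
Qed.

Let P (t : R) (xi : C) : C := z + (clamp t)%:C * (xi - z).

Let PD t xi : disc xi -> disc (P t xi).
Proof. by move=> xiD; apply: disc_segment => //; exact: clamp_itv. Qed.

Let bfP t : cbmeas (fun xi => f (P t xi)).
Proof.
apply: (@lipschitz_cbmeas _ _ K) => a b Da Db.
apply: le_trans (flip (PD t Da) (PD t Db)) _; rewrite ler_wpM2l//.
have -> : P t b - P t a = (clamp t)%:C * (b - a) by rewrite /P; ring.
have /andP[c0 c1] := clamp_itv t.
by rewrite cabsM cabs_ge0_real// ler_piMl ?cabs_ge0.
Qed.

Let P_dist t t' xi : disc xi -> cabs (f (P t xi) - f (P t' xi)) <= K * 2 * `|t - t'|.
Proof.
move=> xiD; apply: le_trans (flip (PD t' xiD) (PD t xiD)) _; rewrite -mulrA ler_wpM2l//.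
have -> : P t xi - P t' xi = (clamp t - clamp t')%:C * (xi - z) by rewrite /P rmorphB; ring.
rewrite cabsM cabs_real mulrC ler_pM ?cabs_ge0 ?cdist_le2// clamp_lipschitz//.
Qed.

Let q_bound xi : cabs (q xi) <= Q.
Proof.
rewrite /q cabsM -[leRHS]mul1r ler_pM ?cabs_ge0//; exact: cabs_csum (S_summable xi).
Qed.

Let G t := cint one (fun xi => f (P t xi) * q xi).

Let bfq t : cbmeas (fun xi => f (P t xi) * q xi). Proof. exact: cbmeasM. Qed.

Let G_sub t t' : G t - G t' = cint one (fun xi => (f (P t xi) - f (P t' xi)) * q xi).
Proof.
rewrite /G -cintB//; last exact: weight1.
by apply: eq_cint => xi _; rewrite mulrBl.
Qed.

Let G_lip t t' : cabs (G t - G t') <= (K * 2 * Q * dint one (fun=> 1)) * `|t - t'|.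
Proof.
rewrite G_sub.
have b1 : cbmeas (fun xi => (f (P t xi) - f (P t' xi)) * q xi).
  by apply: eq_cbmeas (cbmeasM (cbmeasD (bfP t) (cbmeasM (cbmeas_cst (-1)) (bfP t'))) bq) => xi _; ring.
apply: le_trans (cabs_cint weight1 b1) _.
have -> : K * 2 * Q * dint one (fun=> 1) * `|t - t'| =
   dint one (fun=> K * 2 * `|t - t'| * Q * 1).
  by rewrite (dintZ weight1 _ (bmeas_cst 1)); ring.
apply: dint_le => //; [exact: weight1|exact: bmeas_cabs_comp|exact: bmeas_cst|].
move=> xi xiD; rewrite cabsM mulr1 ler_pM ?cabs_ge0//.
exact: P_dist.
Qed.

(** Differentiating f(z + t (u xi - z)) in u at u = 1 gives t f'(.) xi, while the mean over the
    annulus does not depend on u. Division by t (u - 1) requires t > 0. *)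
Let rot_deriv t : 0 < t < 1 ->
  cbmeas (fun xi => f' (P t xi) * xi * (chi xi)%:C) /\
  cint one (fun xi => f' (P t xi) * xi * (chi xi)%:C) = 0.
Proof.
move=> t01; have /andP[t0 t1] := t01.
have tc : clamp t = t by apply: clamp_id; rewrite (ltW t0) (ltW t1).
have [u [u1 uN un cu]] := rotation_sequence.
pose F n xi : C := (f (P t (u n * xi)) - f (P t xi)) / (t%:C * (u n - 1)) * (chi xi)%:C.
have bc : cbmeas (fun xi => (chi xi)%:C) by exact: cbmeas_real.
have bH : cbmeas (fun xi => f (P t xi) * (chi xi)%:C) by exact: cbmeasM.
have bHr n : cbmeas (fun xi => f (P t (u n * xi)) * (chi xi)%:C).
  have [h1 h2] := bH.
  apply: (@eq_cbmeas _ (fun xi => f (P t (u n * xi)) * (chi (u n * xi))%:C)).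
    by move=> xi _; rewrite /chi cabsM u1 mul1r.
  by split; [exact: (bmeas_rot (u1 n) h1)|exact: (bmeas_rot (u1 n) h2)].
have E1 n xi : F n xi = (t%:C * (u n - 1))^-1 *
    (f (P t (u n * xi)) * (chi xi)%:C - f (P t xi) * (chi xi)%:C) by rewrite /F; ring.
have bD n : cbmeas (fun xi => f (P t (u n * xi)) * (chi xi)%:C - f (P t xi) * (chi xi)%:C).
  by apply: eq_cbmeas (cbmeasD (bHr n) (cbmeasM (cbmeas_cst (-1)) bH)) => xi _; ring.
have bF n : cbmeas (F n).
  by apply: eq_cbmeas (cbmeasM (cbmeas_cst _) (bD n)) => xi _; rewrite E1.
have tu n : t%:C * (u n - 1) != 0.
  rewrite mulf_neq0 ?subr_eq0 ?un//; apply/eqP => -[] h; move: t0; by rewrite h ltxx.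
have F0 n : cint one (F n) = 0.
  rewrite (eq_cint one (fun xi _ => E1 n xi)) cintZ//; last exact: weight1.
  rewrite cintB//; last exact: weight1.
  rewrite (eq_cint one (G := fun xi => (fun x => f (P t x) * (chi x)%:C) (u n * xi))).
    by rewrite (cint_rot weight1 radial1 (u1 n) (uN n) bH) subrr mulr0.
  by move=> xi _; rewrite /chi cabsM u1 mul1r.
have rD n xi : disc xi -> disc (u n * xi) by move=> xiD; exact/disc_rot.
have [|||b c] := @bounded_ccvg _ one weight1 F (fun xi => f' (P t xi) * xi * (chi xi)%:C) K.
- exact: bF.
- move=> n xi xiD; rewrite /F cabsM -[leRHS]mulr1 ler_pM ?cabs_ge0//.
  rewrite cabsM cabsV ler_pdivrMr; last by rewrite lt_def cabs_eq0 tu cabs_ge0.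
  apply: le_trans (flip (PD t xiD) (PD t (rD n xi xiD))) _; rewrite ler_wpM2l//.
  have -> : P t (u n * xi) - P t xi = (t%:C * (u n - 1)) * xi by rewrite /P tc; ring.
  by rewrite cabsM ler_piMr ?cabs_ge0//; exact: ltW.
- move=> xi xiD; apply: ccvgMr.
  have -> : (fun n => (f (P t (u n * xi)) - f (P t xi)) / (t%:C * (u n - 1))) =
    (fun n => (f (P t xi + (t%:C * (u n - 1)) * xi) - f (P t xi)) / (t%:C * (u n - 1))).
    by apply/funext => n; congr ((f _ - _) / _); rewrite /P tc; ring.
  apply: (cderiv_quotient (df (PD t xiD)) tu).
  + have -> : (0 : C) = t%:C * (1 - 1) * xi by rewrite subrr mulr0 mul0r.
    by apply: ccvgMr; apply: ccvgMl; exact: (cvgB cu (cvg_cst (1 : C))).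
  + have -> : (fun n => t%:C * (u n - 1) * xi / (t%:C * (u n - 1))) = (fun=> xi).
      by apply/funext => n; rewrite mulrAC mulfV ?tu// mul1r.
    exact: cvg_cst.
split => //; apply: (ccvg_unique c).
have -> : (fun n => cint one (F n)) = (fun=> 0) by apply/funext => n; exact: F0.
exact: cvg_cst.
Qed.

(** The derivative of f(P t xi) in t is f'(P t xi) (xi - z); times q it becomes f'(P t xi) xi on the
    annulus, whose mean vanishes by [rot_deriv]. *)
Let G_deriv t : 0 < t < 1 -> forall d : nat -> R, (forall n, d n != 0) -> d @ \oo --> (0 : R) ->
  (fun n => (G (d n + t) - G t) * ((d n)^-1)%:C) @ \oo --> (0 : C).
Proof.
move=> t01 d dn0 d0; have /andP[t0 t1] := t01.
have [b0 <-] := rot_deriv t01.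
have tc : clamp t = t by apply: clamp_id; rewrite (ltW t0) (ltW t1).
have dC n : (d n)%:C != 0 by apply/eqP => -[] h; have := dn0 n; rewrite h eqxx.
pose F n xi : C := (f (P (d n + t) xi) - f (P t xi)) / (d n)%:C * q xi.
have E1 n xi : F n xi = ((d n)%:C)^-1 * ((f (P (d n + t) xi) - f (P t xi)) * q xi).
  by rewrite /F; ring.
have b1 n : cbmeas (fun xi => (f (P (d n + t) xi) - f (P t xi)) * q xi).
  by apply: eq_cbmeas (cbmeasM (cbmeasD (bfP (d n + t)) (cbmeasM (cbmeas_cst (-1)) (bfP t))) bq) => xi _; ring.
have [|||b c] := @bounded_ccvg _ one weight1 F (fun xi => f' (P t xi) * xi * (chi xi)%:C) (K * 2 * Q).
- by move=> n; apply: eq_cbmeas (cbmeasM (cbmeas_cst _) (b1 n)) => xi _; rewrite E1.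
- move=> n xi xiD; rewrite /F cabsM ler_pM ?cabs_ge0//.
  rewrite cabsM cabsV cabs_real ler_pdivrMr ?normr_gt0//.
  by have := P_dist (d n + t) t xiD; rewrite addrK.
- move=> xi xiD.
  have -> : f' (P t xi) * xi * (chi xi)%:C = f' (P t xi) * (xi - z) * q xi.
    by rewrite -!mulrA q_spec; ring.
  apply: ccvgMr.
  have -> : (fun n => (f (P (d n + t) xi) - f (P t xi)) / (d n)%:C) =
    (fun n => (f (P t xi + (clamp (d n + t) - t)%:C * (xi - z)) - f (P t xi)) / (d n)%:C).
    by apply/funext => n; congr ((f _ - _) / _); rewrite /P tc rmorphB; ring.
  (* The truncation is inactive from some index on, as t lies strictly inside the interval. *)
  have near_id : \forall n \near \oo, clamp (d n + t) = d n + t.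
    have m0 : 0 < Num.min t (1 - t) by rewrite lt_min t0 subr_gt0.
    move/cvgrPdist_lt : d0 => /(_ _ m0); apply: filterS => n.
    rewrite sub0r normrN lt_min => /andP[h1 h2]; apply: clamp_id.
    by have := ler_norm (d n); have := ler_norm (- d n); rewrite normrN => *; apply/andP; split; lra.
  apply: (cderiv_quotient (df (PD t xiD)) dC).
  + have -> : (0 : C) = (0 : R)%:C * (xi - z) by rewrite rmorph0 mul0r.
    apply: ccvgMr; apply: cvg_ReIm => /=; last exact: cvg_cst.
    apply/cvgrPdist_lt => e e0; move/cvgrPdist_lt : d0 => /(_ _ e0); apply: filterS => n.
    rewrite !sub0r !normrN; apply: le_lt_trans.
    by rewrite -[X in _ - X]tc (le_trans (clamp_lipschitz _ _))// addrK.
  + apply: cvg_near_cst; near=> n.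
    have -> : clamp (d n + t) = d n + t by near: n.
    by rewrite addrK mulrAC mulfV ?dC// mul1r.
apply: eq_ccvg c => n.
rewrite (eq_cint one (fun xi _ => E1 n xi)) cintZ//; last exact: weight1.
by rewrite G_sub mulrC fmorphV.
Unshelve. all: by end_near. Qed.

Let G_const : G 1 = G 0.
Proof.
apply/eqP; rewrite -subr_eq0 -cabs_eq0.
have [u [u1 uE]] := cabs_phase (G 1 - G 0).
pose g t := complex.Re (u * G t).
have gE a b : g a - g b = complex.Re (u * (G a - G b)) by rewrite /g -cReB mulrBr.
have : `|g 1 - g 0| <= 0.
  apply: (@mvt_bound _ g (fun=> 0)) => [|t t01|t _]; last by rewrite normr0.
    apply: (@lipschitz_continuous _ g (K * 2 * Q * dint one (fun=> 1))) => a b.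
    rewrite gE; apply: le_trans (Re_le_cabs _) _; rewrite cabsM u1 mul1r.
    exact: G_lip.
  apply/cvgr_dnbhsP => d [dn0 d0].
  have h := G_deriv t01 dn0 d0.
  have -> : (fun n => (d n)^-1 * (g (d n + t) - g t)) =
    (fun n => complex.Re (u * ((G (d n + t) - G t) * ((d n)^-1)%:C))).
    by apply/funext => n; rewrite mulrA cRe_scale gE mulrC.
  have -> : (0 : R) = complex.Re (u * 0) by rewrite mulr0.
  by apply: cvg_Re; exact: ccvgMl.
rewrite gE uE; have -> : complex.Re (cabs (G 1 - G 0))%:C = cabs (G 1 - G 0) by [].
by rewrite ger0_norm ?cabs_ge0// => h; rewrite eq_le h cabs_ge0.
Qed.

Let bf : cbmeas f. Proof. exact: lipschitz_cbmeas flip. Qed.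

(** G 1 is the mean of f q, and G 0 is f(z) times the mean of q, that is f(z) A. Constancy of G acts
    as a Cauchy formula, and the expansion of q gives the series. *)
Lemma cauchy_series :
  series (fun k => cint one (fun xi => f xi * ((chi xi)%:C * J xi ^+ k)) * z ^+ k) @ \oo
    --> f z * A%:C.
Proof.
have [_ h] := cint_q bf.
suff <- : cint one (fun xi => f xi * q xi) = f z * A%:C by exact: h.
transitivity (G 1).
  apply: eq_cint => xi _; congr (f _ * _).
  by rewrite /P clamp_id ?ler01 ?lexx// mul1r addrC subrK.
rewrite G_const /G (eq_cint one (G := fun xi => f z * q xi)) => [|xi _]; last first.
  by congr (f _ * _); rewrite /P clamp_id ?ler01 ?lexx// mul0r addr0.
by rewrite cintZ ?cint_q1//; exact: weight1.
Qed.

End fixed_point.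

(** The coefficients in [cauchy_series] do not involve z, and |J| <= 1 / s bounds them by a multiple
    of s^(-k). *)
Lemma cauchy_taylor : exists2 a : nat -> C, radius_ge s a &
  forall z, cabs z < s -> f z = ps a z.
Proof.
have bf : cbmeas f by exact: lipschitz_cbmeas flip.
have [M FM] := cbmeas_bound bf.
have D0 : disc (0 : C) by rewrite /disc/mkset ComplexField.Normc.normc0.
have M0 : 0 <= M by exact: le_trans (cabs_ge0 _) (FM 0 D0).
pose b k := cint one (fun xi => f xi * ((chi xi)%:C * J xi ^+ k)).
have bb k : cabs (b k) <= M * s^-1 ^+ k * dint one (fun=> 1).
  have b1 : cbmeas (fun xi => f xi * ((chi xi)%:C * J xi ^+ k)).
    by apply: cbmeasM => //; apply: cbmeasM; [exact: cbmeas_real|exact: cbmeasX].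
  apply: le_trans (cabs_cint weight1 b1) _; rewrite -(dintZ weight1 _ (bmeas_cst 1)).
  apply: dint_le => //; [exact: weight1|exact: bmeas_cabs_comp|exact: bmeas_cst|].
  move=> xi xiD; rewrite mulr1 cabsM ler_pM ?cabs_ge0 ?FM// cabsM -[leRHS]mul1r.
  rewrite ler_pM ?cabs_ge0//; first by rewrite cabs_ge0_real; case/andP : (chi01 xi).
  by rewrite cabsX lerXn2r// nnegrE ?cabs_ge0// invr_ge0 ltW.
have d0 : 0 <= dint one (fun=> 1) by apply: dint_ge0 => //; exact: weight1.
exists (fun k => A%:C^-1 * b k).
  move=> r /andP[r0 rs]; exists (A^-1 * (M * dint one (fun=> 1))) => k.
  rewrite cabsM cabsV cabs_ge0_real ?(ltW A0)// -mulrA ler_wpM2l ?invr_ge0 ?(ltW A0)//.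
  apply: (@le_trans _ _ (M * s^-1 ^+ k * dint one (fun=> 1) * r ^+ k)).
    by rewrite ler_wpM2r ?exprn_ge0.
  have -> : M * s^-1 ^+ k * dint one (fun=> 1) * r ^+ k =
    M * dint one (fun=> 1) * (s^-1 * r) ^+ k by rewrite exprMn; ring.
  rewrite ler_piMr ?mulr_ge0// exprn_ile1 ?mulr_ge0 ?invr_ge0 ?(ltW s0)//.
  by rewrite mulrC ler_pdivrMr// mul1r ltW.
move=> z zs; apply/esym/csumE.
have AC : A%:C != 0 by apply/eqP => -[] h; move: A0; rewrite h ltxx.
have -> : f z = A%:C^-1 * (f z * A%:C) by rewrite mulrCA mulVf ?mulr1.
have -> : series (fun k => A%:C^-1 * b k * z ^+ k) = (fun n => A%:C^-1 * series (fun k => b k * z ^+ k) n).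
  by apply/funext => n; rewrite /series/= mulr_sumr; apply: eq_bigr => k _; rewrite mulrA.
exact: (ccvgMl (cauchy_series zs)).
Qed.

End fixed_function.
End CauchyTaylor.

(** * Kernel estimates *)

Section KernelEstimate.
Context {R : realType}.
Local Notation C := R[i].
Local Notation MR := (measurableTypeR R).
Local Notation I01 := (`[0%R, 1%R[%classic : set MR).

Lemma ccvg_cabs (x : nat -> C) (l : C) : x @ \oo --> l ->
  (fun n => cabs (x n)) @ \oo --> cabs l.
Proof.
move=> /cvgCP/cvgrPdist_lt h; apply/cvgrPdist_lt => e e0.
apply: filterS (h e e0) => n; rewrite sub0r normrN ger0_norm ?cabs_ge0//.
apply: le_lt_trans; rewrite ler_norml lerNl opprB cabsB_ge/= cabs_distC.
exact: cabsB_ge.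
Qed.

Definition nondecreasing01 (phi : R -> R) :=
  forall s t, 0 <= s -> s <= t -> t < 1 -> phi s <= phi t.

(** Monotonicity is known on [0, 1) only: the clamp extends it to the line, and rho < 1 keeps the
    argument away from 1, where phi may blow up. *)
Lemma bmeas_nondecreasing (phi : R -> R) (rho : R) : nondecreasing01 phi -> 0 <= rho < 1 ->
  bmeas (fun xi : C => phi (rho * cabs xi)).
Proof.
move=> mphi /andP[r0 r1].
have rc t : 0 <= rho * clamp t /\ rho * clamp t <= rho.
  by have /andP[c0 c1] := clamp_itv t; rewrite mulr_ge0// ler_piMr.
apply: (@eq_bmeas _ (fun xi => (fun r : MR => phi (rho * clamp r) : MR) (cabs xi))).
  by move=> z zD; rewrite clamp_id// cabs_ge0/= ltW.
apply: (bmeas_radial (phi := fun r : MR => phi (rho * clamp r) : MR) (M := `|phi 0| + `|phi rho|)).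
  apply: nondecreasing_measurable; first exact: measurable_itv.
  move=> s t st; have [s0 s1] := rc s; have [t0 t1] := rc t.
  apply: mphi => //; last exact: le_lt_trans r1.
  rewrite ler_wpM2l//; have := ler_norm (clamp s - clamp t).
  by case: (clampP s) => *; case: (clampP t) => *; lra.
move=> t _; have [t0 t1] := rc t.
have h1 : phi 0 <= phi (rho * clamp t) by apply: mphi => //; exact: le_lt_trans r1.
have h2 : phi (rho * clamp t) <= phi rho by exact: mphi.
have := ler_norm (phi rho); have := ler_norm (- phi 0); rewrite normrN.
have := normr_ge0 (phi 0); have := normr_ge0 (phi rho).
by move=> *; rewrite ler_norml; apply/andP; split; lra.
Qed.

Section fixed_weight.
Variable v : C -> R.
Hypotheses (vw : weight v) (vr : radial v).

(** Cross terms vanish by orthogonality, also under a radial factor psi. Finite sums suffice here;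
    the limit is taken in [bessel]. *)
Lemma parseval_poly (psi : C -> R) (a : nat -> C) (z : C) N : bmeas psi ->
  (forall u xi, cabs u = 1 -> disc xi -> psi (u * xi) = psi xi) ->
  dint v (fun xi => psi xi * cabs (\sum_(0 <= k < N) a k * (z * xi^*) ^+ k) ^+ 2) =
  dint v (fun xi => psi xi * \sum_(0 <= k < N) cabs (a k) ^+ 2 * (cabs z * cabs xi) ^+ (2 * k)).
Proof.
move=> bpsi psir; apply: (@complexI R); rewrite -!(cint_real vw).
have bxJ : cbmeas (fun xi : C => xi^*) by exact: cbmeasJ cbmeas_id.
have bC := cbmeas_real bpsi.
have be j k : cbmeas (fun xi => (psi xi)%:C * (xi ^+ k * xi^* ^+ j)).
  by apply: cbmeasM => //; apply: cbmeasM; apply: cbmeasX => //; exact: cbmeas_id.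
pose c j k := (a j * z ^+ j) * (a k * z ^+ k)^*.
have bce j k : cbmeas (fun xi => c j k * ((psi xi)%:C * (xi ^+ k * xi^* ^+ j))).
  by apply: cbmeasM => //; exact: cbmeas_cst.
rewrite (eq_cint v (G := fun xi => \sum_(0 <= j < N) \sum_(0 <= k < N)
    c j k * ((psi xi)%:C * (xi ^+ k * xi^* ^+ j)))); last first.
  move=> xi _; rewrite rmorphM/= -mulJ_cabs (rmorph_sum (@conjc R)) mulr_suml mulr_sumr.
  apply: eq_bigr => j _; rewrite mulr_sumr mulr_sumr; apply: eq_bigr => k _.
  rewrite /c !rmorphM !rmorphXn/= !rmorphM/= conjcK !exprMn; ring.
rewrite (eq_cint v (F := fun xi => (psi xi * _)%:C) (G := fun xi => \sum_(0 <= j < N)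
    c j j * ((psi xi)%:C * (xi ^+ j * xi^* ^+ j)))); last first.
  move=> xi _; rewrite mulr_sumr rmorph_sum; apply: eq_bigr => j _.
  rewrite cabsXJ /c mulJ_cabs cabsM cabsX -!rmorphM; congr (_%:C).
  by rewrite !exprMn -!exprM (mulnC j); ring.
rewrite cint_sum//; last by move=> j; apply: cbmeas_sum.
rewrite cint_sum//; apply: eq_big_nat => j /andP[_ jN].
rewrite cint_sum// (bigD1_seq j) ?mem_index_iota ?iota_uniq//=.
rewrite [X in _ + X]big1_seq ?addr0// => k /andP[kj _].
by rewrite cintZ// (cint_orthogonal vw vr)// ?mulr0.
Qed.

Lemma ps_bar_meas (a : nat -> C) (z : C) : radius_ge 1 a -> disc z ->
  cbmeas (fun xi => ps a (z * xi^*)) /\ exists M, forall n xi, disc xi ->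
    cabs (\sum_(0 <= k < n) a k * (z * xi^*) ^+ k) <= M.
Proof.
move=> ra zD; have [|M HM] := radius_summable ra (_ : 0 <= cabs z < 1).
  by rewrite cabs_ge0.
have bd n xi : disc xi -> cabs (\sum_(0 <= k < n) a k * (z * xi^*) ^+ k) <= M.
  move=> xiD; apply: le_trans (HM n); apply: le_trans (cabs_sum _ _ _) _.
  apply: ler_sum => k _; rewrite cabsM cabsX ler_wpM2l ?cabs_ge0// lerXn2r// ?nnegrE ?cabs_ge0//.
  by rewrite cabsM cabsJ ler_piMr ?cabs_ge0//; exact: ltW.
split; last by exists M.
have [||xi xiD|] // := @bounded_ccvg _ v vw (fun n xi => \sum_(0 <= k < n) a k * (z * xi^*) ^+ k)
  (fun xi => ps a (z * xi^*)) M.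
- move=> n; apply: cbmeas_sum => k; apply: cbmeasM; first exact: cbmeas_cst.
  by apply: cbmeasX; apply: cbmeasM; [exact: cbmeas_cst|exact: cbmeasJ cbmeas_id].
- apply: (ps_cvg ra); rewrite cabsM cabsJ; apply: le_lt_trans zD.
  by rewrite ler_piMr ?cabs_ge0//; exact: ltW.
Qed.

Lemma bessel (psi : C -> R) (a : nat -> C) (z : C) (B : R -> R) : bmeas psi ->
  (forall u xi, cabs u = 1 -> disc xi -> psi (u * xi) = psi xi) ->
  (forall xi, disc xi -> 0 <= psi xi) -> radius_ge 1 a -> disc z ->
  (forall N t, 0 <= t < 1 -> \sum_(0 <= k < N) cabs (a k) ^+ 2 * t ^+ (2 * k) <= B t) ->
  bmeas (fun xi => B (cabs z * cabs xi)) ->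
  dint v (fun xi => psi xi * cabs (ps a (z * xi^*)) ^+ 2) <=
  dint v (fun xi => psi xi * B (cabs z * cabs xi)).
Proof.
move=> bpsi psir psi0 ra zD HB bB.
have [bps [M HM]] := ps_bar_meas ra zD.
have [_ [N0 HN0]] := bpsi.
have bSn n : cbmeas (fun xi : C => \sum_(0 <= k < n) a k * (z * xi^*) ^+ k).
  apply: cbmeas_sum => k; apply: cbmeasM; first exact: cbmeas_cst.
  by apply: cbmeasX; apply: cbmeasM; [exact: cbmeas_cst|exact: cbmeasJ cbmeas_id].
have zx xi : disc xi -> 0 <= cabs z * cabs xi < 1.
  move=> xiD; rewrite mulr_ge0 ?cabs_ge0//=; apply: le_lt_trans zD.
  by rewrite ler_piMr ?cabs_ge0//; exact: ltW.
have [||xi xiD|_ c] := @bounded_cvg _ v vw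
  (fun n xi => psi xi * cabs (\sum_(0 <= k < n) a k * (z * xi^*) ^+ k) ^+ 2)
  (fun xi => psi xi * cabs (ps a (z * xi^*)) ^+ 2) (N0 * M ^+ 2).
- by move=> n; apply: bmeasM => //; apply: bmeasX; exact: bmeas_cabs_comp.
- move=> n xi xiD; rewrite normrM ler_pM ?HN0// ger0_norm ?exprn_ge0 ?cabs_ge0//.
  rewrite lerXn2r ?nnegrE ?cabs_ge0 ?HM//; exact: le_trans (cabs_ge0 _) (HM 0 _ xiD).
- have h : (fun n => cabs (\sum_(0 <= k < n) a k * (z * xi^*) ^+ k)) @ \oo --> cabs (ps a (z * xi^*)).
    by apply: ccvg_cabs; apply: (ps_cvg ra); rewrite cabsM cabsJ; have /andP[] := zx xi xiD.
  exact: (cvgM (cvg_cst (psi xi)) (cvgM h h)).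
apply: (cvgr_to_le c); apply: nearW => n; rewrite parseval_poly//.
apply: dint_le => //; [|exact: bmeasM|].
  apply: bmeasM => //; elim: n => [|n ih].
    by under eq_fun do rewrite big_nil; exact: bmeas_cst.
  under eq_fun do rewrite big_nat_recr//=; apply: bmeasD => //.
  apply: bmeasM; first exact: bmeas_cst.
  by apply: bmeasX; apply: bmeasM; [exact: bmeas_cst|exact: bmeas_cabs].
by move=> xi xiD; rewrite ler_wpM2l ?psi0// HB// zx.
Qed.

(* By AM-GM, |L| <= (phi |1 / (1 - x)|^2 + |(1 - x) L|^2 / phi) / 2 at x = z conj(xi), and the
   two squares are integrated over circles |xi| = const by Bessel's inequality. *)
Lemma kernel_estimate (l : nat -> R) (phi : R -> R) (z : C) :
  radius_ge 1 (fun k => (l k)%:C) -> nondecreasing01 phi ->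
  (forall t, 0 <= t < 1 -> 0 < phi t) ->
  (forall N t, 0 <= t < 1 ->
     \sum_(0 <= k < N) diffcoef l k ^+ 2 * t ^+ (2 * k) <= phi t ^+ 2 / (1 - t)) ->
  disc z ->
  dint v (fun xi => cabs (ps (fun k => (l k)%:C) (z * xi^*))) <=
  dint v (fun xi => phi (cabs z * cabs xi) / (1 - cabs z * cabs xi)).
Proof.
move=> rl mphi phi0 Hd zD.
have z01 : 0 <= cabs z < 1 by rewrite cabs_ge0.
have zx xi : disc xi -> 0 <= cabs z * cabs xi < 1.
  move=> xiD; rewrite mulr_ge0 ?cabs_ge0//=; apply: le_lt_trans zD.
  by rewrite ler_piMr ?cabs_ge0//; exact: ltW.
have zxC xi : disc xi -> cabs (z * xi^*) < 1.
  by move=> xiD; rewrite cabsM cabsJ; case/andP : (zx xi xiD).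
have rinv (u xi : C) : cabs u = 1 -> cabs (u * xi) = cabs xi by move=> u1; rewrite cabsM u1 mul1r.
pose p xi := phi (cabs z * cabs xi).
have bp : bmeas p by exact: bmeas_nondecreasing.
have p0 xi : disc xi -> 0 < p xi by move=> xiD; apply: phi0; exact: zx.
have bpV : bmeas (fun xi => (p xi)^-1).
  have := bmeasN (bmeas_nondecreasing (phi := fun t => - (phi t)^-1) _ z01).
  have mV : nondecreasing01 (fun t => - (phi t)^-1).
    move=> s t s0 st t1; rewrite lerN2 lef_pV2 ?posrE ?phi0//; last 2 first.
    - by rewrite (le_trans s0 st) t1.
    - by rewrite s0 (le_lt_trans st t1).
    exact: mphi.
  by move/(_ mV); apply: eq_bmeas => xi _; rewrite opprK.
have b1 : bmeas (fun xi : C => (1 - cabs z * cabs xi)^-1).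
  apply: (bmeas_nondecreasing (phi := fun t => (1 - t)^-1)) => // s t s0 st t1.
  by rewrite lef_pV2 ?posrE; lra.
pose L x := ps (fun k => (l k)%:C) x.
pose d := fun k => (diffcoef l k)%:C : C.
have rd : radius_ge 1 d.
  move=> r r01; have [|M1 H1] := radius_summable rl (_ : 0 <= r < 1) => //.
  have r0 : 0 <= r by case/andP : r01.
  have M10 : 0 <= M1 by apply: le_trans (H1 0); rewrite big_nil.
  have H k : cabs (l k)%:C * r ^+ k <= M1.
    apply: le_trans (H1 k.+1); rewrite big_nat_recr//= lerDr sumr_ge0// => i _.
    by rewrite mulr_ge0 ?cabs_ge0// exprn_ge0.
  exists (M1 + M1) => -[|k]; rewrite /d /diffcoef.
    by rewrite (le_trans (H 0))// lerDl.
  rewrite rmorphB; apply: (@le_trans _ _ ((cabs (l k.+1)%:C + cabs (l k)%:C) * r ^+ k.+1)).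
    by rewrite ler_wpM2r ?exprn_ge0// cabsB.
  rewrite mulrDl lerD//; apply: le_trans (H k); rewrite ler_wpM2l ?cabs_ge0//.
  by rewrite exprS ler_piMl ?exprn_ge0//; case/andP : r01 => _ /ltW.
pose g := fun _ : nat => 1 : C.
have rg : radius_ge 1 g.
  move=> r /andP[r0 r1]; exists 1 => k; rewrite /g ComplexField.Normc.normc1 mul1r.
  by rewrite exprn_ile1// ltW.
have dL (x : C) : cabs x < 1 -> ps d x = (1 - x) * L x.
  move=> x1; have [M1 H1] := ps_summable rl x1; have [M2 H2] := ps_summable rd x1.
  have H1' := abs_summableS H1.
  rewrite mulrBl mul1r /L /ps {1}(csumS H1) (csumS H2) -(csumZ _ H1).
  rewrite -[X in _ = _ + _ + X]mulN1r -(csumZ _ (abs_summableZ x H1)) -addrA.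
  rewrite -(csumD H1' (abs_summableZ (-1) (abs_summableZ x H1))).
  congr (_ + _); congr csum; apply/funext => k.
  by rewrite /d /diffcoef rmorphB exprS; ring.
have gL (x : C) : cabs x < 1 -> (1 - x) * ps g x = 1.
  move=> x1; have [M1 H1] := ps_summable rg x1.
  rewrite mulrBl mul1r /ps {1}(csumS H1) -(csumZ _ H1).
  rewrite /g expr0 mulr1; set c1 := csum _; set c2 := csum _.
  have -> : c1 = c2 by congr csum; apply/funext => k; rewrite exprS; ring.
  by rewrite addrK.
have [bg _] := ps_bar_meas rg zD; have [bd _] := ps_bar_meas rd zD; have [bL _] := ps_bar_meas rl zD.
have bgs : bmeas (fun xi => cabs (ps g (z * xi^*)) ^+ 2) by apply: bmeasX; exact: bmeas_cabs_comp.
have bds : bmeas (fun xi => cabs (ps d (z * xi^*)) ^+ 2) by apply: bmeasX; exact: bmeas_cabs_comp.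
have bG := bmeasM bp bgs; have bH := bmeasM bpV bds.
(* Both squares get the same bound: phi times 1 / (1 - t) here, and 1 / phi times phi^2 / (1 - t) in
   I2. *)
have I1 : dint v (fun xi => p xi * cabs (ps g (z * xi^*)) ^+ 2) <=
    dint v (fun xi => phi (cabs z * cabs xi) / (1 - cabs z * cabs xi)).
  apply: (bessel (B := fun t => (1 - t)^-1)) => //.
  - by move=> u xi u1 xiD; rewrite /p rinv.
  - by move=> xi xiD; exact: ltW (p0 xi xiD).
  - move=> N t /andP[t0 t1]; apply: (@le_trans _ _ (\sum_(0 <= k < N) t ^+ k)).
      apply: ler_sum => k _; rewrite /g ComplexField.Normc.normc1 expr1n mul1r.
      by rewrite ler_wiXn2l ?(ltW t1)// leq_pmull.
    by apply: geometric_sum_le; rewrite t0.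
have I2 : dint v (fun xi => (p xi)^-1 * cabs (ps d (z * xi^*)) ^+ 2) <=
    dint v (fun xi => phi (cabs z * cabs xi) / (1 - cabs z * cabs xi)).
  have bB : bmeas (fun xi => phi (cabs z * cabs xi) ^+ 2 / (1 - cabs z * cabs xi)).
    by apply: bmeasM => //; exact: bmeasX.
  have -> : dint v (fun xi => phi (cabs z * cabs xi) / (1 - cabs z * cabs xi)) =
    dint v (fun xi => (p xi)^-1 * (phi (cabs z * cabs xi) ^+ 2 / (1 - cabs z * cabs xi))).
    apply: eq_dint => xi xiD; rewrite mulrA expr2 mulKf// gt_eqF//; exact: p0.
  apply: (bessel (B := fun t => phi t ^+ 2 / (1 - t))) => //.
  - by move=> u xi u1 xiD; rewrite /p rinv.
  - by move=> xi xiD; rewrite invr_ge0 ltW// p0.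
  - move=> N t t01; apply: le_trans (Hd N t t01); apply: ler_sum => k _.
    by rewrite /d cabs_real real_normK// num_real.
have bsum : bmeas (fun xi => 2^-1 * (p xi * cabs (ps g (z * xi^*)) ^+ 2 +
   (p xi)^-1 * cabs (ps d (z * xi^*)) ^+ 2)).
  by apply: bmeasM; [exact: bmeas_cst|exact: bmeasD].
apply: (@le_trans _ _ (dint v (fun xi => 2^-1 * (p xi * cabs (ps g (z * xi^*)) ^+ 2 +
   (p xi)^-1 * cabs (ps d (z * xi^*)) ^+ 2)))); last first.
  rewrite (dintZ vw _ (bmeasD bG bH)) (dintD vw bG bH).
  rewrite ler_pdivrMl// mulr_natl mulr2n.
  exact: lerD I1 I2.
apply: dint_le => //; first exact: bmeas_cabs_comp.
move=> xi xiD; have x1 := zxC xi xiD; have q0 := p0 xi xiD.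
have -> : ps (fun k => (l k)%:C) (z * xi^*) = ps g (z * xi^*) * ps d (z * xi^*).
  by rewrite (dL _ x1) mulrA (mulrC (ps g _)) gL// mul1r.
rewrite cabsM; move: (cabs (ps g _)) (cabs (ps d _)) => A B.
have -> : 2^-1 * (p xi * A ^+ 2 + (p xi)^-1 * B ^+ 2) =
   A * B + 2^-1 * (p xi)^-1 * (p xi * A - B) ^+ 2 by field; rewrite gt_eqF.
by rewrite lerDl mulr_ge0 ?sqr_ge0// mulr_ge0// invr_ge0 ltW.
Qed.

(* Dyadic decomposition of |xi| < s by 1 - |xi| ~ 2^n (1 - s), run as an induction. *)
Lemma radial_growth_integral (psi : R -> R) (c g : R) : nondecreasing01 psi ->
  (forall t, 0 <= t < 1 -> 0 <= psi t) -> 0 < g -> 0 < c ->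
  (forall s, 0 <= s < 1 -> psi s * tail v (Num.max (2 * s - 1) 0) <= c / (1 - s) `^ g) ->
  exists2 c' : R, 0 < c' & forall s, 0 <= s < 1 ->
    dint v (fun xi => psi (s * cabs xi)) <= c' / (1 - s) `^ g.
Proof.
move=> mpsi psi0 g0 c0 H.
have G2 : 1 < (2 : R) `^ g.
  by have := gt0_ltr_powR g0; move=> /(_ 1 2); rewrite !nnegrE powR1 ler01 ler0n ltr1n; exact.
(* A solves A 2^(-g) + c = A, so the bound reproduces itself in the passage from 2 s - 1 to s. *)
pose A := c / (1 - ((2 : R) `^ g)^-1).
have i1 : 0 < 1 - ((2 : R) `^ g)^-1 by rewrite subr_gt0 invf_lt1//; lra.
have A0 : 0 < A by rewrite divr_gt0.
have AE : A * ((2 : R) `^ g)^-1 + c = A.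
  by rewrite -[in RHS](subrK (A * (2 `^ g)^-1) A) addrC -[in X in _ = X - _ + _](mulr1 A) -mulrBr divfK// gt_eqF.
pose ind (s : R) (xi : C) : R := 1 - (s <= cabs xi)%R%:R.
have bind s : bmeas (ind s) by apply: bmeasB; [exact: bmeas_cst|exact: bmeas_ge].
have bpsi s : 0 <= s < 1 -> bmeas (fun xi => psi (s * cabs xi)).
  by move=> s01; exact: bmeas_nondecreasing.
(* Only s moves in the induction; s', the argument of psi, stays fixed above it. The condition 1 <=
   2^n (1 - s) says that n doublings of 1 - s bring s down to 0. *)
have part n : forall s, 0 <= s < 1 -> 1 <= 2 ^+ n * (1 - s) -> forall s', s <= s' -> s' < 1 ->
    dint v (fun xi => ind s xi * psi (s' * cabs xi)) <= A / (1 - s) `^ g.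
  elim: n => [|n ih] s /[dup] s01 /andP[s0 s1] hn s' ss' s'1.
    have -> : s = 0 by move: hn; rewrite expr0 mul1r; lra.
    apply: (@le_trans _ _ (dint v (fun=> 0))).
      apply: dint_le => //; [apply: bmeasM => //; apply: bpsi; lra|exact: bmeas_cst|].
      by move=> xi _; rewrite /ind cabs_ge0 subrr mul0r.
    have -> : dint v (fun=> 0) = 0.
      by rewrite -[RHS](mul0r (dint v (fun=> 0))) -dintZ//; [rewrite mul0r|exact: bmeas_cst].
    by rewrite divr_ge0 ?(ltW A0) ?powR_ge0.
  pose r := Num.max (2 * s - 1) 0.
  have r01 : 0 <= r < 1 by rewrite /r le_max lexx orbT/= gt_max ltr01 andbT; lra.
  have rs : r <= s by rewrite /r ge_max s0 andbT; lra.
  have s'01 : 0 <= s' < 1 by rewrite (le_trans s0 ss') s'1.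
  have hr : 1 <= 2 ^+ n * (1 - r).
    rewrite /r; have [h|h] := leP (2 * s - 1) 0.
      by rewrite subr0 mulr1 exprn_ege1// ler1n.
    by apply: le_trans hn _; rewrite exprS le_eqVlt; apply/orP; left; apply/eqP; ring.
  have hP : dint v (fun xi => ind r xi * psi (s' * cabs xi)) <= A / (1 - r) `^ g.
    exact: ih r r01 hr s' (le_trans rs ss') s'1.
  (* Either 1 - r is exactly 2 (1 - s), or r = 0 and the region |xi| < r is empty. *)
  have r2 : (2 : R) `^ g * (1 - s) `^ g <= (1 - r) `^ g \/ r = 0 /\ dint v (fun xi => ind r xi * psi (s' * cabs xi)) <= 0.
    have [h|h] := leP (2 * s - 1) 0; [right|left].
      have rE : r = 0 by rewrite /r max_r.
      split => //; rewrite -[leRHS](mul0r (dint v (fun=> 0))) -dintZ//; last exact: bmeas_cst.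
      apply: dint_le => //; [by apply: bmeasM => //; exact: bpsi| |].
        by apply: bmeasM; exact: bmeas_cst.
      by move=> xi _; rewrite rE /ind cabs_ge0 subrr !mul0r.
    rewrite -powRM ?subr_ge0 ?(ltW s1)// ge0_ler_powR ?nnegrE ?(ltW g0)//; rewrite /r ?max_l ?(ltW h)//; lra.
  have S0 : 0 < (1 - s) `^ g by rewrite powR_gt0// subr_gt0.
  have hP' : dint v (fun xi => ind r xi * psi (s' * cabs xi)) <= A * (2 `^ g)^-1 / (1 - s) `^ g.
    case: r2 => [h|[_ h]]; last by apply: le_trans h _; rewrite !divr_ge0 ?mulr_ge0 ?invr_ge0 ?powR_ge0// ltW.
    apply: le_trans hP _; rewrite -mulrA -invfM ler_wpM2l ?(ltW A0)// lef_pV2// posrE; last first.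
      by rewrite mulr_gt0//; exact: lt_trans G2.
    by rewrite powR_gt0// subr_gt0; case/andP : r01.
  apply: (@le_trans _ _ (dint v (fun xi => ind r xi * psi (s' * cabs xi)) + psi s * tail v r)).
    rewrite /tail -dintZ//; last exact: bmeas_ge.
    rewrite -dintD//; [|by apply: bmeasM => //; exact: bpsi|by apply: bmeasM; [exact: bmeas_cst|exact: bmeas_ge]].
    apply: dint_le => //.
    - by apply: bmeasM => //; exact: bpsi.
    - apply: bmeasD; first by apply: bmeasM => //; exact: bpsi.
      by apply: bmeasM; [exact: bmeas_cst|exact: bmeas_ge].
    - move=> xi xiD; rewrite /ind.
      have x01 : 0 <= s' * cabs xi < 1.
        have /andP[a1 a2] := s'01; rewrite mulr_ge0 ?cabs_ge0//=; apply: le_lt_trans a2.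
        by rewrite ler_piMr//; exact: ltW.
      have px := psi0 _ x01; have ps0 := psi0 s s01.
      have [h1|h1] := leP s (cabs xi).
        by rewrite (le_trans rs h1) subrr !mul0r add0r mulr1.
      have [h2|h2] := leP r (cabs xi); last by rewrite mulr0 addr0.
      rewrite subrr subr0 mul0r mul1r add0r mulr1; apply: mpsi => //; first by case/andP : x01.
      by apply: le_trans (ltW h1); rewrite ler_piMl ?cabs_ge0//; case/andP : s'01 => _ /ltW.
  apply: le_trans (lerD hP' (H s s01)) _; rewrite -mulrDl AE.
  by rewrite lexx.
exists (A + c); first by rewrite addr_gt0.
move=> s /[dup] s01 /andP[s0 s1].
have [n hn] : exists n, 1 <= 2 ^+ n * (1 - s).
  have [m Hm] : exists m : nat, (1 - s)^-1 <= m%:R.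
    by exists (Num.truncn (1 - s)^-1).+1; apply/ltW/truncnS_gt.
  exists m; rewrite -ler_pdivrMr ?subr_gt0// mul1r; apply: (le_trans Hm).
  by rewrite -natrX ler_nat ltnW// ltn_expl.
have h1 := part n s s01 hn s (lexx s) s1.
have h2 : psi s * tail v s <= c / (1 - s) `^ g.
  apply: le_trans (H s s01); rewrite ler_wpM2l ?psi0//; apply: (tail_le vw).
  by rewrite ge_max s0 andbT; lra.
rewrite mulrDl; apply: le_trans (lerD h1 h2).
rewrite /tail -dintZ//; last exact: bmeas_ge.
rewrite -dintD//; [|by apply: bmeasM => //; exact: bpsi|by apply: bmeasM; [exact: bmeas_cst|exact: bmeas_ge]].
apply: dint_le => //; [exact: bpsi| |].
  apply: bmeasD; first by apply: bmeasM => //; exact: bpsi.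
  by apply: bmeasM; [exact: bmeas_cst|exact: bmeas_ge].
move=> xi xiD; rewrite /ind; have [h|h] := leP s (cabs xi).
  rewrite subrr mul0r add0r mulr1; apply: mpsi => //; first by rewrite mulr_ge0// cabs_ge0.
  by rewrite ler_piMr//; exact: ltW.
by rewrite subr0 mul1r mulr0 addr0.
Qed.

End fixed_weight.
End KernelEstimate.

(** * Bloch functions *)

Section BlochTaylor.
Context {R : realType}.
Local Notation C := R[i].

Lemma disc0 : disc (0 : C).
Proof. by rewrite /disc/mkset ComplexField.Normc.normc0. Qed.

Lemma bloch_normE (f : C -> C) (B : R) :
  (forall z, disc z -> (1 - cabs z ^+ 2) * cabs (derive1 f z) <= B) ->
  (bloch_norm f <= (B + cabs (f 0))%:E)%E.
Proof.
move=> H; rewrite /bloch_norm EFinD leeD2r//; apply: ge_ereal_sup => _ [z zD <-].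
by rewrite lee_fin H.
Qed.

Lemma bloch_deriv_bound (h : C -> C) : Bloch h -> exists2 B : R, 0 <= B &
  forall z, disc z -> (1 - cabs z ^+ 2) * cabs (derive1 h z) <= B.
Proof.
case=> _; rewrite /bloch_norm; set S := [set _ | _ in _].
have S0 : (((1 - cabs (0 : C) ^+ 2) * cabs (derive1 h 0))%:E <= ereal_sup S)%E.
  by apply: ereal_sup_ubound; exists 0 => //; exact: disc0.
case: (ereal_sup S) S0 (@ereal_sup_ubound _ S) => [b| |].
- move=> S0 Sb _; exists b.
    move: S0; rewrite lee_fin; apply: le_trans; rewrite ComplexField.Normc.normc0 expr0n/= subr0 mul1r.
    exact: cabs_ge0.
  by move=> z zD; rewrite -lee_fin; apply: Sb; exists z.
- by move=> _ _; rewrite addye.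
- by move=> h1 _; have := lt_le_trans (ltNyr _) h1; rewrite ltxx.
Qed.

Lemma cderiv_dilation (h : C -> C) (s : R) (z d : C) : 0 <= s <= 1 ->
  cderiv h (s%:C * z) d -> cderiv (fun x => h (s%:C * x)) z (s%:C * d).
Proof.
move=> /andP[s0 s1] hd e e0; have [del del0 H] := hd e e0; exists del => // w wd.
have sw : cabs (s%:C * w) <= cabs w.
  by rewrite cabsM cabs_ge0_real// ler_piMl ?cabs_ge0.
rewrite mulrDr -mulrA (mulrCA s%:C) (mulrA d) (mulrC d) -(mulrA _ d) (mulrCA _ d).
by apply: le_trans (H _ (le_lt_trans sw wd)) _; rewrite ler_wpM2l// ltW.
Qed.

(** h' may blow up at the circle, so the expansion is applied to the dilation x -> h(s x), whose
    derivative is bounded. This reaches the radius s^2, which exceeds r for s = (1 + r) / 2.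
    Identification with Taylor coefficients makes the expansions for different s agree. *)
Let bloch_taylor_local (h : C -> C) (r : R) : Bloch h -> 0 <= r < 1 ->
  exists2 rho : R, r < rho & radius_ge rho (taylor_coef h) /\
    forall z, cabs z < rho -> h z = ps (taylor_coef h) z.
Proof.
move=> hB /andP[r0 r1]; have [B B0 HB] := bloch_deriv_bound hB; case: hB => ha _.
pose s : R := (1 + r) / 2.
have s0 : 0 < s by rewrite /s; lra.
have s1 : s < 1 by rewrite /s; lra.
have sC : s%:C != 0 by apply/eqP => -[] h0; move: s0; rewrite h0 ltxx.
have szE (z : C) : cabs (s%:C * z) = s * cabs z by rewrite cabsM (cabs_ge0_real (ltW s0)).
have sz (z : C) : disc z -> cabs (s%:C * z) <= s.
  by move=> zD; rewrite szE ler_piMr ?(ltW s0)//; exact: ltW.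
have ss : 0 < 1 - s ^+ 2 by nra.
have [||a ra Ha] := @cauchy_taylor R (fun x => h (s%:C * x))
    (fun x => s%:C * derive1 h (s%:C * x)) (B / (1 - s ^+ 2)) s _ _ ltac:(by rewrite s0 s1).
- move=> z zD; apply: cderiv_dilation; first by rewrite !ltW.
  by apply: analytic_cderiv => //; exact: le_lt_trans (sz z zD) s1.
- move=> z zD; rewrite szE ler_pdivlMr//.
  have D' : disc (s%:C * z) by exact: le_lt_trans (sz z zD) s1.
  apply: le_trans (HB _ D'); have d0 := cabs_ge0 (derive1 h (s%:C * z)).
  have h1 : cabs (s%:C * z) ^+ 2 <= s ^+ 2 by rewrite lerXn2r ?nnegrE ?cabs_ge0 ?(ltW s0) ?sz.
  apply: (@le_trans _ _ (cabs (derive1 h (s%:C * z)) * (1 - s ^+ 2))).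
    by rewrite ler_wpM2r ?(ltW ss)// ler_piMl// ltW.
  by rewrite mulrC ler_wpM2r// lerD2l lerN2.
pose b k := a k * s%:C^-1 ^+ k.
have rb : radius_ge (s ^+ 2) b.
  move=> q /andP[q0 q1]; have [|M HM] := ra (q / s).
    by rewrite divr_ge0 ?(ltW s0)//= ltr_pdivrMr// -expr2.
  exists M => k; apply: le_trans (HM k).
  by rewrite /b cabsM cabsX cabsV (cabs_ge0_real (ltW s0)) -mulrA -exprMn (mulrC q).
have hb z : cabs z < s ^+ 2 -> h z = ps b z.
  move=> zs; have zs' : cabs (s%:C^-1 * z) < s.
    by rewrite cabsM cabsV (cabs_ge0_real (ltW s0)) ltr_pdivrMl// -expr2.
  have -> : h z = h (s%:C * (s%:C^-1 * z)) by rewrite mulVKf.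
  rewrite (Ha _ zs'); congr csum; apply/funext => k.
  by rewrite /b exprMn mulrA.
have s20 : 0 < s ^+ 2 by rewrite exprn_gt0.
have tE : taylor_coef h = b by apply/funext => k; exact: taylor_coefE s20 rb hb.
exists (s ^+ 2); first by rewrite /s; nra.
by rewrite tE.
Qed.

Lemma bloch_radius (h : C -> C) : Bloch h -> radius_ge 1 (taylor_coef h).
Proof.
move=> hB r r01; have [rho rr [h1 _]] := bloch_taylor_local hB r01.
by apply: h1; rewrite rr; case/andP : r01 => ->.
Qed.

Lemma bloch_taylor (h : C -> C) (z : C) : Bloch h -> disc z -> h z = ps (taylor_coef h) z.
Proof.
move=> hB zD; have [|rho rr [_ ->//]] := bloch_taylor_local hB (_ : 0 <= cabs z < 1).
by rewrite cabs_ge0.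
Qed.

End BlochTaylor.

(** * Bloch norm of the projection of a bounded function *)

Section BoundedProjection.
Context {R : realType}.
Local Notation C := R[i].
Local Notation MR := (measurableTypeR R).

Lemma ccvgJ (x : nat -> C) (l : C) : x @ \oo --> l -> (fun n => (x n)^*) @ \oo --> l^*.
Proof.
move=> /cvgCP h; apply/cvgCP.
by rewrite (_ : (fun n => _) = (fun n => cabs (x n - l)))//; apply/funext => n; rewrite -rmorphB/= cabsJ.
Qed.

Lemma ps_conj (l : nat -> R) (z : C) : radius_ge 1 (fun k => (l k)%:C) -> disc z ->
  (ps (fun k => (l k)%:C) z)^* = ps (fun k => (l k)%:C) z^*.
Proof.
move=> rl zD; apply/esym/csumE.
have -> : series (fun k => (l k)%:C * z^* ^+ k) = (fun n => (series (fun k => (l k)%:C * z ^+ k) n)^*).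
  apply/funext => n; rewrite /series/= (rmorph_sum (@conjc R)); apply: eq_bigr => k _.
  by rewrite rmorphM rmorphXn /= oppr0.
exact: ccvgJ (ps_cvg rl zD).
Qed.

Section fixed_weight.
Variable v : C -> R.
Hypothesis vw : weight v.

(** For fixed z the partial sums are bounded uniformly in xi, so integration is termwise and
    produces a power series in z. *)
Lemma cint_ps_bar (l : nat -> C) (f : C -> C) (z : C) : radius_ge 1 l -> cbmeas f -> disc z ->
  cint v (fun xi => f xi * ps l (z * xi^*)) = ps (fun k => l k * cint v (fun xi => f xi * xi^* ^+ k)) z.
Proof.
move=> rl bf zD; have [A fA] := cbmeas_bound bf.
have A0 : 0 <= A := le_trans (cabs_ge0 _) (fA 0 disc0).
have [bps [M HM]] := ps_bar_meas vw rl zD.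
have bX k : cbmeas (fun xi => f xi * xi^* ^+ k).
  by apply: cbmeasM => //; apply: cbmeasX; exact: cbmeasJ cbmeas_id.
apply/esym/csumE.
have [|||_] := @bounded_ccvg _ v vw (fun n xi => f xi * \sum_(0 <= k < n) l k * (z * xi^*) ^+ k)
  (fun xi => f xi * ps l (z * xi^*)) (A * M).
- move=> n; apply: cbmeasM => //; apply: cbmeas_sum => k; apply: cbmeasM; first exact: cbmeas_cst.
  by apply: cbmeasX; apply: cbmeasM; [exact: cbmeas_cst|exact: cbmeasJ cbmeas_id].
- by move=> n xi xiD; rewrite cabsM ler_pM ?cabs_ge0 ?fA ?HM.
- move=> xi xiD; apply: ccvgMl; apply: (ps_cvg rl); rewrite cabsM cabsJ.
  by apply: le_lt_trans zD; rewrite ler_piMr ?cabs_ge0//; exact: ltW.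
apply: eq_ccvg => n; rewrite /series/=.
rewrite -(eq_cint v (F := fun xi => \sum_(0 <= k < n) (l k * z ^+ k) * (f xi * xi^* ^+ k))); last first.
  by move=> xi _; rewrite mulr_sumr; apply: eq_bigr => k _; rewrite exprMn; ring.
rewrite cint_sum//; last by move=> k; apply: cbmeasM => //; exact: cbmeas_cst.
by apply: eq_bigr => k _; rewrite cintZ// mulrAC.
Qed.

Lemma radius_cint (l : nat -> C) (f : C -> C) : radius_ge 1 l -> cbmeas f ->
  radius_ge 1 (fun k => l k * cint v (fun xi => f xi * xi^* ^+ k)).
Proof.
move=> rl bf; apply: (radius_le (A := dint v (fun xi => cabs (f xi))) rl) => k.
rewrite cabsM mulrC ler_wpM2r ?cabs_ge0//.
have bX : cbmeas (fun xi => f xi * xi^* ^+ k).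
  by apply: cbmeasM => //; apply: cbmeasX; exact: cbmeasJ cbmeas_id.
apply: le_trans (cabs_cint vw bX) _; apply: dint_le => //; [exact: bmeas_cabs_comp|exact: bmeas_cabs_comp|].
move=> xi xiD; rewrite cabsM cabsX cabsJ ler_piMr ?cabs_ge0// exprn_ile1 ?cabs_ge0//.
exact: ltW.
Qed.

Lemma cabs_cint_le (f g : C -> C) (A : R) : cbmeas f -> cbmeas g ->
  (forall xi, disc xi -> cabs (f xi) <= A) ->
  cabs (cint v (fun xi => f xi * g xi)) <= A * dint v (fun xi => cabs (g xi)).
Proof.
move=> bf bg fA; apply: le_trans (cabs_cint vw (cbmeasM bf bg)) _.
have bcg := bmeas_cabs_comp bg.
rewrite -(dintZ vw)//; apply: dint_le => //; first by apply: bmeas_cabs_comp; exact: cbmeasM.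
  by apply: bmeasM => //; exact: bmeas_cst.
by move=> xi xiD; rewrite cabsM ler_wpM2r ?cabs_ge0 ?fA.
Qed.

End fixed_weight.

Section fixed_classD.
Variable w : C -> R.
Hypothesis hw : classD w.
Let ww := classD_weight hw.
Let wr := classD_radial hw.

Let minv k := ((moment w k)^-1)%:C.
Let l k : R := k.+1%:R / moment w k.+1.

Let rl : radius_ge 1 (fun k => (l k)%:C).
Proof.
apply: (radius_le (A := 1) (radius_natS (radius_shift (radius_moment_inv hw)))) => k.
by rewrite mul1r /l !cabsM cabs_nat !cabs_real normrM normr_nat.
Qed.

(** phi, a multiple of 1 / tail, controls the square sums of the differenced coefficients.
    [radial_growth_integral] at exponent 1 then asks that phi(s) tail(2 s - 1) be bounded, which is
    tail doubling. *)
Lemma kernel_deriv_integral : exists2 c : R, 0 < c & forall z, disc z ->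
  dint w (fun xi => cabs (ps (fun k => (l k)%:C) (z * xi^*))) <= c / (1 - cabs z).
Proof.
have [c1 c10 H1] := kernel_deriv_diffcoef hw.
have [c2 c20 H2] := sum_moment_inv_sqr hw.
have [c3 c30 H3] := tail_doubling hw.
pose phi t : R := c1 * c2 / tail w t.
have c12 : 0 < c1 * c2 by rewrite mulr_gt0.
have phi0 t : 0 <= t < 1 -> 0 < phi t by move=> t01; rewrite divr_gt0// tail_gt0.
have mphi : nondecreasing01 phi.
  move=> s t s0 st t1; rewrite /phi ler_wpM2l ?(ltW c12)//.
  rewrite lef_pV2 ?posrE ?tail_gt0//; [exact: tail_le|by rewrite s0 (le_lt_trans st)|].
  by rewrite (le_trans s0 st).
have [|||||c c0 H] := @radial_growth_integral _ w ww (fun t => phi t / (1 - t)) (c1 * c2 * c3) 1.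
- move=> s t s0 st t1; have p1 := mphi s t s0 st t1.
  have p0 : 0 < phi s by apply: phi0; rewrite s0 (le_lt_trans st).
  rewrite ler_pM ?(ltW p0) ?invr_ge0//; first by lra.
  by rewrite lef_pV2 ?posrE; lra.
- move=> t t01; rewrite divr_ge0 ?(ltW (phi0 t t01))//; by case/andP : t01 => _; lra.
- by [].
- by rewrite mulr_gt0//; lra.
- move=> s /[dup] s01 /andP[s0 s1]; rewrite powRr1; last by lra.
  have Ts : 0 < tail w s by exact: tail_gt0.
  rewrite mulrAC ler_wpM2r ?invr_ge0//; first by lra.
  rewrite /phi mulrAC ler_pdivrMr// -(mulrA _ c3) ler_wpM2l ?(ltW c12)//.
  set r := Num.max _ _.
  have r01 : 0 <= r < 1 by rewrite /r le_max lexx orbT/= gt_max ltr01 andbT; lra.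
  apply: le_trans (H3 r r01) _; rewrite ler_wpM2l//; first by lra.
  apply: tail_le => //; have : 2 * s - 1 <= r by rewrite /r le_max lexx.
  lra.
exists c => // z zD; have z01 : 0 <= cabs z < 1 by rewrite cabs_ge0.
have := H _ z01; rewrite powRr1; last by rewrite subr_ge0 ltW.
apply: le_trans; apply: kernel_estimate => // N t t01.
apply: (@le_trans _ _ (c1 ^+ 2 * \sum_(0 <= k < N) ((moment w k.+1)^-1) ^+ 2 * t ^+ (2 * k))).
  rewrite mulr_sumr; apply: ler_sum => k _; rewrite mulrA ler_wpM2r//.
    by rewrite exprn_ge0//; case/andP : t01.
  rewrite -exprMn -[X in X ^+ 2 <= _]/(diffcoef l k) -(real_normK (num_real (diffcoef l k))).
  rewrite lerXn2r ?nnegrE ?H1//.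
  by rewrite mulr_ge0 ?(ltW c10)// invr_ge0 ltW// moment_gt0.
apply: le_trans (ler_wpM2l (sqr_ge0 c1) (H2 N t t01)) _.
by rewrite mulrA -exprMn mulrA lexx.
Qed.

Section bounded_function.
Variables (f : C -> C) (A : R).
Hypotheses (bf : cbmeas f) (fA : forall xi, disc xi -> cabs (f xi) <= A).

Let Pf z := cint w (fun xi => f xi * ps minv (z * xi^*)).
Let p k := minv k * cint w (fun xi => f xi * xi^* ^+ k).

Let rp : radius_ge 1 p.
Proof. by apply: radius_cint => //; exact: radius_moment_inv. Qed.

Let PfE z : disc z -> Pf z = ps p z.
Proof. by move=> zD; apply: cint_ps_bar => //; exact: radius_moment_inv. Qed.

Let Pf_cderiv z : disc z -> cderiv Pf z (ps (dcoef p) z).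
Proof. by move=> zD; apply: (cderiv_congr PfE zD); exact: ps_deriv rp zD. Qed.

Lemma bounded_proj_analytic : analytic Pf.
Proof. by move=> z zD; have /cderivP[] := Pf_cderiv zD. Qed.

(** 1 - |z|^2 <= 2 (1 - |z|) cancels the growth of the kernel mean and gives 2 c; the 1 accounts for
    |Pf 0| <= A. Differentiating the series leaves an extra conj(xi), of modulus at most 1. *)
Lemma bounded_proj_bloch c : (forall z, disc z ->
  dint w (fun xi => cabs (ps (fun k => (l k)%:C) (z * xi^*))) <= c / (1 - cabs z)) ->
  (bloch_norm Pf <= ((2 * c + 1) * A)%:E)%E.
Proof.
move=> Hc; have A0 : 0 <= A := le_trans (cabs_ge0 _) (fA disc0).
have -> : (2 * c + 1) * A = 2 * c * A + A by ring.
apply: (@le_trans _ _ ((2 * c * A + cabs (Pf 0))%:E)); last first.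
  rewrite lee_fin lerD2l PfE ?(ps0 _ rp) ?ltr01//; last exact: disc0.
  have m0 := moment_gt0 hw 0.
  rewrite cabsM cabs_real ger0_norm ?invr_ge0 ?(ltW m0)// ler_pdivrMl//.
  rewrite moment_classD// mulrC; under [X in A * X]eq_dint do rewrite expr0.
  have := cabs_cint_le ww bf (cbmeas_cst 1) fA.
  by under [X in _ <= _ * X]eq_dint do rewrite ComplexField.Normc.normc1.
apply: bloch_normE => z zD; rewrite (cderiv_derive1 (Pf_cderiv zD)).
have z1 : 0 < 1 - cabs z by rewrite subr_gt0.
have bJ : cbmeas (fun xi => f xi * xi^*) by apply: cbmeasM => //; exact: cbmeasJ cbmeas_id.
have -> : ps (dcoef p) z = cint w (fun xi => (f xi * xi^*) * ps (fun k => (l k)%:C) (z * xi^*)).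
  rewrite (cint_ps_bar ww rl bJ zD); congr ps; apply/funext => k.
  rewrite /dcoef /p /minv /l mulrA; congr (_ * _); last first.
    by apply: eq_cint => xi _; rewrite exprS mulrA.
  by rewrite rmorphM rmorph_nat.
have [bps _] := ps_bar_meas ww rl zD.
have h := cabs_cint_le ww bJ bps (A := A) _.
apply: (@le_trans _ _ ((2 * (1 - cabs z)) * (A * (c / (1 - cabs z))))).
  apply: ler_pM; rewrite ?cabs_ge0//.
  - by have := cabs_ge0 z; nra.
  - by have := cabs_ge0 z; nra.
  - apply: le_trans (h _) _; last by rewrite ler_wpM2l// Hc.
    move=> xi xiD; rewrite cabsM cabsJ -[leRHS]mulr1 ler_pM ?cabs_ge0 ?fA//; exact: ltW.
by rewrite le_eqVlt; apply/orP; left; apply/eqP; field; rewrite gt_eqF.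
Qed.

End bounded_function.
End fixed_classD.
End BoundedProjection.

(** * The Bergman projection of bounded functions *)

Section EssentiallyBounded.
Context {R : realType}.
Local Notation C := R[i].
Local Notation MR := (measurableTypeR R).
Local Notation E := (MR * MR)%type.

Lemma eq_cintegral (F G : C -> C) : (forall z, disc z -> F z = G z) ->
  cintegral F = cintegral G.
Proof.
move=> FG; rewrite /cintegral /Rintegral.
by congr (fine _ +i* fine _); apply: eq_integral => p; rewrite inE => pD; rewrite FG.
Qed.

Lemma eq_bloch_norm (f g : C -> C) : f 0 = g 0 ->
  (forall z, disc z -> derive1 f z = derive1 g z) -> bloch_norm f = bloch_norm g.
Proof.
move=> fg0 fg; rewrite /bloch_norm.
apply: congr2; last by rewrite fg0.
apply: congr1.
apply: eq_imagel => z zD.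
by rewrite fg.
Qed.

Lemma Linfty_norm_ge0 (F : C -> C) : (0 <= Linfty_norm F)%E.
Proof.
apply: ess_sup_gee; last first.
  by apply/aeW => p; rewrite /patch; case: ifPn => // _; rewrite lee_fin cabs_ge0.
(* A lower bound for an essential supremum needs a space of positive measure; the plane has infinite
   [dA] measure. *)
rewrite -setXTT (_ : dA _ = (pi^-1)%:E *
  (@lebesgue_measure R \x @lebesgue_measure R) (setT `*` setT))%E//.
rewrite product_measure1E//.
have h : @lebesgue_measure R setT = +oo%E.
  by rewrite -set_itvNyy lebesgue_measure_itv.
rewrite [X in (_ * X)%E](_ : _ = (+oo * +oo)%E); last by congr (_ * _)%E; exact: h.
by rewrite mulyy gt0_muley ?ltry// lte_fin invr_gt0 pi_gt0.
Qed.

Lemma Linfty_bounded (F : C -> C) (M : R) : cbmeas F ->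
  (forall xi, disc xi -> cabs (F xi) <= M) -> Linfty F.
Proof.
move=> [[m1 _] [m2 _]] FM; split => //; apply: (@le_lt_trans _ _ `|M|%:E); last exact: ltry.
apply/ess_supP; apply/aeW => p; rewrite /patch; case: ifPn => [|_]; last by rewrite lee_fin.
by rewrite inE => pD; rewrite lee_fin (le_trans (FM _ pD)) ?ler_norm.
Qed.

(** Cutting F to 0 where |F| exceeds its norm alters it on a null subset of the disc and makes it
    bounded at every point, the setting of the integrals above. *)
Lemma Linfty_representative (F : C -> C) : Linfty F -> exists f (A : R),
  [/\ cbmeas f, forall xi, cabs (f xi) <= A, Linfty_norm F = A%:E &
    forall v G, weight v -> cbmeas G ->
      cintegral (fun xi => F xi * G xi * (v xi)%:C) = cint v (fun xi => f xi * G xi)].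
Proof.
move=> [mRe mIm Foo].
have F0 := Linfty_norm_ge0 F; pose A := fine (Linfty_norm F).
have AE : Linfty_norm F = A%:E by rewrite /A fineK// ge0_fin_numE.
have A0 : 0 <= A by rewrite -lee_fin -AE.
pose ind xi : R := (0 <= A - cabs (F xi))%R%:R.
have mF : measurable_fun disc2 (fun p : E => cabs (F (ofR2 p)) : MR).
  apply: (eq_measurable_fun (fun p : E => Num.sqrt
    (complex.Re (F (ofR2 p)) ^+ 2 + complex.Im (F (ofR2 p)) ^+ 2))).
    by move=> p _; case: (F _).
  apply: measurableT_comp; first exact: measurable_sqrt.
  by apply: measurable_funD; apply: measurable_funX.
have mind : measurable_fun disc2 (fun p : E => ind (ofR2 p) : MR).
  apply: (measurableT_comp (f := fun s : MR => (0 <= s)%R%:R : MR)).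
    apply: nondecreasing_measurable; first exact: measurableT.
    move=> s t st; case: (leP 0 s) => rs; last by rewrite ler0n.
    by rewrite (le_trans rs st).
  by apply: measurable_funB.
pose f xi := F xi * (ind xi)%:C.
have fA xi : cabs (f xi) <= A.
  rewrite /f /ind subr_ge0; case: (leP (cabs (F xi)) A) => h; first by rewrite (_ : _%:C = 1)// mulr1.
  by rewrite (_ : _%:C = 0)// mulr0 ComplexField.Normc.normc0.
have mfR : measurable_fun disc2 (fun p : E => complex.Re (f (ofR2 p)) : MR).
  by rewrite /f; under eq_fun do rewrite cRe_scale; exact: measurable_funM.
have mfI : measurable_fun disc2 (fun p : E => complex.Im (f (ofR2 p)) : MR).
  by rewrite /f; under eq_fun do rewrite cIm_scale; exact: measurable_funM.
exists f, A; split => //.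
  split; split => //; exists A => z _; apply: le_trans (fA z); [exact: Re_le_cabs|exact: Im_le_cabs].
move=> v G [_ vi] [[mG1 _] [mG2 _]].
have mv : measurable_fun disc2 (fun p : E => v (ofR2 p) : MR).
  by apply/measurable_EFinP; exact: measurable_int vi.
have aeF : \forall p \ae dA, disc2 p -> f (ofR2 p) = F (ofR2 p).
  have := ess_sup_ge dA ((fun p : E => (cabs (F (ofR2 p)))%:E) \_ disc2).
  rewrite -/(Linfty_norm F) AE; apply: filterS => p h pD; move: h.
  by rewrite /patch mem_set// lee_fin /f /ind subr_ge0 => ->; rewrite (_ : _%:C = 1)// mulr1.
rewrite /cintegral /cint /dint /Rintegral; congr (fine _ +i* fine _); apply: ae_eq_integral.
- exact: measurable_disc2.
- apply/measurable_EFinP; under eq_fun do rewrite cRe_scale cReM.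
  by apply: measurable_funM => //; apply: measurable_funB; exact: measurable_funM.
- apply/measurable_EFinP; under eq_fun do rewrite cReM.
  by apply: measurable_funM => //; apply: measurable_funB; exact: measurable_funM.
- by apply: filterS aeF => p h /h ->; rewrite cRe_scale.
- exact: measurable_disc2.
- apply/measurable_EFinP; under eq_fun do rewrite cIm_scale cImM.
  by apply: measurable_funM => //; apply: measurable_funD; exact: measurable_funM.
- apply/measurable_EFinP; under eq_fun do rewrite cImM.
  by apply: measurable_funM => //; apply: measurable_funD; exact: measurable_funM.
- by apply: filterS aeF => p h /h ->; rewrite cIm_scale.
Qed.

End EssentiallyBounded.

(** * The projection on essentially bounded functions *)

Section BergmanProjection.
Context {R : realType}.
Local Notation C := R[i].
Variable w : C -> R.
Hypothesis hw : classD w.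
Let ww := classD_weight hw.
Local Notation minv := (fun k => ((moment w k)^-1)%:C).

Lemma bergman_kernelJ (z xi : C) : disc z -> disc xi ->
  (bergman_kernel w z xi)^* = ps minv (z * xi^*).
Proof.
move=> zD xiD; have zx : disc (z^* * xi).
  by rewrite /disc/mkset cabsM cabsJ; apply: le_lt_trans zD; rewrite ler_piMr ?cabs_ge0//; exact: ltW.
have := ps_conj (radius_moment_inv hw) zx.
by rewrite rmorphM/= conjcK.
Qed.

Lemma bergman_proj_representative (F : C -> C) : Linfty F -> exists f (A : R),
  [/\ cbmeas f, forall xi, cabs (f xi) <= A, Linfty_norm F = A%:E,
    (forall k, cintegral (fun xi => F xi * xi^* ^+ k * (w xi)%:C) = cint w (fun xi => f xi * xi^* ^+ k)) &
    forall z, disc z -> bergman_proj w F z = cint w (fun xi => f xi * ps minv (z * xi^*))].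
Proof.
move=> FL; have [f [A [bf fA FA H]]] := Linfty_representative FL.
exists f, A; split => //.
  by move=> k; apply: H => //; apply: cbmeasX; exact: cbmeasJ cbmeas_id.
move=> z zD; have [bps _] := ps_bar_meas ww (radius_moment_inv hw) zD.
rewrite -H//; apply: eq_cintegral => xi xiD; congr (_ * _ * _).
exact: bergman_kernelJ.
Qed.

Lemma bergman_proj_bounded : exists M : R, forall F : C -> C, Linfty F ->
  Bloch (bergman_proj w F) /\ (bloch_norm (bergman_proj w F) <= M%:E * Linfty_norm F)%E.
Proof.
have [c c0 Hc] := kernel_deriv_integral hw.
exists (2 * c + 1) => F FL.
have [f [A [bf fA FA _ H]]] := bergman_proj_representative FL.
pose Pf z := cint w (fun xi => f xi * ps minv (z * xi^*)).
have fA' xi : disc xi -> cabs (f xi) <= A by [].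
have aP : analytic Pf := bounded_proj_analytic hw bf.
have dP z : disc z -> cderiv (bergman_proj w F) z (derive1 Pf z).
  by move=> zD; apply: (cderiv_congr H zD); exact: analytic_cderiv.
have bE : bloch_norm (bergman_proj w F) = bloch_norm Pf.
  by apply: eq_bloch_norm => [|z zD]; [exact: H disc0|exact: cderiv_derive1 (dP z zD)].
have := bounded_proj_bloch hw bf fA' Hc; rewrite -/Pf => hP.
have hA : analytic (bergman_proj w F) by move=> z zD; have /cderivP[] := dP z zD.
have hN : (bloch_norm (bergman_proj w F) <= (2 * c + 1)%:E * Linfty_norm F)%E.
  by rewrite bE FA.
have hF : (bloch_norm (bergman_proj w F) < +oo)%E.
  by rewrite bE; exact: le_lt_trans hP (ltry _).
exact: (conj (conj hA hF) hN).
Qed.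

(** The projection sees F only through its moments against conj(xi)^k, and the 1 / m_k in the kernel
    cancels the factor m_k. *)
Lemma bergman_proj_coef (F : C -> C) (c : nat -> C) (z : C) : Linfty F -> disc z ->
  (forall k, cintegral (fun xi => F xi * xi^* ^+ k * (w xi)%:C) = (moment w k)%:C * c k) ->
  bergman_proj w F z = ps c z.
Proof.
move=> FL zD Hc; have [f [A [bf fA FA HX H]]] := bergman_proj_representative FL.
rewrite H// (cint_ps_bar ww (radius_moment_inv hw) bf zD); congr ps; apply/funext => k.
rewrite -HX Hc mulrA -rmorphM mulVf ?mul1r// gt_eqF//; exact: moment_gt0.
Qed.

End BergmanProjection.

(** * The multiplier of a Bloch function *)

Section DilatedSeries.
Context {R : realType}.
Local Notation C := R[i].
Local Notation MR := (measurableTypeR R).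

Section fixed_weight.
Variable v : C -> R.
Hypotheses (vw : weight v) (vr : radial v).

(** Conjugating the coefficients reduces this to [ps_bar_meas] at the point rho. *)
Lemma ps_dilation_meas (e : nat -> C) (rho : R) : radius_ge 1 e -> 0 <= rho < 1 ->
  cbmeas (fun xi => ps e (rho%:C * xi)).
Proof.
move=> re /andP[r0 r1]; have rD : disc (rho%:C : C) by rewrite /disc/mkset cabs_ge0_real.
have rJ : radius_ge 1 (fun k => (e k)^*).
  by apply: (radius_le (A := 1) re) => k; rewrite cabsJ mul1r.
have [b _] := ps_bar_meas vw rJ rD.
apply: eq_cbmeas (cbmeasJ b) => xi xiD.
have x1 : disc (rho%:C * xi^*).
  by rewrite /disc/mkset cabsM cabsJ; apply: le_lt_trans rD; rewrite ler_piMr ?cabs_ge0//; exact: ltW.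
apply/esym/csumE.
have -> : series (fun k => e k * (rho%:C * xi) ^+ k) =
    (fun n => (series (fun k => (e k)^* * (rho%:C * xi^*) ^+ k) n)^*).
  apply/funext => n; rewrite /series/= (rmorph_sum (@conjc R)); apply: eq_bigr => k _.
  by rewrite rmorphM rmorphXn/= rmorphM/= !conjcK oppr0.
exact: ccvgJ (ps_cvg rJ x1).
Qed.

(** For rho < 1 the series converges uniformly on the disc, and orthogonality keeps its k-th term
    alone: the integrals of the partial sums are constant from n = k + 1 on. *)
Lemma cint_dilated_series (e : nat -> C) (phi : C -> R) (rho : R) k : radius_ge 1 e ->
  bmeas phi -> (forall u xi, cabs u = 1 -> disc xi -> phi (u * xi) = phi xi) -> 0 <= rho < 1 ->
  cint v (fun xi => (phi xi)%:C * ps e (rho%:C * xi) * xi^* ^+ k) =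
  e k * (rho ^+ k)%:C * (dint v (fun xi => phi xi * cabs xi ^+ (2 * k)))%:C.
Proof.
move=> re bphi phir /andP[r0 r1]; have [_ [N0 HN0]] := bphi.
have [|M HM] := radius_summable re (_ : 0 <= rho < 1); first by rewrite r0.
have bJ : cbmeas (fun xi : C => xi^* ^+ k) by apply: cbmeasX; exact: cbmeasJ cbmeas_id.
have bC := cbmeas_real bphi.
pose S n (xi : C) := \sum_(0 <= j < n) e j * (rho%:C * xi) ^+ j.
have bS n : cbmeas (S n).
  apply: cbmeas_sum => j; apply: cbmeasM; first exact: cbmeas_cst.
  by apply: cbmeasX; apply: cbmeasM; [exact: cbmeas_cst|exact: cbmeas_id].
have [|||_ c] := @bounded_ccvg _ v vw (fun n xi => (phi xi)%:C * S n xi * xi^* ^+ k)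
  (fun xi => (phi xi)%:C * ps e (rho%:C * xi) * xi^* ^+ k) (N0 * M * 1).
- by move=> n; apply: cbmeasM => //; exact: cbmeasM.
- move=> n xi xiD; rewrite !cabsM !ler_pM ?mulr_ge0 ?cabs_ge0//.
  + by rewrite cabs_real HN0.
  + apply: le_trans (HM n); apply: le_trans (cabs_sum _ _ _) _; apply: ler_sum => j _.
    rewrite cabsM cabsX ler_wpM2l ?cabs_ge0// lerXn2r// ?nnegrE ?cabs_ge0//.
    by rewrite cabsM cabs_ge0_real// ler_piMr//; exact: ltW.
  + by rewrite cabsX cabsJ exprn_ile1 ?cabs_ge0//; exact: ltW.
- move=> xi xiD; apply: ccvgMr; apply: ccvgMl; apply: (ps_cvg re).
  by rewrite cabsM cabs_ge0_real//; apply: le_lt_trans r1; rewrite ler_piMr//; exact: ltW.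
apply: (ccvg_unique c); apply: cvg_near_cst; exists k.+1 => // n /= kn.
have be j : cbmeas (fun xi => (e j * (rho ^+ j)%:C) * ((phi xi)%:C * (xi ^+ j * xi^* ^+ k))).
  apply: cbmeasM; first exact: cbmeas_cst.
  by apply: cbmeasM => //; apply: cbmeasM => //; apply: cbmeasX; exact: cbmeas_id.
have be' j : cbmeas (fun xi => (phi xi)%:C * (xi ^+ j * xi^* ^+ k)).
  by apply: cbmeasM => //; apply: cbmeasM => //; apply: cbmeasX; exact: cbmeas_id.
rewrite (eq_cint v (G := fun xi => \sum_(0 <= j < n)
   (e j * (rho ^+ j)%:C) * ((phi xi)%:C * (xi ^+ j * xi^* ^+ k)))); last first.
  move=> xi _; rewrite /S mulr_sumr mulr_suml; apply: eq_bigr => j _.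
  by rewrite exprMn rmorphXn; ring.
rewrite cint_sum// (bigD1_seq k) ?mem_index_iota ?iota_uniq ?leq0n ?kn//=.
rewrite [X in _ + X]big1_seq ?addr0 => [|j /andP[jk _]].
  by rewrite cintZ// cint_diagonal.
by rewrite cintZ// (cint_orthogonal vw vr)// mulr0.
Qed.

End fixed_weight.

Lemma moment_one k : dint (fun _ : C => 1 : R) (fun xi => cabs xi ^+ (2 * k)) = k.+1%:R^-1.
Proof.
have <- : moment (fun _ : C => 1 : R) k = dint (fun _ : C => 1 : R) (fun xi => cabs xi ^+ (2 * k)).
  rewrite (moment_dint weight1 radial1 k (phi := fun=> 1))//; [|by exists 1|by move=> r _; rewrite mul1r].
  by apply: eq_dint => z _; rewrite mul1r.
rewrite /moment.
have -> : \int[lebesgue_measure]_(r in `[0%R, 1%R[) (r ^+ (2 * k + 1) * 1 : R) = (2 * k + 2)%:R^-1.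
  transitivity (@beta_fun R (2 * k + 1).+1 1); last by rewrite beta_fun_sym beta_fun1Sn addn2 addn1.
  rewrite /beta_fun -Rintegral_mkcond Rintegral_itv_bndo_bndc//.
  apply: (integrableS _ _ _ (integrable_XMonemX (2 * k + 1) 0)) => //.
  by move=> x /=; rewrite !in_itv/= => /andP[-> /ltW].
have -> : (2 * k + 2)%N = (2 * k.+1)%N by rewrite mulnS addnC.
by rewrite natrM invfM mulrA mulfV ?mul1r// pnatr_eq0.
Qed.

Lemma moment_one_oneBsqr k : dint (fun _ : C => 1 : R)
  (fun xi => (1 - cabs xi ^+ 2) * cabs xi ^+ (2 * k)) = (k.+1%:R * k.+2%:R)^-1.
Proof.
have b n : bmeas (fun xi : C => cabs xi ^+ n) by apply: bmeasX; exact: bmeas_cabs.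
rewrite (@eq_dint _ (fun=> 1) _ (fun xi => cabs xi ^+ (2 * k) - cabs xi ^+ (2 * k.+1))); last first.
  by move=> xi _; rewrite mulrBl mul1r -exprD mulnS.
rewrite dintB//; last exact: weight1.
rewrite !moment_one; have x0 : (0 : R) < k.+1%:R by [].
rewrite -(natr1 k.+1); move: (k.+1%:R : R) x0 => x x0.
by field; apply/andP; split; apply/eqP; lra.
Qed.

End DilatedSeries.

Section RatioMultiplier.
Context {R : realType}.
Local Notation C := R[i].
Local Notation MR := (measurableTypeR R).
Local Notation one := (fun _ : C => 1 : R).
Variable w : C -> R.
Hypothesis hw : classD w.
Let ww := classD_weight hw.
Let wr := classD_radial hw.
Variable a : R.
Hypothesis a0 : 0 < a.
Let lam k := moment w k / moment (shift_weight w a) k.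

(** lambda_k grows at most like a power of k, which does not affect the radius. *)
Lemma radius_ratio (u : nat -> C) : radius_ge 1 u -> radius_ge 1 (fun k => (lam k)%:C * u k).
Proof.
move=> ru; have [c c0 H] := ratio_le hw a0.
pose n := (Num.truncn a).+1.
have an : a <= n%:R by apply/ltW/truncnS_gt.
have rn m : radius_ge 1 (fun k => k.+1%:R ^+ m * u k).
  elim: m => [|m ih]; first by under eq_fun do rewrite expr0 mul1r.
  by under eq_fun do rewrite exprS -mulrA; exact: radius_natS.
apply: (radius_le (A := 2 * c) (rn n)) => k.
rewrite !cabsM cabsX cabs_nat cabs_real ger0_norm ?ratio_ge0// mulrA.
rewrite ler_wpM2r ?cabs_ge0//; apply: le_trans (H k) _.
have k1 : (1 : R) <= k.+1%:R by rewrite ler1n.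
have := powR_le_pow (x := k.+1%:R) (a := a) (n := n) ltac:(by []) ltac:(by rewrite (ltW a0)).
have := exprn_ege1 n k1; nra.
Qed.

(** The moments of 1 - |xi|^2 are 1 / ((k + 1) (k + 2)): differentiation of h compensates k + 1, and
    the factor k + 2 here compensates the rest. *)
Let L k : R := k.+2%:R * lam k.+1.

Let rL : radius_ge 1 (fun k => (L k)%:C).
Proof.
have r1 : radius_ge 1 (fun _ : nat => 1 : C).
  move=> r /andP[r0 r1]; exists 1 => k; rewrite ComplexField.Normc.normc1 mul1r.
  by rewrite exprn_ile1// ltW.
apply: (radius_le (A := 1) (radius_shift (radius_ratio (radius_natS r1)))) => k.
by rewrite mul1r /L mulr1 !cabsM cabs_nat !cabs_real normrM normr_nat mulrC.
Qed.

(** The scheme of [kernel_deriv_integral] with Lebesgue measure, whose tail at max(2 s - 1, 0) is at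
    most 4 (1 - s), and with phi of size (1 - t)^(-a). *)
Lemma ratio_kernel_integral : exists2 c : R, 0 < c & forall z, disc z ->
  dint one (fun xi => cabs (ps (fun k => (L k)%:C) (z * xi^*))) <= c / (1 - cabs z) `^ a.
Proof.
have [c1 c10 H1] := ratio_diffcoef hw a0.
have [c2 c20 H2] := @sum_powR_sqr R a a0.
pose phi t : R := c1 * c2 / (1 - t) `^ a.
have c12 : 0 < c1 * c2 by rewrite mulr_gt0.
have p0 t : t < 1 -> 0 < (1 - t) `^ a by move=> t1; rewrite powR_gt0// subr_gt0.
have phi0 t : 0 <= t < 1 -> 0 < phi t by move=> /andP[_ t1]; rewrite divr_gt0// p0.
have mphi : nondecreasing01 phi.
  move=> s t s0 st t1; rewrite /phi ler_wpM2l ?(ltW c12)//.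
  rewrite lef_pV2 ?posrE ?p0//; last exact: le_lt_trans t1.
  by rewrite ge0_ler_powR ?nnegrE ?(ltW a0)//; lra.
have [|||||c c0 H] := @radial_growth_integral _ one weight1 (fun t => phi t / (1 - t)) (4 * (c1 * c2)) a.
- move=> s t s0 st t1; have q1 := mphi s t s0 st t1.
  have q0 : 0 < phi s by apply: phi0; rewrite s0 (le_lt_trans st).
  rewrite ler_pM ?(ltW q0) ?invr_ge0//; first by lra.
  by rewrite lef_pV2 ?posrE; lra.
- move=> t t01; rewrite divr_ge0 ?(ltW (phi0 t t01))//; by case/andP : t01 => _; lra.
- by [].
- by rewrite mulr_gt0.
- move=> s /[dup] s01 /andP[s0 s1]; set r := Num.max _ _.
  have r01 : 0 <= r < 1 by rewrite /r le_max lexx orbT/= gt_max ltr01 andbT; lra.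
  have rs : 2 * s - 1 <= r by rewrite /r le_max lexx.
  have /andP[_ hr] := tail_one_bounds r01.
  have S0 := p0 s s1; have s10 : 0 < 1 - s by lra.
  apply: (@le_trans _ _ (phi s / (1 - s) * (4 * (1 - s)))).
    rewrite ler_wpM2l ?divr_ge0 ?(ltW (phi0 s s01)) ?(ltW s10)//; lra.
  rewrite /phi le_eqVlt; apply/orP; left; apply/eqP; field.
  by rewrite !gt_eqF.
exists c => // z zD; have z01 : 0 <= cabs z < 1 by rewrite cabs_ge0.
apply: le_trans (H _ z01); apply: (kernel_estimate weight1 radial1) => //.
move=> N t t01.
apply: (@le_trans _ _ (c1 ^+ 2 * \sum_(0 <= k < N) (k.+1%:R `^ a) ^+ 2 * t ^+ (2 * k))).
  rewrite mulr_sumr; apply: ler_sum => k _; rewrite mulrA ler_wpM2r//.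
    by rewrite exprn_ge0//; case/andP : t01.
  rewrite -exprMn -(real_normK (num_real (diffcoef L k))).
  rewrite lerXn2r ?nnegrE ?H1//.
  by rewrite mulr_ge0 ?(ltW c10)// powR_ge0.
apply: le_trans (ler_wpM2l (sqr_ge0 c1) (H2 N t t01)) _.
by rewrite mulrA -exprMn mulrA lexx.
Qed.

Section bloch_function.
Variables (h : C -> C).
Hypothesis hB : Bloch h.
Let c := taylor_coef h.
Let d k := (lam k)%:C * c k.
Let rc : radius_ge 1 c. Proof. exact: bloch_radius. Qed.
Let rd : radius_ge 1 d. Proof. exact: radius_ratio. Qed.

(* With c_{k+1} rho^{k+1} the k-th moment of (1 - |xi|^2) rho h'(rho xi), up to the factor
   k + 2, the dilated multiplier becomes an integral against the kernel with coefficients L. *)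
Let multiplier_dilation (rho : R) (z : C) : 0 <= rho < 1 -> disc z ->
  ps d (rho%:C * z) = d 0%N + z * cint one (fun xi =>
    ((1 - cabs xi ^+ 2)%:C * (rho%:C * ps (dcoef c) (rho%:C * xi))) *
      ps (fun k => (L k)%:C) (z * xi^*)).
Proof.
move=> /[dup] r01 /andP[r0 r1] zD.
have rD : cabs (rho%:C * z) < 1.
  by rewrite cabsM cabs_ge0_real//; apply: le_lt_trans r1; rewrite ler_piMr//; exact: ltW.
have b1 : bmeas (fun xi : C => 1 - cabs xi ^+ 2).
  by apply: bmeasB; [exact: bmeas_cst|apply: bmeasX; exact: bmeas_cabs].
have rdc := radius_dcoef rc.
have bps := ps_dilation_meas weight1 rdc r01.
have bF : cbmeas (fun xi => (1 - cabs xi ^+ 2)%:C * (rho%:C * ps (dcoef c) (rho%:C * xi))).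
  by apply: cbmeasM; [exact: cbmeas_real|apply: cbmeasM => //; exact: cbmeas_cst].
rewrite (cint_ps_bar weight1 rL bF zD).
have [M HM] := ps_summable rd rD.
rewrite {1}/ps (csumS HM) expr0 mulr1; congr (_ + _).
have rd' : radius_ge 1 (fun k => d k.+1 * (rho ^+ k.+1)%:C).
  apply: (radius_le (A := 1) (radius_shift rd)) => k.
  by rewrite cabsM mulrC ler_wpM2r ?cabs_ge0// cabs_ge0_real ?exprn_ge0// exprn_ile1// ltW.
have [M' HM'] := ps_summable rd' zD.
have bE : (fun k => (L k)%:C * cint one (fun xi =>
    (1 - cabs xi ^+ 2)%:C * (rho%:C * ps (dcoef c) (rho%:C * xi)) * xi^* ^+ k)) =
    (fun k => d k.+1 * (rho ^+ k.+1)%:C).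
  apply/funext => k.
  rewrite (eq_cint one (G := fun xi => rho%:C * ((1 - cabs xi ^+ 2)%:C * ps (dcoef c) (rho%:C * xi) * xi^* ^+ k))); last first.
    by move=> xi _; ring.
  rewrite cintZ//; [|exact: weight1|]; last first.
    apply: cbmeasM; first by apply: cbmeasM => //; exact: cbmeas_real.
    by apply: cbmeasX; exact: cbmeasJ cbmeas_id.
  rewrite (cint_dilated_series weight1 radial1)//; last first.
    by move=> u xi u1 _; rewrite cabsM u1 mul1r.
  have k1 : 1 + k%:R != 0 :> C by rewrite addrC natr1 pnatr_eq0.
  have k2 : 2 + k%:R != 0 :> C by rewrite -(natrD _ 2 k) pnatr_eq0.
  rewrite moment_one_oneBsqr /L /d /dcoef exprS; move: (lam k.+1) => y.
  rewrite !rmorphM !fmorphV !rmorphM !rmorph_nat; field.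
  by rewrite k1 k2.
rewrite bE /ps -(csumZ _ HM'); congr csum; apply/funext => k.
rewrite exprMn rmorphXn (exprS z); move: (d k.+1) => y.
by rewrite -!mulrA [RHS]mulrCA [in LHS](mulrCA _ z).
Qed.

(** z is written as rho z' with rho = (1 + |z|) / 2: then z' lies in the disc and 1 - |z'| >= (1 -
    |z|) / 2, which is the origin of 2^a. *)
Lemma multiplier_growth : exists K : R, forall z, disc z ->
  (1 - cabs z) `^ a * cabs (ps d z) <= K.
Proof.
have [B B0 HB] := bloch_deriv_bound hB; have [k0 k00 Hk] := ratio_kernel_integral.
exists (cabs (d 0%N) + B * k0 * 2 `^ a) => z zD.
set t := cabs z; have t0 : 0 <= t by exact: cabs_ge0.
have t1 : t < 1 by [].
pose rho : R := (1 + t) / 2.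
have r01 : 0 <= rho < 1 by rewrite /rho; lra.
have rp : 0 < rho by rewrite /rho; lra.
have rC : rho%:C != 0 by apply/eqP => -[] e; move: rp; rewrite e ltxx.
pose z' := rho%:C^-1 * z.
have z'E : cabs z' = t / rho by rewrite /z' cabsM cabsV cabs_ge0_real ?(ltW rp)// mulrC.
have z'D : disc z' by rewrite /disc/mkset z'E ltr_pdivrMr// mul1r /rho; lra.
have -> : z = rho%:C * z' by rewrite mulVKf.
rewrite multiplier_dilation//.
have bp := ps_dilation_meas weight1 (radius_dcoef rc) r01.
have bF : cbmeas (fun xi => (1 - cabs xi ^+ 2)%:C * (rho%:C * ps (dcoef c) (rho%:C * xi))).
  apply: cbmeasM; last by apply: cbmeasM => //; exact: cbmeas_cst.
  by apply: cbmeas_real; apply: bmeasB; [exact: bmeas_cst|apply: bmeasX; exact: bmeas_cabs].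
(* Since 1 - |xi|^2 <= 1 - |rho xi|^2, the Bloch bound at rho xi applies, uniformly in rho. *)
have FB xi : disc xi -> cabs ((1 - cabs xi ^+ 2)%:C * (rho%:C * ps (dcoef c) (rho%:C * xi))) <= B.
  move=> xiD; have rxE : cabs (rho%:C * xi) = rho * cabs xi by rewrite cabsM cabs_ge0_real// ltW.
  have x0 := cabs_ge0 xi; have x1 : cabs xi < 1 by [].
  have rx : rho * cabs xi <= cabs xi by rewrite ler_piMl//; lra.
  have rxD : disc (rho%:C * xi) by rewrite /disc/mkset rxE (le_lt_trans rx).
  have <- : derive1 h (rho%:C * xi) = ps (dcoef c) (rho%:C * xi).
    apply: cderiv_derive1; apply: (cderiv_congr (rho := 1) (g := ps c)) => //.
      by move=> x xD; exact: bloch_taylor.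
    exact: ps_deriv rc rxD.
  apply: le_trans (HB _ rxD); have q0 : 0 <= 1 - cabs xi ^+ 2 by nra.
  rewrite !cabsM (cabs_ge0_real q0) (cabs_ge0_real (ltW rp)) mulrA ler_wpM2r ?cabs_ge0//.
  apply: (@le_trans _ _ (1 - cabs xi ^+ 2)); first by rewrite ler_piMr//; lra.
  by rewrite lerD2l lerN2 lerXn2r// nnegrE// mulr_ge0// ltW.
have [bps _] := ps_bar_meas weight1 rL z'D.
have hI := cabs_cint_le weight1 bF bps FB.
have tp : 0 < 1 - t by rewrite subr_gt0.
have p0 : 0 < (1 - t) `^ a by rewrite powR_gt0.
have p1 : (1 - t) `^ a <= 1 by apply: powR_le1; [lra|exact: ltW].
have hz : (1 - t) `^ a <= 2 `^ a * (1 - cabs z') `^ a.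
  rewrite -powRM//; last by rewrite subr_ge0 ltW.
  rewrite ge0_ler_powR ?nnegrE ?(ltW a0) ?(ltW tp)//.
    by rewrite mulr_ge0// subr_ge0 ltW.
  have h1 : t / rho <= (1 + t) / 2 by rewrite ler_pdivrMr// /rho; nra.
  by rewrite z'E; lra.
have q0 : 0 < (1 - cabs z') `^ a by rewrite powR_gt0// subr_gt0.
apply: (@le_trans _ _ ((1 - t) `^ a * (cabs (d 0%N) + B * (k0 / (1 - cabs z') `^ a)))).
  rewrite ler_wpM2l ?(ltW p0)//; apply: le_trans (cabsD _ _) _; rewrite lerD2l cabsM.
  apply: (@le_trans _ _ (1 * (B * dint one (fun xi => cabs (ps (fun k => (L k)%:C) (z' * xi^*)))))).
    by rewrite ler_pM ?cabs_ge0//; exact: ltW.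
  by rewrite mul1r ler_wpM2l// Hk.
rewrite mulrDr lerD//; first by rewrite ler_piMl ?cabs_ge0.
have -> : B * k0 * 2 `^ a = 2 `^ a * (1 - cabs z') `^ a * (B * (k0 / (1 - cabs z') `^ a)).
  by field; rewrite gt_eqF.
by rewrite ler_wpM2r// mulr_ge0// divr_ge0// ltW.
Qed.

Let g (z : C) := ((1 - cabs z) `^ a)%:C * ps d z.
Let rho_ n : R := 1 - n.+2%:R^-1.

Let rho01 n : 0 <= rho_ n < 1.
Proof.
have n0 : (0 : R) < n.+2%:R^-1 by rewrite invr_gt0.
have n1 : n.+2%:R^-1 <= (1 : R) by rewrite invf_le1// ler1n.
by rewrite /rho_; move: (n.+2%:R^-1) n0 n1 => x *; lra.
Qed.

Let cvg_rho : rho_ @ \oo --> (1 : R).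
Proof.
rewrite -[X in _ --> X](subr0 1); apply: cvgB; first exact: cvg_cst.
by rewrite (cvg_shiftS (fun n => n.+1%:R^-1 : R)); exact: cvg_harmonic.
Qed.

Let bshift : bmeas (fun z : C => (1 - cabs z) `^ a).
Proof. exact: bmeas_shift_factor. Qed.

Let g_dilation n (z : C) := ((1 - cabs z) `^ a)%:C * ps d ((rho_ n)%:C * z).

(** |rho z| <= |z| gives (1 - |z|)^a <= (1 - |rho z|)^a, so the growth bound at rho z yields the
    same K for all n. *)
Let g_dilation_bound (K : R) : (forall z, disc z -> (1 - cabs z) `^ a * cabs (ps d z) <= K) ->
  forall n z, disc z -> cabs (g_dilation n z) <= K.
Proof.
move=> HK n z zD; have /andP[r0 r1] := rho01 n.
have rz : cabs ((rho_ n)%:C * z) <= cabs z by rewrite cabsM cabs_ge0_real// ler_piMl ?cabs_ge0// ltW.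
have rD : disc ((rho_ n)%:C * z) by exact: le_lt_trans zD.
apply: le_trans (HK _ rD); rewrite /g_dilation [leLHS]cabsM (cabs_ge0_real (powR_ge0 _ _)).
rewrite ler_wpM2r ?cabs_ge0// ge0_ler_powR ?nnegrE ?(ltW a0) ?subr_ge0 ?(ltW zD)//.
  exact: ltW.
by rewrite lerD2l lerN2.
Qed.

Let g_dilation_cvg z : disc z -> (fun n => g_dilation n z) @ \oo --> g z.
Proof.
move=> zD; apply: ccvgMl; apply/cvgCP/cvgrPdist_lt => e e0.
have [del del0 H] := cderiv_cont (ps_deriv rd zD) e0.
move/cvgrPdist_lt : cvg_rho => /(_ _ del0); apply: filterS => n hn.
rewrite sub0r normrN ger0_norm ?cabs_ge0//.
have -> : (rho_ n)%:C * z = z + (rho_ n - 1)%:C * z by move: (rho_ n) => r; rewrite rmorphB rmorph1; ring.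
apply: H; rewrite cabsM cabs_real distrC; apply: le_lt_trans hn.
by rewrite ler_piMr//; exact: ltW.
Qed.

(** Dilated by rho, the k-th moment is m_k c_k rho^k, because lambda_k times the shifted moment is
    m_k. The dilations share one bound, so bounded convergence lets rho tend to 1. *)
Lemma multiplier_moments : exists K : R, [/\ cbmeas g, forall z, disc z -> cabs (g z) <= K &
  forall k, cint w (fun xi => g xi * xi^* ^+ k) = (moment w k)%:C * c k].
Proof.
have [K HK] := multiplier_growth; exists K.
have bd n : cbmeas (g_dilation n).
  have bp := ps_dilation_meas weight1 rd (rho01 n).
  by apply: cbmeasM => //; exact: cbmeas_real.
have [|||bg _] := @bounded_ccvg _ w ww g_dilation g K => //; first exact: g_dilation_bound.
split => // [z zD|k].
  by rewrite cabsM cabs_ge0_real ?powR_ge0 ?HK.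
have bJ : cbmeas (fun xi : C => xi^* ^+ k) by apply: cbmeasX; exact: cbmeasJ cbmeas_id.
have [|||_ cv] := @bounded_ccvg _ w ww (fun n xi => g_dilation n xi * xi^* ^+ k)
   (fun xi => g xi * xi^* ^+ k) (K * 1).
- by move=> n; exact: cbmeasM (bd n) bJ.
- move=> n xi xiD; rewrite cabsM ler_pM ?cabs_ge0 ?g_dilation_bound//.
  by rewrite cabsX cabsJ exprn_ile1 ?cabs_ge0//; exact: ltW.
- by move=> xi xiD; apply: ccvgMr; exact: g_dilation_cvg.
apply: (ccvg_unique cv).
have E1 n : cint w (fun xi => g_dilation n xi * xi^* ^+ k) =
    (moment w k)%:C * c k * (rho_ n ^+ k)%:C.
  rewrite (cint_dilated_series ww wr)//; last by move=> u xi u1 _; rewrite cabsM u1 mul1r.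
  rewrite -moment_shift_classD// /d /lam rmorphM fmorphV; field.
  by rewrite (inj_eq (@complexI R)) gt_eqF// moment_shift_gt0.
have rk m : (fun n => rho_ n ^+ m) @ \oo --> (1 : R).
  elim: m => [|m ih]; first exact: cvg_cst.
  have h1 : (fun n => rho_ n * rho_ n ^+ m) @ \oo --> (1 * 1 : R) := cvgM cvg_rho ih.
  rewrite mulr1 in h1.
  have -> : (fun n => rho_ n ^+ m.+1) = (fun n => rho_ n * rho_ n ^+ m) by apply/funext => n; rewrite exprS.
  exact: h1.
have rkC : (fun n => (rho_ n ^+ k)%:C) @ \oo --> (1 : C).
  by apply: cvg_ReIm => /=; [exact: rk k|exact: cvg_cst].
have hh := ccvgMl (c := (moment w k)%:C * c k) rkC; rewrite mulr1 in hh.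
exact: (eq_ccvg (fun n => esym (E1 n)) hh).
Qed.

End bloch_function.

Lemma bergman_proj_multiplier (h : C -> C) : Bloch h ->
  let g := fun z : C => ((1 - cabs z) `^ a)%:C * Rmult w (shift_weight w a) h z in
  Linfty g /\ forall z, disc z -> bergman_proj w g z = h z.
Proof.
move=> hB g; have [K [bg gK Hg]] := multiplier_moments hB.
have gL : Linfty g := Linfty_bounded bg gK.
split => // z zD; rewrite (bloch_taylor hB zD).
apply: (bergman_proj_coef hw gL zD) => k; rewrite -Hg.
rewrite /cintegral /cint /dint; congr (_ +i* _); apply: eq_Rintegral => p _.
  exact: cRe_scale.
exact: cIm_scale.
Qed.

End RatioMultiplier.

Theorem theorem5 (R : realType) (w : R[i] -> R) (hw : classD w) :
  (exists M : R, forall f : R[i] -> R[i], Linfty f ->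
     Bloch (bergman_proj w f) /\
     (bloch_norm (bergman_proj w f) <= M%:E * Linfty_norm f)%E) /\
  (forall h : R[i] -> R[i], Bloch h ->
     exists f : R[i] -> R[i], Linfty f /\
       forall z, disc z -> bergman_proj w f z = h z) /\
  (forall (a : R) (h : R[i] -> R[i]), 0 < a -> Bloch h ->
     let g := fun z : R[i] =>
       ((1 - cabs z) `^ a)%:C * Rmult w (shift_weight w a) h z in
     Linfty g /\ forall z, disc z -> bergman_proj w g z = h z).
Proof.
split; first exact: bergman_proj_bounded hw.
split=> [h hB|a h a0 hB]; last exact (bergman_proj_multiplier hw a0 hB).
(* For surjectivity any positive exponent gives a preimage; a = 1 is taken. *)
have [gL gh] := bergman_proj_multiplier hw ltr01 hB.
by eexists; split; [exact: gL|exact: gh].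
Qed.
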